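(* Let $d\ge 2$ and $a>0$, and consider the critical Ising model on $a\mathbb{Z}^d$ with fixed magnetic field $\tilde h>0$. Then for any $n\in\mathbb{N}$ and any distinct $s_1,\dots,s_n\in a\mathbb{Z}$, $$\left(\hat X^a_L(s_1),\dots,\hat X^a_L(s_n)\right)\Rightarrow\left(\hat X^a(s_1),\dots,\hat X^a(s_n)\right)\quad\text{as }L\uparrow\infty,$$ where $\Rightarrow$ denotes convergence in distribution and $\{\hat X^a(s):s\in a\mathbb{Z}\}$ is a mean-zero stationary Gaussian process with covariance function $$\mathrm{Cov}(\hat X^a(s),\hat X^a(t))=\hat K^a(t-s):=\frac{\sum_{\vec y\in a\mathbb{Z}^{d-1}}\langle\sigma_{(0,\vec 0)};\sigma_{(t-s,\vec y)}\rangle}{\sum_{\vec y\in a\mathbb{Z}^{d-1}}\langle\sigma_{(0,\vec 0)};\sigma_{(0,\vec y)}\rangle}\quad\text{for } s,t\in a\mathbb{Z}.$$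
   Context: The critical Ising model on $a\mathbb{Z}^d$ with magnetic field $\tilde h$ is the infinite-volume nearest-neighbour ferromagnetic Ising measure on $\{-1,1\}^{a\mathbb{Z}^d}$ at the critical inverse temperature $\beta_c=\beta_c(d)$ of $\mathbb{Z}^d$, i.e. the Gibbs measure with formal weight proportional to $\exp\big(\beta_c\sum_{\{x,y\}}\sigma_x\sigma_y+\tilde h\sum_x\sigma_x\big)$, the first sum running over nearest-neighbour pairs of $a\mathbb{Z}^d$. $\langle\cdot\rangle$ denotes its expectation. For $z,w\in a\mathbb{Z}^d$, $\langle\sigma_z;\sigma_w\rangle:=\langle\sigma_z\sigma_w\rangle-\langle\sigma_z\rangle\langle\sigma_w\rangle$. Points of $a\mathbb{Z}^d$ are written $x=(t,\vec y)$ with $t\in a\mathbb{Z}$ and $\vec y\in a\mathbb{Z}^{d-1}$. For $s\in\mathbb{R}$, $s_a$ is a point of $a\mathbb{Z}$ closest to $s$ (so $s_a=s$ if $s\in a\mathbb{Z}$). For $L>0$ and $s\in\mathbb{R}$, $$\hat X^a_L(s):=\frac{\sum_{\vec y\in a\mathbb{Z}^{d-1}\cap[-L,L]^{d-1}}\left[\sigma_{(s_a,\vec y)}-\langle\sigma_{(s_a,\vec y)}\rangle\right]}{\sqrt{\mathrm{Var}\left(\sum_{\vec y\in a\mathbb{Z}^{d-1}\cap[-L,L]^{d-1}}\sigma_{(s_a,\vec y)}\right)}},$$ where the variance is with respect to the same Ising measure. *)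

(* Defs.v *)
From HB Require Import structures.
From mathcomp Require Import all_boot all_order all_algebra.
From mathcomp Require Import finmap.
From mathcomp Require Import all_classical all_reals all_analysis.

Set Implicit Arguments.
Unset Strict Implicit.
Unset Printing Implicit Defensive.

Import Order.TTheory GRing.Theory Num.Theory.
Import numFieldNormedType.Exports.

Local Open Scope classical_set_scope.
Local Open Scope ring_scope.

(* For d >= 1, the pair (k, v) : int * int^(d-1) is the index of the point
   (a k, a v) of the lattice a Z^d, the first coordinate being the time t and
   the others the vector y.  The spacing a enters only through this labelling:
   the Ising measure itself is a measure on spin configurations indexed by
   [site d]. *)
Definition site (d : nat) : Type := (int * 'rV[int]_d.-1)%type.
HB.instance Definition _ d := Countable.on (site d).
HB.instance Definition _ d := GRing.Zmodule.on (site d).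

(* [true] encodes the spin +1 and [false] the spin -1. *)
Definition cylinders (d : nat) : set (set (site d -> bool)) :=
  [set A | exists (x : site d) (b : bool), A = [set eta | eta x = b]].

Definition config (d : nat) : Type := g_sigma_algebraType (@cylinders d).
HB.instance Definition _ d := Measurable.on (config d).

Section ising.
Context {R : realType}.

Definition spin d (x : site d) (eta : config d) : R :=
  if eta x then 1 else -1.

(* The d coordinate unit vectors: every nearest-neighbour pair is {x, x + e}
   for exactly one site x and one unit vector e. *)
Definition unit_vectors d : seq (site d) :=
  (1, 0) :: [seq (0, delta_mx 0 i) | i <- enum 'I_d.-1].

(* Sites x such that the pair {x, x + e} meets Lam. *)
Definition bond_bases d (Lam : {fset site d}) (e : site d) : {fset site d} :=
  (Lam `|` [fset (x - e)%R | x in Lam])%fset.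

(* Unnormalised Gibbs weight of eta in the finite volume Lam: all pairs that
   meet Lam interact, so eta outside Lam acts as a boundary condition. *)
Definition boltzmann d (beta h : R) (Lam : {fset site d}) (eta : config d) : R :=
  expR (beta * (\sum_(e <- unit_vectors d) \sum_(x <- bond_bases Lam e)
                  spin x eta * spin (x + e) eta)
        + h * \sum_(x <- Lam) spin x eta).

Definition glue d (Lam : {fset site d}) (tau : {ffun Lam -> bool})
    (eta : config d) : config d :=
  fun x => if insub x is Some u then tau u else eta x.

Definition partition_function d (beta h : R) (Lam : {fset site d})
    (eta : config d) : R :=
  \sum_(tau : {ffun Lam -> bool}) boltzmann beta h Lam (glue tau eta).

Definition finite_volume_avg d (beta h : R) (Lam : {fset site d})
    (eta : config d) (f : config d -> R) : R :=
  (\sum_(tau : {ffun Lam -> bool})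
      f (glue tau eta) * boltzmann beta h Lam (glue tau eta))
  / partition_function beta h Lam eta.

(* Infinite-volume Gibbs measures, through the Dobrushin-Lanford-Ruelle
   equations. *)
Definition ising_measure d (beta h : R) (mu : probability (config d) R) : Prop :=
  forall (Lam : {fset site d}) (A : set (config d)), measurable A ->
    mu A = (\int[mu]_eta
              (finite_volume_avg beta h Lam eta (\1_A : config d -> R))%:E)%E.

Definition box d (n : nat) : {fset site d} :=
  fset_set [set x : site d | `|x.1| <= n%:Z /\ forall i, `|x.2 0 i| <= n%:Z].

Definition all_plus d : config d := fun=> true.
Arguments all_plus : clear implicits.

(* Spontaneous magnetisation <sigma_0>^+_{beta, h = 0}. *)
Definition magnetisation_plus d (beta : R) : R :=
  limn (fun n => finite_volume_avg beta 0 (box d n) (all_plus d) (spin 0)).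

Definition beta_c d : R :=
  inf [set beta | 0 <= beta /\ 0 < magnetisation_plus d beta].

(* The expectation < f > as a real number; all observables below are bounded. *)
Definition avg d (mu : probability (config d) R) (f : config d -> R) : R :=
  fine ('E_mu[f])%E.

Definition truncated d (mu : probability (config d) R) (z w : site d) : R :=
  avg mu (fun eta => spin z eta * spin w eta) - avg mu (spin z) * avg mu (spin w).

Definition lattice (a : R) : set R := [set s | exists k : int, s = a * k%:~R].

(* s_a = a * nearest a s is a point of a Z closest to s. *)
Definition nearest (a s : R) : int := Num.floor (s / a + 2^-1).

(* Indices of the points of a Z^(d-1) in [-L, L]^(d-1). *)
Definition slice d (a L : R) : set 'rV[int]_d.-1 :=
  [set y | forall i, `|a * (y 0 i)%:~R| <= L].
Arguments slice : clear implicits.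

Definition slice_sum d (a L s : R) (eta : config d) : R :=
  \sum_(y \in slice d a L) spin ((nearest a s, y) : site d) eta.

Definition centred_slice_sum d (mu : probability (config d) R) (a L s : R)
    (eta : config d) : R :=
  \sum_(y \in slice d a L)
    (spin ((nearest a s, y) : site d) eta
     - avg mu (spin ((nearest a s, y) : site d))).

Definition Xhat d (mu : probability (config d) R) (a L s : R)
    (eta : config d) : R :=
  centred_slice_sum mu a L s eta
  / Num.sqrt (fine ('V_mu[(slice_sum a L s : config d -> R)])%E).

Definition slice_truncated d (mu : probability (config d) R) (a u : R)
    (y : 'rV[int]_d.-1) : R :=
  truncated mu (0 : site d) (nearest a u, y).

(* Sum of an absolutely summable real family. *)
Definition family_sum (I : choiceType) (f : I -> R) : R :=
  fine (\esum_(i in [set: I]) (f^\+ i)%:E)%E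
  - fine (\esum_(i in [set: I]) (f^\- i)%:E)%E.

Definition Khat d (mu : probability (config d) R) (a u : R) : R :=
  family_sum (slice_truncated mu a u) / family_sum (slice_truncated mu a 0).

(* Normal laws, including the degenerate ones; [normal_prob m 0] is not the
   Dirac mass at m. *)
Definition gaussian_law (nu : set R -> \bar R) : Prop :=
  exists m s : R, 0 <= s /\ forall A : set R, measurable A ->
    nu A = if s == 0 then \d_m A else normal_prob m s A.

Section processes.
Context {dO} {Omega : measurableType dO} (P : probability Omega R).
Implicit Types (T : set R) (X : R -> {RV P >-> R}).

(* Processes indexed by T; the variables X s with s outside T play no role. *)
Definition gaussian_process T X : Prop :=
  forall (n : nat) (s c : 'I_n -> R), (forall i, T (s i)) ->
    gaussian_law (pushforward P (fun w => \sum_(i < n) c i * X (s i) w)).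

Definition stationary_process T X : Prop :=
  forall (n : nat) (s : 'I_n -> R) (u : R),
    (forall i, T (s i)) -> (forall i, T (s i + u)) ->
    forall B : set (n.-tuple R), measurable B ->
      P [set w | B [tuple X (s i + u) w | i < n]]
      = P [set w | B [tuple X (s i) w | i < n]].

Definition mean_zero T X : Prop := forall s, T s -> ('E_P[X s] = 0)%E.

Definition has_covariance T X (K : R -> R -> R) : Prop :=
  forall s t, T s -> T t -> covariance P (X s) (X t) = (K s t)%:E.

End processes.

(* Convergence in distribution, as L tends to +oo, of random vectors that may
   live on a different probability space from the limit. *)
Definition cvg_in_distribution d1 d2 (S1 : measurableType d1)
    (S2 : measurableType d2) (P1 : probability S1 R) (P2 : probability S2 R)
    (n : nat) (Y : R -> S1 -> 'rV[R]_n) (Z : S2 -> 'rV[R]_n) : Prop :=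
  forall f : 'rV[R]_n -> R, continuous f ->
    (exists M : R, forall v, `|f v| <= M) ->
    ('E_P1[f \o Y L])%E @[L --> +oo] --> ('E_P2[f \o Z])%E.

End ising.

(* Main.v *)
(* A magnetic field h > 0 makes the Ising model at any inverse temperature beta >= 0
   amenable to Newman's central limit theorem, and criticality plays no role.  By
   the GHS inequality truncated correlations decrease in the field, so their sum is
   at most 2 / h, and the magnetisations with plus and minus boundary conditions
   agree; hence every Gibbs measure is the translation invariant limit of the
   finite-volume measures with plus boundary conditions and satisfies FKG.  Cutting
   the slices into large cells, Newman's inequality factorises characteristic
   functions of linear combinations of the slice sums up to the correlations across
   cells, and summability makes the covariances per site converge to the K(t).  The
   limit law follows from Levy's continuity theorem.  The Gaussian process is a
   triangular transform, obtained by successive Schur complements, of independent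
   normal variables on the space of coin tossings. *)

Require Import Defs.
From HB Require Import structures.
From mathcomp Require Import all_boot all_order all_algebra.
From mathcomp Require Import finmap.
From mathcomp Require Import all_classical all_reals all_analysis.
From mathcomp Require Import measurable_realfun ring lra zify.

Set Implicit Arguments.
Unset Strict Implicit.
Unset Printing Implicit Defensive.

Import Order.TTheory GRing.Theory Num.Theory.
Import numFieldNormedType.Exports.

Local Open Scope classical_set_scope.
Local Open Scope ring_scope.

(** * Finite-volume correlation inequalities and uniqueness *)

(** The obstacle is that correlations are known to be summable, but with no rate of decay. Hence the
    cells have a fixed size, chosen from the required precision before the slices grow, and the
    position of the grid is selected by averaging instead of leaving corridors between blocks. Spins
    are bounded and the normalising factor tends to 0, so a Taylor expansion on each cell replaces a
    Lindeberg condition. That factor is small because a slice of dimension d - 1 >= 1 has more and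
    more sites and, by FKG, a variance at least proportional to their number. The GHS inequality is
    proved for plus boundary conditions only. This suffices, since every Gibbs measure turns out to
    be a limit of such finite-volume measures. For uniqueness, partition functions are compared at
    two fields h' < h, which avoids differentiating the pressure; the 2 / h bound then lets h' tend
    to h. Characteristic functions stay real: cosines and sines are estimated together, or a phase
    is carried inside the cosine. In infinite volume everything is reduced to local functions, to
    which the DLR equations extend by linearity. *)

Section iterated_sums.
Context {R : realType} {T : choiceType} {A : finType}.
Implicit Types (s : seq T) (F G : (T -> A) -> R) (eta : T -> A).

Definition upd eta x a : T -> A := fun y => if y == x then a else eta y.

(** Summation over the spins in a list with the other sites frozen at [eta]. The recursion on the
    list is what permits induction one site at a time; the order is immaterial by [perm_sumv]. *)
Fixpoint sumv s F eta : R :=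
  if s is x :: s' then \sum_a sumv s' F (upd eta x a) else F eta.

Definition indep_of s F := forall x a eta, x \in s -> F (upd eta x a) = F eta.

Lemma eq_sumv s F G eta : (forall xi, F xi = G xi) -> sumv s F eta = sumv s G eta.
Proof.
by move=> FG; elim: s eta => [|x s IH] eta //=; apply: eq_bigr => a _; exact: IH.
Qed.

Lemma sumv_cat s1 s2 F eta : sumv (s1 ++ s2) F eta = sumv s1 (sumv s2 F) eta.
Proof. by elim: s1 eta => [|x s IH] eta //=; apply: eq_bigr => a _; exact: IH. Qed.

Lemma sumvD s F G eta :
  sumv s (fun xi => F xi + G xi) eta = sumv s F eta + sumv s G eta.
Proof.
elim: s eta => [|x s IH] eta //=; rewrite -big_split /=.
by apply: eq_bigr => a _; exact: IH.
Qed.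

Lemma sumvM s c F eta : indep_of s c ->
  sumv s (fun xi => c xi * F xi) eta = c eta * sumv s F eta.
Proof.
elim: s eta => [|x s IH] eta //= Hc; rewrite mulr_sumr; apply: eq_bigr => a _.
rewrite IH; first by rewrite Hc ?mem_head.
by move=> y b xi ys; rewrite Hc // in_cons ys orbT.
Qed.

Lemma sumvZ s (c : R) F eta : sumv s (fun xi => c * F xi) eta = c * sumv s F eta.
Proof. exact: (@sumvM s (fun=> c)). Qed.

Lemma sumv0 s eta : sumv s (fun=> 0) eta = 0.
Proof. by rewrite -[RHS](mul0r (sumv s (fun=> 0) eta)) -sumvZ; apply: eq_sumv => xi; rewrite mul0r. Qed.

Lemma sumvB s F G eta :
  sumv s (fun xi => F xi - G xi) eta = sumv s F eta - sumv s G eta.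
Proof.
by rewrite sumvD; congr (_ + _); rewrite -mulN1r -sumvZ; apply: eq_sumv => xi; rewrite mulN1r.
Qed.

Lemma sumv_sum s (I : Type) (r : seq I) (P : pred I) (F : I -> (T -> A) -> R) eta :
  sumv s (fun xi => \sum_(i <- r | P i) F i xi) eta
  = \sum_(i <- r | P i) sumv s (F i) eta.
Proof.
elim: r => [|i r IH].
  by rewrite big_nil -[RHS](sumv0 s eta); apply: eq_sumv => xi; rewrite big_nil.
rewrite big_cons -IH; case: ifP => Pi; last first.
  by apply: eq_sumv => xi; rewrite big_cons Pi.
by rewrite -sumvD; apply: eq_sumv => xi; rewrite big_cons Pi.
Qed.

Lemma ler_sumv s F G eta : (forall xi, F xi <= G xi) -> sumv s F eta <= sumv s G eta.
Proof.
by move=> FG; elim: s eta => [|x s IH] eta //=; apply: ler_sum => a _; exact: IH.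
Qed.

Lemma sumv_ge0 s F eta : (forall xi, 0 <= F xi) -> 0 <= sumv s F eta.
Proof. by move=> F0; rewrite -(sumv0 s eta); exact: ler_sumv. Qed.

Lemma sumv_gt0 s F eta : (0 < #|A|)%N -> (forall xi, 0 < F xi) -> 0 < sumv s F eta.
Proof.
move=> /card_gt0P [a0 _] F0; elim: s eta => [|x s IH] eta //=.
rewrite (bigD1 a0) //= ltr_pwDl //; apply: sumr_ge0 => a _; exact/ltW.
Qed.

Fixpoint confs s eta : seq (T -> A) :=
  if s is x :: s' then flatten [seq confs s' (upd eta x a) | a <- enum A] else [:: eta].

Lemma sumv_confs s F eta : sumv s F eta = \sum_(xi <- confs s eta) F xi.
Proof.
elim: s eta => [|x s IH] eta /=; first by rewrite big_seq1.
by rewrite big_flatten big_map big_enum /=; apply: eq_bigr => a _; rewrite IH.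
Qed.

Lemma mem_confs s eta xi : uniq s ->
  (xi \in confs s eta) = `[< forall x, x \notin s -> xi x = eta x >].
Proof.
elim: s eta => [|x s IH] eta /=.
  move=> _; rewrite inE; apply/eqP/asboolP => [-> //|H].
  by apply/funext => x; exact: H.
case/andP=> xs us; apply/flattenP/asboolP => [[l /mapP [a _ ->]]|H].
  rewrite IH // => /asboolP H y; rewrite in_cons negb_or => /andP [yx ys].
  by rewrite H // /upd (negbTE yx).
exists (confs s (upd eta x (xi x))); first by apply: map_f; rewrite mem_enum.
rewrite IH //; apply/asboolP => y ys; rewrite /upd; case: eqVneq => [-> //|yx].
by apply: H; rewrite in_cons negb_or yx.
Qed.

Lemma uniq_confs s eta : uniq s -> uniq (confs s eta).
Proof.
elim: s eta => [|x s IH] eta //= /andP [xs us].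
elim: (enum A) (enum_uniq A) => [|a l IHl] //= /andP [al ul].
rewrite cat_uniq IH // IHl // andbT /=; apply/hasPn => xi /flattenP [l' /mapP [b bl ->]].
rewrite !mem_confs // => /asboolP H; apply/asboolP => H'.
move: (H x xs); rewrite H' // /upd eqxx => ab; by move: al; rewrite ab bl.
Qed.

(** Both sides run over the configurations that agree with [eta] off the list. This set ignores the
    order, and [uniq] ensures that each of them is listed once. *)
Lemma perm_sumv s1 s2 F eta : uniq s1 -> perm_eq s1 s2 -> sumv s1 F eta = sumv s2 F eta.
Proof.
move=> u1 p12; have u2 : uniq s2 by rewrite -(perm_uniq p12).
rewrite !sumv_confs; apply/perm_big/uniq_perm; rewrite ?uniq_confs // => xi.
rewrite !mem_confs //; apply: asbool_equiv_eq.
by split=> H x xs; apply: H; rewrite ?(perm_mem p12) // -(perm_mem p12).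
Qed.

End iterated_sums.

(** Two independent replicas; used twice, it gives the four replicas of the GHS argument. *)
Lemma sumv_pair {R : realType} {T : choiceType} {A B : finType} (s : seq T)
    (F : (T -> A) -> R) (G : (T -> B) -> R) (eta : T -> A * B) :
  sumv s (fun xi => F (fst \o xi) * G (snd \o xi)) eta
  = sumv s F (fst \o eta) * sumv s G (snd \o eta).
Proof.
elim: s eta => [|x s IH] eta //=.
rewrite big_distrl /=; under [RHS]eq_bigr do rewrite big_distrr /=.
rewrite pair_big /=; apply: eq_bigr => -[a b] _; rewrite IH.
have -> : fst \o upd eta x (a, b) = upd (fst \o eta) x a.
  by apply/funext => y; rewrite /upd /=; case: eqP.
suff -> : snd \o upd eta x (a, b) = upd (snd \o eta) x b by [].
by apply/funext => y; rewrite /upd /=; case: eqP.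
Qed.

(** * The four functions theorem and the Holley and FKG inequalities *)

Section four_functions.
Context {R : realType} {T : choiceType}.
Implicit Types (s : seq T) (f g w : (T -> bool) -> R) (eta xi : T -> bool).

Definition lec eta xi := forall x, eta x ==> xi x.
Definition joinc eta xi : T -> bool := fun x => eta x || xi x.
Definition meetc eta xi : T -> bool := fun x => eta x && xi x.
Definition increasing f := forall eta xi, lec eta xi -> f eta <= f xi.
(** The FKG lattice condition. *)
Definition log_supermodular w :=
  forall eta xi, w eta * w xi <= w (joinc eta xi) * w (meetc eta xi).

Lemma lec_joinl eta xi : lec eta (joinc eta xi).
Proof. by move=> x; rewrite /joinc; case: (eta x). Qed.

Lemma lec_joinr eta xi : lec xi (joinc eta xi).
Proof. by move=> x; rewrite /joinc orbC; case: (xi x). Qed.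

(** Only the mixed terms need an argument. With p and q the mixed products on the left, u = c1 d0
    and v = c0 d1, one has p, q <= u and p q <= u v, so (u - p)(u - q) >= 0 yields u (p + q) <= u^2
    + p q <= u (u + v). *)
Lemma four_functions_site (a0 a1 b0 b1 c0 c1 d0 d1 : R) :
  0 <= a0 -> 0 <= a1 -> 0 <= b0 -> 0 <= b1 ->
  0 <= c0 -> 0 <= c1 -> 0 <= d0 -> 0 <= d1 ->
  a0 * b0 <= c0 * d0 -> a0 * b1 <= c1 * d0 ->
  a1 * b0 <= c1 * d0 -> a1 * b1 <= c1 * d1 ->
  (a0 + a1) * (b0 + b1) <= (c0 + c1) * (d0 + d1).
Proof.
move=> a00 a10 b00 b10 c00 c10 d00 d10 h00 h01 h10 h11.
have u0 : 0 <= c1 * d0 by exact: mulr_ge0.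
have v0 : 0 <= c0 * d1 by exact: mulr_ge0.
have p0 : 0 <= a0 * b1 by exact: mulr_ge0.
have q0 : 0 <= a1 * b0 by exact: mulr_ge0.
suff H : a0 * b1 + a1 * b0 <= c1 * d0 + c0 * d1 by nra.
have pq : (a0 * b1) * (a1 * b0) <= (c1 * d0) * (c0 * d1).
  have -> : (a0 * b1) * (a1 * b0) = (a0 * b0) * (a1 * b1) by ring.
  have -> : (c1 * d0) * (c0 * d1) = (c0 * d0) * (c1 * d1) by ring.
  by apply: ler_pM => //; exact: mulr_ge0.
move: (a0 * b1) (a1 * b0) (c1 * d0) (c0 * d1) u0 v0 p0 q0 h01 h10 pq => p q u v.
move=> u0 v0 p0 q0 pu qu pquv.
have [u00|un0] := eqVneq u 0; first by lra.
have up : 0 < u by rewrite lt0r un0.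
rewrite -(ler_pM2l up); nra.
Qed.

Lemma upd_join eta xi x a b :
  joinc (upd eta x a) (upd xi x b) = upd (joinc eta xi) x (a || b).
Proof. by apply/funext => y; rewrite /joinc /upd; case: eqP. Qed.

Lemma upd_meet eta xi x a b :
  meetc (upd eta x a) (upd xi x b) = upd (meetc eta xi) x (a && b).
Proof. by apply/funext => y; rewrite /meetc /upd; case: eqP. Qed.

(** The Ahlswede-Daykin theorem: by induction the sums over the remaining sites satisfy the
    hypotheses of the one-site inequality for the four choices of the two spins at [x]. *)
Lemma four_functions s (f1 f2 f3 f4 : (T -> bool) -> R) :
  (forall eta, 0 <= f1 eta) -> (forall eta, 0 <= f2 eta) ->
  (forall eta, 0 <= f3 eta) -> (forall eta, 0 <= f4 eta) ->
  (forall eta xi, f1 eta * f2 xi <= f3 (joinc eta xi) * f4 (meetc eta xi)) ->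
  forall eta xi, sumv s f1 eta * sumv s f2 xi
    <= sumv s f3 (joinc eta xi) * sumv s f4 (meetc eta xi).
Proof.
move=> p1 p2 p3 p4 H; elim: s => [|x s IH] //= eta xi.
rewrite !big_bool /= ![sumv s _ (upd _ _ true) + _]addrC.
apply: four_functions_site; try exact: sumv_ge0.
- by have := IH (upd eta x false) (upd xi x false); rewrite upd_join upd_meet.
- by have := IH (upd eta x false) (upd xi x true); rewrite upd_join upd_meet.
- by have := IH (upd eta x true) (upd xi x false); rewrite upd_join upd_meet.
- by have := IH (upd eta x true) (upd xi x true); rewrite upd_join upd_meet.
Qed.

Definition gavg s w f eta := sumv s (fun xi => f xi * w xi) eta / sumv s w eta.

Lemma sumvw_gt0 s w eta : (forall xi, 0 < w xi) -> 0 < sumv s w eta.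
Proof. by move=> w0; apply: sumv_gt0 => //; rewrite card_bool. Qed.

Lemma gavgD s w f g eta : gavg s w (fun xi => f xi + g xi) eta = gavg s w f eta + gavg s w g eta.
Proof. by rewrite /gavg -mulrDl -sumvD; congr (_ / _); apply: eq_sumv => xi; rewrite mulrDl. Qed.

Lemma gavgZ s w c f eta : gavg s w (fun xi => c * f xi) eta = c * gavg s w f eta.
Proof. by rewrite /gavg mulrA -sumvZ; congr (_ / _); apply: eq_sumv => xi; rewrite mulrA. Qed.

Lemma gavgB s w f g eta : gavg s w (fun xi => f xi - g xi) eta = gavg s w f eta - gavg s w g eta.
Proof. by rewrite /gavg -mulrBl -sumvB; congr (_ / _); apply: eq_sumv => xi; rewrite mulrBl. Qed.

Lemma gavg_sum s w (I : Type) (r : seq I) (P : pred I) (f : I -> (T -> bool) -> R) eta :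
  gavg s w (fun xi => \sum_(i <- r | P i) f i xi) eta
  = \sum_(i <- r | P i) gavg s w (f i) eta.
Proof.
rewrite /gavg -mulr_suml -sumv_sum; congr (_ / _); apply: eq_sumv => xi.
by rewrite mulr_suml.
Qed.

Lemma eq_gavg s w f g eta : (forall xi, f xi = g xi) -> gavg s w f eta = gavg s w g eta.
Proof. by move=> fg; congr gavg; apply/funext. Qed.

Section positive_weight.
Variables (s : seq T) (w : (T -> bool) -> R).
Hypothesis w0 : forall xi, 0 < w xi.

Lemma gavg_cst c eta : gavg s w (fun=> c) eta = c.
Proof. by rewrite /gavg sumvZ mulfK // gt_eqF // sumvw_gt0. Qed.

Lemma ler_gavg f g eta : (forall xi, f xi <= g xi) -> gavg s w f eta <= gavg s w g eta.
Proof.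
move=> fg; rewrite /gavg ler_pM2r ?invr_gt0 ?sumvw_gt0 //.
by apply: ler_sumv => xi; rewrite ler_pM2r.
Qed.

Lemma gavg_norm f M eta : (forall xi, `|f xi| <= M) -> `|gavg s w f eta| <= M.
Proof.
move=> fM; rewrite ler_norml -{1}(gavg_cst (- M) eta) -{2}(gavg_cst M eta).
by apply/andP; split; apply: ler_gavg => xi; have := fM xi; rewrite ler_norml => /andP [].
Qed.

Hypothesis lsm : log_supermodular w.

(** When eta <= xi, their meet is eta and their join is xi, so the four functions theorem with f w,
    w, f w, w compares the two boundary conditions. Subtracting a lower bound makes f
    nonnegative. *)
Lemma gavg_holley f eta xi : increasing f -> (exists c, forall zeta, c <= f zeta) ->
  lec eta xi -> gavg s w f eta <= gavg s w f xi.
Proof.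
move=> incf [c fc] le; wlog f0 : f incf {c fc} / forall zeta, 0 <= f zeta => [H|].
  have := H (fun z => f z - c); rewrite !gavgB !gavg_cst lerD2r; apply.
    by move=> ? ? ?; rewrite lerD2r; exact: incf.
  by move=> z; rewrite subr_ge0.
rewrite /gavg ler_pdivrMr ?sumvw_gt0 // mulrAC ler_pdivlMr ?sumvw_gt0 //.
have := @four_functions s (fun z => f z * w z) w (fun z => f z * w z) w.
have -> : sumv s (fun z => f z * w z) xi = sumv s (fun z => f z * w z) (joinc eta xi).
  by congr sumv; apply/funext => x; rewrite /joinc; case: (eta x) (le x) => //= ->.
have E : eta = meetc eta xi.
  by apply/funext => x; rewrite /meetc; case: (eta x) (le x) => //= ->.
rewrite {3}E; apply => //; try by move=> z; rewrite mulr_ge0 // ltW.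
- by move=> z; exact: ltW.
- by move=> z; exact: ltW.
move=> z z'; rewrite -!mulrA; apply: ler_pM; [exact: f0|by rewrite mulr_ge0 // ltW| |exact: lsm].
exact: (incf _ _ (lec_joinl _ _)).
Qed.

(** The four functions theorem with f w, g w, f g w, w at a single boundary condition, after
    shifting f and g to be nonnegative. *)
Lemma gavg_fkg f g eta : increasing f -> increasing g ->
  (exists c, forall zeta, c <= f zeta) -> (exists c, forall zeta, c <= g zeta) ->
  gavg s w f eta * gavg s w g eta <= gavg s w (fun z => f z * g z) eta.
Proof.
move=> incf incg [c fc] [c' gc].
wlog f0 : f incf {c fc} / forall zeta, 0 <= f zeta => [H|].
  have := H (fun z => f z - c); rewrite gavgB gavg_cst.
  have -> : gavg s w (fun z => (f z - c) * g z) eta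
          = gavg s w (fun z => f z * g z) eta - c * gavg s w g eta.
    by rewrite -gavgZ -gavgB; apply: eq_gavg => z; rewrite mulrBl.
  rewrite mulrBl lerD2r; apply.
    by move=> ? ? ?; rewrite lerD2r; exact: incf.
  by move=> z; rewrite subr_ge0.
wlog g0 : g incg {c' gc} / forall zeta, 0 <= g zeta => [H|].
  have := H (fun z => g z - c'); rewrite gavgB gavg_cst.
  have -> : gavg s w (fun z => f z * (g z - c')) eta
          = gavg s w (fun z => f z * g z) eta - c' * gavg s w f eta.
    by rewrite -gavgZ -gavgB; apply: eq_gavg => z; rewrite mulrBr [f z * c']mulrC.
  rewrite mulrBr [_ * c']mulrC lerD2r; apply.
    by move=> ? ? ?; rewrite lerD2r; exact: incg.
  by move=> z; rewrite subr_ge0.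
have Z0 := sumvw_gt0 s eta w0.
rewrite /gavg mulrACA -invfM ler_pdivrMr ?mulr_gt0 // mulrA divfK ?gt_eqF //.
have := @four_functions s (fun z => f z * w z) (fun z => g z * w z)
  (fun z => f z * g z * w z) w.
move=> /(_ _ _ _ _ _ eta eta).
have -> : joinc eta eta = eta by apply/funext => x; rewrite /joinc orbb.
have -> : meetc eta eta = eta by apply/funext => x; rewrite /meetc andbb.
apply; try by move=> z; rewrite !mulr_ge0 // ltW.
- by move=> z; exact: ltW.
move=> z z'; rewrite mulrACA -[leRHS]mulrA; apply: ler_pM.
- exact: mulr_ge0.
- by rewrite mulr_ge0 // ltW.
- by apply: ler_pM => //; [exact: (incf _ _ (lec_joinl _ _))|exact: (incg _ _ (lec_joinr _ _))].
- exact: lsm.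
Qed.

End positive_weight.
End four_functions.

(** * The Griffiths-Hurst-Sherman inequality *)

Section ghs.
Context {R : realType} {T : choiceType}.

Definition sg (b : bool) : R := if b then 1 else -1.

Notation quad := ((bool * bool) * (bool * bool))%type.

(* Up to a factor 1/2, the orthogonal change of variables of Ellis and Monroe
   on four replicas; the signs are chosen so that the product of the four new
   variables is never negative. *)
Definition em (i : 'I_4) (a : quad) : R :=
  let: (s1, s2, (s3, s4)) := (sg a.1.1, sg a.1.2, (sg a.2.1, sg a.2.2)) in
  match val i with
  | 0%N => s1 + s2 + s3 + s4
  | 1%N => - s1 - s2 + s3 + s4
  | 2%N => s1 - s2 + s3 - s4
  | _ => s1 - s2 - s3 + s4
  end.

Lemma quad_sum (F : quad -> R) : \sum_a F a =
  \sum_(b1 : bool) \sum_(b2 : bool) \sum_(b3 : bool) \sum_(b4 : bool)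
    F ((b1, b2), (b3, b4)).
Proof.
rewrite pair_bigA /=; under [RHS]eq_bigr do rewrite pair_bigA /=.
rewrite pair_bigA /=; apply: eq_bigr => -[[b1 b2] [b3 b4]] _ //.
Qed.

(** Only the four exponents matter. With an even number of minus spins a single variable is nonzero
    and takes the values 4 and -4 equally often. With an odd number all four are 2 or -2 with
    positive product, every such sign pattern occurs once, and the signs sum to 8 if the exponents
    have equal parities and to 0 otherwise. *)
Lemma em_site_ge0 (v : seq 'I_4) : 0 <= \sum_a \prod_(i <- v) em i a.
Proof.
have [k E] : exists k : 'I_4 -> nat, forall a,
    \prod_(i <- v) em i a = \prod_(i : 'I_4) em i a ^+ k i.
  exists (fun i => count_mem i v) => a /=.
  elim: v => [|i v IH]; first by rewrite big_nil big1.
  rewrite big_cons IH [RHS](bigD1 i) //= eqxx exprS -mulrA; congr (_ * _).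
  rewrite (bigD1 i) //=; congr (_ * _); apply: eq_bigr => j /negbTE ji.
  by rewrite eq_sym ji.
under eq_bigr do rewrite E.
rewrite quad_sum !big_bool /=.
rewrite !big_ord_recr !big_ord0 /= /em /sg /= !mul1r.
set k0 := k _; set k1 := k _; set k2 := k _; set k3 := k _.
have zero n : 0 <= (0 : R) ^+ n by rewrite exprn_ge0.
have neg (x : R) n : (- x) ^+ n = (-1) ^+ (odd n) * x ^+ n by rewrite [in LHS]exprNn signr_odd.
repeat match goal with |- context [(?x + ?y) ^+ _] =>
  first [ have -> : x + y = 0 by lra | have -> : x + y = 2 by lra
        | have -> : x + y = - 2%:R by lra | have -> : x + y = 4 by lra
        | have -> : x + y = - 4%:R by lra] end.
rewrite !(neg 2) !(neg 4).
have z0 := zero k0; have z1 := zero k1; have z2 := zero k2; have z3 := zero k3.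
have f0 : 0 <= (4 : R) ^+ k0 by rewrite exprn_ge0.
have f1 : 0 <= (4 : R) ^+ k1 by rewrite exprn_ge0.
have f2 : 0 <= (4 : R) ^+ k2 by rewrite exprn_ge0.
have f3 : 0 <= (4 : R) ^+ k3 by rewrite exprn_ge0.
have t0 : 0 <= (2 : R) ^+ k0 by rewrite exprn_ge0.
have t1 : 0 <= (2 : R) ^+ k1 by rewrite exprn_ge0.
have t2 : 0 <= (2 : R) ^+ k2 by rewrite exprn_ge0.
have t3 : 0 <= (2 : R) ^+ k3 by rewrite exprn_ge0.
have p0 : 0 <= 4 ^+ k0 * 0 ^+ k1 * 0 ^+ k2 * 0 ^+ k3 :> R by rewrite !mulr_ge0.
have p1 : 0 <= 0 ^+ k0 * 4 ^+ k1 * 0 ^+ k2 * 0 ^+ k3 :> R by rewrite !mulr_ge0.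
have p2 : 0 <= 0 ^+ k0 * 0 ^+ k1 * 4 ^+ k2 * 0 ^+ k3 :> R by rewrite !mulr_ge0.
have p3 : 0 <= 0 ^+ k0 * 0 ^+ k1 * 0 ^+ k2 * 4 ^+ k3 :> R by rewrite !mulr_ge0.
have q : 0 <= 2 ^+ k0 * 2 ^+ k1 * 2 ^+ k2 * 2 ^+ k3 :> R by rewrite !mulr_ge0.
clear neg zero.
case: (odd k0); case: (odd k1); case: (odd k2); case: (odd k3); rewrite ?expr1 ?expr0; lra.
Qed.

Implicit Types (s : seq T) (xi : T -> quad) (v : seq (T * 'I_4)).

Definition word v xi : R := \prod_(p <- v) em p.2 (xi p.1).

(** Summing out one site removes its factors from the monomial and leaves a constant that is
    nonnegative by [em_site_ge0]. *)
Lemma sumv_word s v : exists (c : R) v', 0 <= c /\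
  forall xi, sumv s (word v) xi = c * word v' xi.
Proof.
elim: s v => [|x s IH] v /=; first by exists 1, v; split => // xi; rewrite mul1r.
have [c [v' [c0 H]]] := IH v.
pose vx := [seq p.2 | p <- v' & p.1 == x].
exists (c * \sum_a \prod_(i <- vx) em i a), [seq p <- v' | p.1 != x].
split=> [|xi]; first by rewrite mulr_ge0 // em_site_ge0.
under eq_bigr do rewrite H; rewrite -mulr_sumr -mulrA; congr (c * _).
rewrite mulr_suml; apply: eq_bigr => a _.
rewrite /word (bigID (fun p => p.1 == x)) /= /vx big_map !big_filter; congr (_ * _).
  by apply: eq_bigr => p /eqP ->; rewrite /upd eqxx.
by apply: eq_bigr => p /negbTE px; rewrite /upd px.
Qed.

Definition plus4 : T -> quad := fun=> ((true, true), (true, true)).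

(** The plus boundary condition enters here: at four plus spins the first variable is 4 and the
    others vanish. *)
Lemma word_plus4_ge0 v : 0 <= word v plus4.
Proof.
apply: prodr_ge0 => p _; rewrite /em /sg /=.
by case: (val p.2) => [|[|[|?]]]; lra.
Qed.

(* The functions G that stay nonnegative after multiplication by any monomial in
   the Ellis-Monroe variables and summation over s form a closed cone, stable
   under these variables and hence under exponentials. *)
Definition pos_type s (G : (T -> quad) -> R) :=
  forall v, 0 <= sumv s (fun xi => G xi * word v xi) plus4.

Lemma pos_type_cst s (c : R) : 0 <= c -> pos_type s (fun=> c).
Proof.
move=> c0 v; have [c' [v' [c'0 H]]] := sumv_word s v.
by rewrite sumvZ H !mulr_ge0 // word_plus4_ge0.
Qed.

Lemma pos_typeD s G1 G2 : pos_type s G1 -> pos_type s G2 ->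
  pos_type s (fun xi => G1 xi + G2 xi).
Proof.
move=> h1 h2 v; under eq_sumv do rewrite mulrDl.
by rewrite sumvD addr_ge0.
Qed.

Lemma pos_type_sum s (I : Type) (r : seq I) (G : I -> (T -> quad) -> R) :
  (forall i, pos_type s (G i)) -> pos_type s (fun xi => \sum_(i <- r) G i xi).
Proof.
move=> h; elim: r => [|i r IH].
  have -> : (fun xi => \sum_(j <- [::]) G j xi) = fun=> 0.
    by apply/funext => xi; rewrite big_nil.
  exact: pos_type_cst.
have -> : (fun xi => \sum_(j <- i :: r) G j xi)
        = fun xi => G i xi + \sum_(j <- r) G j xi.
  by apply/funext => xi; rewrite big_cons.
exact: pos_typeD.
Qed.

Lemma pos_typeZ s (c : R) G : 0 <= c -> pos_type s G ->
  pos_type s (fun xi => c * G xi).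
Proof.
move=> c0 h v; under eq_sumv do rewrite -mulrA.
by rewrite sumvZ mulr_ge0.
Qed.

Lemma pos_type_em s x i G : pos_type s G ->
  pos_type s (fun xi => em i (xi x) * G xi).
Proof.
move=> h v; have := h ((x, i) :: v); congr (0 <= _); apply: eq_sumv => xi.
by rewrite /word big_cons /= mulrCA mulrA.
Qed.

Lemma pos_type_lim s (G : nat -> (T -> quad) -> R) (G' : (T -> quad) -> R) :
  (forall n, pos_type s (G n)) -> (forall xi, G n xi @[n --> \oo] --> G' xi) ->
  pos_type s G'.
Proof.
move=> h cv v.
have cvs : sumv s (fun xi => G n xi * word v xi) plus4 @[n --> \oo] -->
    sumv s (fun xi => G' xi * word v xi) plus4.
  rewrite sumv_confs; under eq_fun do rewrite sumv_confs.
  elim: (confs s plus4) => [|xi l IH].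
    rewrite big_nil; have -> : (fun n => \sum_(z <- [::]) G n z * word v z) = fun=> 0.
      by apply/funext => n; rewrite big_nil.
    exact: cvg_cst.
  rewrite big_cons; have -> : (fun n => \sum_(z <- xi :: l) G n z * word v z)
      = (fun n => G n xi * word v xi + \sum_(z <- l) G n z * word v z).
    by apply/funext => n; rewrite big_cons.
  by apply: cvgD IH; apply: cvgMr_tmp; exact: cv.
rewrite -(cvg_lim _ cvs) //; apply: limr_ge; first by apply/cvg_ex; eexists; exact: cvs.
by apply: nearW => n; exact: h.
Qed.

(** The exponential series has nonnegative coefficients, so its partial sums preserve the cone
    whenever [G] does, and the cone is closed. *)
Lemma pos_type_expR s (G : (T -> quad) -> R) :
  (forall F, pos_type s F -> pos_type s (fun xi => G xi * F xi)) ->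
  forall F, pos_type s F -> pos_type s (fun xi => expR (G xi) * F xi).
Proof.
move=> hG F hF.
apply: (@pos_type_lim s (fun n xi => series (exp_coeff (G xi)) n * F xi)); last first.
  by move=> xi; apply: cvgMr_tmp; exact: is_cvg_series_exp_coeff.
move=> n.
have -> : (fun xi => series (exp_coeff (G xi)) n * F xi)
   = fun xi => \sum_(k <- index_iota 0 n) (k`!%:R^-1 * (G xi ^+ k * F xi)).
  apply/funext => xi; rewrite seriesEnat /= mulr_suml; apply: eq_bigr => k _.
  by rewrite /exp_coeff /= mulrA [_^-1 * _]mulrC.
apply: pos_type_sum => k; apply: pos_typeZ; first by rewrite invr_ge0.
elim: k => [|k IH].
  by under eq_fun do rewrite expr0 mul1r.
have -> : (fun xi => G xi ^+ k.+1 * F xi) = fun xi => G xi * (G xi ^+ k * F xi).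
  by apply/funext => xi; rewrite exprS mulrA.
exact: hG.
Qed.

Lemma pos_type_ge0 s G : pos_type s G -> 0 <= sumv s G plus4.
Proof.
move=> /(_ [::]); congr (0 <= _); apply: eq_sumv => xi.
by rewrite /word big_nil mulr1.
Qed.

Section covariances.
Variables (s : seq T) (B : seq (T * T)) (J : R).
Hypothesis J0 : 0 <= J.

Definition energy (h : R) (eta : T -> bool) : R :=
  J * \sum_(p <- B) sg (eta p.1) * sg (eta p.2) + h * \sum_(x <- s) sg (eta x).

Definition gibbs h eta := expR (energy h eta).

Definition plus1 : T -> bool := fun=> true.

Definition cov_plus h x y :=
  gavg s (gibbs h) (fun eta => sg (eta x) * sg (eta y)) plus1
  - gavg s (gibbs h) (fun eta => sg (eta x)) plus1
    * gavg s (gibbs h) (fun eta => sg (eta y)) plus1.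

Let r1 (xi : T -> quad) : T -> bool := fst \o (fst \o xi).
Let r2 (xi : T -> quad) : T -> bool := snd \o (fst \o xi).
Let r3 (xi : T -> quad) : T -> bool := fst \o (snd \o xi).
Let r4 (xi : T -> quad) : T -> bool := snd \o (snd \o xi).

Let sumv4 (F1 F2 F3 F4 : (T -> bool) -> R) :
  sumv s (fun xi => (F1 (r1 xi) * F2 (r2 xi)) * (F3 (r3 xi) * F4 (r4 xi))) plus4
  = (sumv s F1 plus1 * sumv s F2 plus1) * (sumv s F3 plus1 * sumv s F4 plus1).
Proof.
have := @sumv_pair R T _ _ s
  (fun xi : T -> bool * bool => F1 (fst \o xi) * F2 (snd \o xi))
  (fun xi : T -> bool * bool => F3 (fst \o xi) * F4 (snd \o xi)) plus4.
by rewrite !sumv_pair.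
Qed.

(** The energy of two replicas at field h1 and two at field h2 in the new variables. The 4 comes
    from the rows of the change of variables being orthogonal of norm 2. For 0 <= h1 <= h2 all
    coefficients are nonnegative, which is what membership in the cone needs. *)
Definition weight4 (h1 h2 : R) (xi : T -> quad) : R :=
  J / 4 * (\sum_(p <- B) \sum_(i < 4) em i (xi p.1) * em i (xi p.2))
  + (h1 + h2) / 2 * \sum_(x <- s) em ord0 (xi x)
  + (h2 - h1) / 2 * \sum_(x <- s) em (inord 1) (xi x).

Let gibbs4 h1 h2 xi :
  (gibbs h1 (r1 xi) * gibbs h1 (r2 xi)) * (gibbs h2 (r3 xi) * gibbs h2 (r4 xi))
  = expR (weight4 h1 h2 xi).
Proof.
rewrite /gibbs -!expRD; congr expR; rewrite /energy /weight4.
have -> : J / 4 * (\sum_(p <- B) \sum_(i < 4) em i (xi p.1) * em i (xi p.2))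
  = J * (\sum_(p <- B) sg (r1 xi p.1) * sg (r1 xi p.2)
       + \sum_(p <- B) sg (r2 xi p.1) * sg (r2 xi p.2)
       + \sum_(p <- B) sg (r3 xi p.1) * sg (r3 xi p.2)
       + \sum_(p <- B) sg (r4 xi p.1) * sg (r4 xi p.2)).
  rewrite -!big_split /= -mulrA; congr (J * _); rewrite mulr_sumr.
  apply: eq_bigr => p _; rewrite !big_ord_recr big_ord0 /= /em /= /r1 /r2 /r3 /r4 /=.
  by field.
have -> : \sum_(x <- s) em ord0 (xi x)
  = \sum_(x <- s) sg (r1 xi x) + \sum_(x <- s) sg (r2 xi x)
  + \sum_(x <- s) sg (r3 xi x) + \sum_(x <- s) sg (r4 xi x).
  by rewrite -!big_split.
have -> : \sum_(x <- s) em (inord 1) (xi x)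
  = - \sum_(x <- s) sg (r1 xi x) - \sum_(x <- s) sg (r2 xi x)
  + \sum_(x <- s) sg (r3 xi x) + \sum_(x <- s) sg (r4 xi x).
  rewrite -!sumrN -!big_split; apply: eq_bigr => x _.
  by rewrite /em /= inordK.
by field.
Qed.

Let gibbs_gt0 h eta : 0 < gibbs h eta. Proof. exact: expR_gt0. Qed.

Theorem ghs h1 h2 x y : 0 <= h1 -> h1 <= h2 -> cov_plus h2 x y <= cov_plus h1 x y.
Proof.
move=> h10 h12.
(* [G] equals 2 ((s1 - s2)(x) (s1 - s2)(y) - (s3 - s4)(x) (s3 - s4)(y)), whose mean over the four
   replicas is 4 times the difference of the covariances at h1 and h2. *)
pose G (xi : T -> quad) := em (inord 2) (xi x) * em (inord 3) (xi y)
                         + em (inord 3) (xi x) * em (inord 2) (xi y).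
have pG : 0 <= sumv s (fun xi => expR (weight4 h1 h2 xi) * G xi) plus4.
  apply/pos_type_ge0/pos_type_expR => [F hF|].
    have -> : (fun xi => weight4 h1 h2 xi * F xi) = (fun xi =>
        (J / 4 * (\sum_(p <- B) \sum_(i < 4) (em i (xi p.1) * (em i (xi p.2) * F xi)))
         + (h1 + h2) / 2 * \sum_(z <- s) (em ord0 (xi z) * F xi))
        + (h2 - h1) / 2 * \sum_(z <- s) (em (inord 1) (xi z) * F xi)).
      apply/funext => xi; rewrite /weight4 [LHS]mulrDl [X in X + _ = _]mulrDl.
      rewrite -![_ / _ * _ * F xi]mulrA !mulr_suml.
      congr (_ * _ + _ + _); apply: eq_bigr => p _; rewrite mulr_suml.
      by apply: eq_bigr => i _; rewrite mulrA.
    apply: pos_typeD; first apply: pos_typeD.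
    - apply: pos_typeZ; first by rewrite divr_ge0.
      apply: pos_type_sum => p; apply: pos_type_sum => i.
      exact/pos_type_em/pos_type_em.
    - apply: pos_typeZ; first lra.
      by apply: pos_type_sum => z; exact: pos_type_em.
    - apply: pos_typeZ; first lra.
      by apply: pos_type_sum => z; exact: pos_type_em.
  have one : pos_type s (fun=> 1) by exact: pos_type_cst.
  have two i j z z' : pos_type s (fun xi => em i (xi z) * em j (xi z')).
    have := @pos_type_em s z i _ (@pos_type_em s z' j _ one).
    by under eq_fun do rewrite mulr1.
  exact: pos_typeD (two _ _ _ _) (two _ _ _ _).
have Z1 : 0 < sumv s (gibbs h1) plus1 by exact: sumvw_gt0.
have Z2 : 0 < sumv s (gibbs h2) plus1 by exact: sumvw_gt0.
have Z4 : 0 < sumv s (gibbs h1) plus1 ^+ 2 * sumv s (gibbs h2) plus1 ^+ 2.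
  by rewrite mulr_gt0 // exprn_gt0.
rewrite -subr_ge0 -(pmulr_rge0 _ Z4).
suff <- : sumv s (fun xi => expR (weight4 h1 h2 xi) * G xi) plus4 / 4
   = sumv s (gibbs h1) plus1 ^+ 2 * sumv s (gibbs h2) plus1 ^+ 2
     * (cov_plus h1 x y - cov_plus h2 x y) by rewrite divr_ge0.
pose g h (k : nat) (eta : T -> bool) : R :=
  match k with 0%N => 1 | 1%N => sg (eta x) | 2%N => sg (eta y)
  | _ => sg (eta x) * sg (eta y) end * gibbs h eta.
pose S h k := sumv s (g h k) plus1.
have S0 h : S h 0%N = sumv s (gibbs h) plus1 by apply: eq_sumv => z; rewrite /g mul1r.
have t4 k1 k2 k3 k4 : sumv s (fun xi => (g h1 k1 (r1 xi) * g h1 k2 (r2 xi))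
    * (g h2 k3 (r3 xi) * g h2 k4 (r4 xi))) plus4 = S h1 k1 * S h1 k2 * (S h2 k3 * S h2 k4).
  by rewrite sumv4.
have -> : sumv s (fun xi => expR (weight4 h1 h2 xi) * G xi) plus4 =
   2 * (S h1 3%N * S h1 0%N * (S h2 0%N * S h2 0%N) + S h1 0%N * S h1 3%N * (S h2 0%N * S h2 0%N)
  - S h1 1%N * S h1 2%N * (S h2 0%N * S h2 0%N) - S h1 2%N * S h1 1%N * (S h2 0%N * S h2 0%N)
  - (S h1 0%N * S h1 0%N * (S h2 3%N * S h2 0%N) + S h1 0%N * S h1 0%N * (S h2 0%N * S h2 3%N)
  - S h1 0%N * S h1 0%N * (S h2 1%N * S h2 2%N) - S h1 0%N * S h1 0%N * (S h2 2%N * S h2 1%N))).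
  rewrite -!t4 -!(sumvD, sumvB) -sumvZ; apply: eq_sumv => xi.
  rewrite -gibbs4 /G /em /= !inordK // /g /r1 /r2 /r3 /r4 /=.
  by ring.
have cE k : cov_plus k x y = S k 3%N / S k 0%N - S k 1%N / S k 0%N * (S k 2%N / S k 0%N).
  by rewrite S0.
rewrite !cE -!S0; rewrite -!S0 in Z1 Z2.
move: (S h1 0%N) (S h2 0%N) (S h1 1%N) (S h2 1%N) (S h1 2%N) (S h2 2%N) (S h1 3%N) (S h2 3%N) Z1 Z2.
move=> ? ? ? ? ? ? ? ? Z1 Z2.
by field; rewrite !gt_eqF.
Qed.

End covariances.
End ghs.

(** * Finite-volume Gibbs states: monotonicity, volume comparison, translations *)

Section finite_volume.
Context {R : realType} {d : nat}.
Implicit Types (Lam : {fset site d}) (eta xi : site d -> bool) (e x y a : site d) (beta h : R).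

Lemma glue_inj Lam eta : injective (fun tau : {ffun Lam -> bool} => Defs.glue tau eta).
Proof.
move=> t1 t2 H; apply/ffunP => u.
have := congr1 (fun f : config d => f (val u)) H.
by rewrite /Defs.glue !valK.
Qed.

(** Passes from finite functions on [Lam] to iterated sums: gluing lists each configuration that
    agrees with [eta] off [Lam] exactly once. *)
Lemma sum_glue Lam (F : (site d -> bool) -> R) eta :
  \sum_(tau : {ffun Lam -> bool}) F (Defs.glue tau eta) = sumv (enum_fset Lam) F eta.
Proof.
rewrite sumv_confs.
transitivity (\sum_(xi <- [seq (Defs.glue tau eta : site d -> bool) |
    tau <- enum {: {ffun Lam -> bool}}]) F xi).
  by rewrite big_map big_enum.
apply/perm_big/uniq_perm.
- by rewrite map_inj_uniq ?enum_uniq //; exact: glue_inj.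
- exact/uniq_confs/fset_uniq.
move=> xi; rewrite mem_confs ?fset_uniq //; apply/mapP/asboolP => [[tau _ ->] x xL|H].
  by rewrite /Defs.glue insubN.
exists [ffun u : Lam => xi (val u)]; first by rewrite mem_enum.
apply/funext => x; rewrite /Defs.glue; case: insubP => [u _ <-|xL]; first by rewrite ffunE.
exact: H.
Qed.

Definition bonds Lam : seq (site d * site d) :=
  [seq (x, x + e) | e <- unit_vectors d, x <- enum_fset (bond_bases Lam e)].

Lemma boltzmannE (beta h : R) Lam :
  boltzmann beta h Lam = gibbs (enum_fset Lam) (bonds Lam) beta h.
Proof.
apply/funext => eta; rewrite /boltzmann /gibbs /energy /bonds.
by rewrite big_allpairs_dep.
Qed.

Lemma finite_volume_avgE (beta h : R) Lam (f : config d -> R) eta :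
  finite_volume_avg beta h Lam eta f
  = gavg (enum_fset Lam) (gibbs (enum_fset Lam) (bonds Lam) beta h) f eta.
Proof.
rewrite /finite_volume_avg /partition_function boltzmannE.
by rewrite (sum_glue Lam (fun z => f z * gibbs (enum_fset Lam) (bonds Lam) beta h z)) sum_glue.
Qed.

End finite_volume.

Lemma increasing_sg {R : realType} {T : choiceType} (x : T) :
  increasing (fun eta : T -> bool => sg (eta x) : R).
Proof. by move=> eta xi /(_ x); rewrite /sg; case: (eta x); case: (xi x) => //= _; lra. Qed.

Lemma sg_norm {R : realType} b : `|sg b : R| = 1.
Proof. by case: b; rewrite /sg ?normrN normr1. Qed.

(** Join and meet together carry the same spins at each site, so the field term is unchanged, while
    each pair term can only grow when J >= 0. *)
Lemma gibbs_log_supermodular {R : realType} {T : choiceType} (s : seq T) B (J h : R) :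
  0 <= J -> log_supermodular (gibbs s B J h).
Proof.
move=> J0 eta xi; rewrite /gibbs -!expRD ler_expR /energy.
have -> : forall a b c e : R, J * a + h * b + (J * c + h * e) = J * (a + c) + h * (b + e).
  by move=> *; ring.
have -> : forall a b c e : R, J * a + h * b + (J * c + h * e) = J * (a + c) + h * (b + e).
  by move=> *; ring.
rewrite -!big_split /=; apply: lerD.
  apply: ler_wpM2l => //; apply: ler_sum => p _; rewrite /joinc /meetc /sg.
  by case: (eta p.1); case: (eta p.2); case: (xi p.1); case: (xi p.2) => /=; lra.
rewrite le_eqVlt; apply/orP; left; apply/eqP; congr (_ * _); apply: eq_bigr => x _.
by rewrite /joinc /meetc /sg; case: (eta x); case: (xi x) => /=; lra.
Qed.

Lemma sum_fset_subset {R : realType} {I : choiceType} (A B : {fset I}) (F : I -> R) :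
  (A `<=` B)%fset ->
  \sum_(x <- B) F x = \sum_(x <- A) F x + \sum_(x <- (B `\` A)%fset) F x.
Proof.
move=> AB; rewrite (big_fsetID _ (mem A)) /=; congr (_ + _).
  suff -> : [fset x | x in B & x \in A]%fset = A by [].
  by apply/fsetP => x; rewrite !inE /=; apply: andb_idl; exact: (fsubsetP AB).
suff -> : [fset x | x in B & x \notin A]%fset = (B `\` A)%fset by [].
by apply/fsetP => x; rewrite !inE /= andbC.
Qed.

Section volumes.
Context {R : realType} {d : nat}.
Implicit Types (Lam : {fset site d}) (eta xi : site d -> bool) (e x y a : site d) (beta h : R).

Definition fvw (beta h : R) Lam := gibbs (enum_fset Lam) (bonds Lam) beta h.

Definition fv (beta h : R) Lam (f : (site d -> bool) -> R) eta :=
  gavg (enum_fset Lam) (fvw beta h Lam) f eta.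

Lemma mem_bond_bases Lam e x :
  (x \in bond_bases Lam e) = (x \in Lam) || (x + e \in Lam).
Proof.
rewrite /bond_bases in_fsetU; congr (_ || _); apply/imfsetP/idP => [[y yL ->]|xL].
  by rewrite subrK.
by exists (x + e); rewrite ?addrK.
Qed.

Lemma fvw_gt0 beta h Lam eta : 0 < fvw beta h Lam eta.
Proof. exact: expR_gt0. Qed.

(** The energy terms present for [Lam'] and absent for [Lam] belong to bonds and sites that do not
    meet [Lam], so their exponential is constant along summation over [Lam]. *)
Lemma fvw_subset beta h Lam Lam' : (Lam `<=` Lam')%fset ->
  exists c : (site d -> bool) -> R, indep_of (enum_fset Lam) c /\
    forall eta, fvw beta h Lam' eta = c eta * fvw beta h Lam eta.
Proof.
move=> sL.
exists (fun eta => expR (energy (enum_fset Lam') (bonds Lam') beta h eta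
                         - energy (enum_fset Lam) (bonds Lam) beta h eta)).
split=> [|eta]; last by rewrite -expRD subrK.
pose D eta := beta * (\sum_(e <- unit_vectors d)
     \sum_(x <- (bond_bases Lam' e `\` bond_bases Lam e)%fset)
        sg (eta x) * sg (eta (x + e)))
   + h * \sum_(x <- (Lam' `\` Lam)%fset) sg (eta x) : R.
have DE eta : energy (enum_fset Lam') (bonds Lam') beta h eta
            - energy (enum_fset Lam) (bonds Lam) beta h eta = D eta.
  have sb e : (bond_bases Lam e `<=` bond_bases Lam' e)%fset.
    apply/fsubsetP => x; rewrite !mem_bond_bases => /orP[] /(fsubsetP sL) -> //.
    by rewrite orbT.
  rewrite /energy /bonds !big_allpairs_dep /= (sum_fset_subset _ sL).
  under eq_bigr do rewrite (sum_fset_subset _ (sb _)).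
  by rewrite big_split /= /D; ring.
move=> x b eta xL; rewrite (DE eta) (DE (upd eta x b)) /D.
apply: congr1; apply: congr2; apply: congr1.
  apply: eq_bigr => e _; apply: eq_big_seq => y.
  rewrite in_fsetD !mem_bond_bases negb_or => /andP [/andP [yL yeL] _].
  rewrite /upd; case: eqVneq => [yx|_]; first by move: yL; rewrite yx xL.
  by case: eqVneq => [yx|_] //; move: yeL; rewrite yx xL.
apply: eq_big_seq => y; rewrite in_fsetD => /andP [yL _].
by rewrite /upd; case: eqVneq => // yx; move: yL; rewrite yx xL.
Qed.

(* DLR consistency in the form needed here: averaging over the larger volume
   averages the boundary condition of the smaller one. *)
Lemma fv_volume_le beta h Lam Lam' f C eta : (Lam `<=` Lam')%fset ->
  (forall xi, fv beta h Lam f xi <= C) -> fv beta h Lam' f eta <= C.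
Proof.
move=> sL H; have [c [ic E]] := fvw_subset beta h sL.
rewrite /fv /gavg ler_pdivrMr ?sumvw_gt0 //; last exact: fvw_gt0.
have p : perm_eq (enum_fset Lam') (enum_fset (Lam' `\` Lam)%fset ++ enum_fset Lam).
  apply: uniq_perm; rewrite ?fset_uniq //.
    rewrite cat_uniq !fset_uniq andbT /=; apply/hasPn => x /= xL.
    by rewrite in_fsetD xL.
  move=> x; rewrite mem_cat in_fsetD; case: (boolP (x \in Lam)) => //= xL.
    by rewrite (fsubsetP sL).
  by rewrite orbF.
rewrite !(perm_sumv _ _ (fset_uniq _) p) !sumv_cat -sumvZ.
apply: ler_sumv => xi.
have Z0 : 0 < sumv (enum_fset Lam) (fvw beta h Lam) xi.
  by apply: sumvw_gt0 => ?; exact: fvw_gt0.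
have := H xi; rewrite /fv /gavg ler_pdivrMr // => Hx.
rewrite (@eq_sumv _ _ _ _ (fvw beta h Lam') _ _ E).
under eq_sumv do rewrite E mulrCA.
rewrite !(sumvM _ _ ic) [leRHS]mulrCA ler_wpM2l //.
rewrite -(pmulr_rge0 _ (fvw_gt0 beta h Lam xi)) mulrC -E ltW //; exact: fvw_gt0.
Qed.

Lemma fvN beta h Lam f eta : fv beta h Lam (fun z => - f z) eta = - fv beta h Lam f eta.
Proof.
by rewrite /fv -mulN1r -gavgZ; apply: eq_gavg => z; rewrite mulN1r.
Qed.

Lemma fv_volume_ge beta h Lam Lam' f C eta : (Lam `<=` Lam')%fset ->
  (forall xi, C <= fv beta h Lam f xi) -> C <= fv beta h Lam' f eta.
Proof.
move=> sL H; have := @fv_volume_le beta h Lam Lam' (fun z => - f z) (- C) eta sL.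
by rewrite fvN lerN2; apply => xi; rewrite fvN lerN2.
Qed.

Definition allp : site d -> bool := fun=> true.
Definition allm : site d -> bool := fun=> false.

Lemma lec_allp eta : lec eta allp. Proof. by move=> x; rewrite implybT. Qed.
Lemma lec_allm eta : lec allm eta. Proof. by []. Qed.

Definition bounded_below (f : (site d -> bool) -> R) := exists c, forall z, c <= f z.

Lemma fv_mono beta h Lam f eta xi : 0 <= beta -> increasing f -> bounded_below f ->
  lec eta xi -> fv beta h Lam f eta <= fv beta h Lam f xi.
Proof.
move=> b0 incf bf le; apply: gavg_holley => //; first exact: fvw_gt0.
exact: gibbs_log_supermodular.
Qed.

(** Whatever the state outside [Lam'], the spins around the smaller volume lie below all plus. In
    particular plus averages of increasing functions decrease as the volume grows. *)
Lemma fv_plus_subset beta h Lam Lam' f eta : 0 <= beta -> increasing f ->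
  bounded_below f -> (Lam `<=` Lam')%fset ->
  fv beta h Lam' f eta <= fv beta h Lam f allp.
Proof.
move=> b0 incf bf sL; apply: (fv_volume_le _ sL) => xi.
by apply: fv_mono => //; exact: lec_allp.
Qed.

Lemma fv_minus_subset beta h Lam Lam' f eta : 0 <= beta -> increasing f ->
  bounded_below f -> (Lam `<=` Lam')%fset ->
  fv beta h Lam f allm <= fv beta h Lam' f eta.
Proof.
move=> b0 incf bf sL; apply: (fv_volume_ge _ sL) => xi.
by apply: fv_mono => //; exact: lec_allm.
Qed.

Definition shift a eta : site d -> bool := fun x => eta (x + a).
Definition fshift a Lam : {fset site d} := [fset (x + a)%R | x in Lam]%fset.

Lemma perm_fshift a Lam :
  perm_eq (enum_fset (fshift a Lam)) [seq x + a | x <- enum_fset Lam].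
Proof. by apply: enum_imfset => x y _ _ /addIr. Qed.

Lemma mem_fshift a Lam x : (x \in fshift a Lam) = (x - a \in Lam).
Proof.
apply/imfsetP/idP => [[y yL ->]|xL]; first by rewrite addrK.
by exists (x - a); rewrite ?subrK.
Qed.

Lemma sumv_shift a (s : seq (site d)) (F : (site d -> bool) -> R) eta :
  sumv [seq x + a | x <- s] (F \o shift a) eta = sumv s F (shift a eta).
Proof.
elim: s eta => [|x s IH] eta //=; apply: eq_bigr => b _; rewrite IH.
congr sumv; apply/funext => y; rewrite /shift /upd.
by rewrite (inj_eq (addIr a)).
Qed.

Lemma fvw_shift beta h a Lam eta :
  fvw beta h (fshift a Lam) eta = fvw beta h Lam (shift a eta).
Proof.
rewrite /fvw /gibbs /energy.
apply: congr1; apply: congr2; apply: congr1; last first.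
  by rewrite (perm_big _ (perm_fshift a Lam)) big_map.
rewrite /bonds !big_allpairs_dep /=; apply: eq_bigr => e _.
have -> : bond_bases (fshift a Lam) e = fshift a (bond_bases Lam e).
  by apply/fsetP => x; rewrite mem_fshift !mem_bond_bases !mem_fshift addrAC.
rewrite (perm_big _ (perm_fshift a _)) big_map; apply: eq_bigr => x _.
by rewrite /shift addrAC.
Qed.

Lemma fv_shift beta h a Lam f eta :
  fv beta h (fshift a Lam) (f \o shift a) eta = fv beta h Lam f (shift a eta).
Proof.
have H (F : (site d -> bool) -> R) : sumv (enum_fset (fshift a Lam)) (F \o shift a) eta
    = sumv (enum_fset Lam) F (shift a eta).
  rewrite -(sumv_shift a); apply: perm_sumv; first exact: fset_uniq.
  exact: perm_fshift.
rewrite /fv /gavg -!H; congr (_ / _); apply: eq_sumv => xi /=; by rewrite fvw_shift.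
Qed.

End volumes.
Lemma MVT_everywhere {R : realType} (f df : R -> R) (a b : R) :
  (forall x : R, is_derive x 1 f (df x)) -> a <= b ->
  exists2 c, a <= c <= b & f b - f a = df c * (b - a).
Proof.
move=> Hd ab.
have [|c] := @MVT_segment R f df a b ab (fun x _ => Hd x).
  apply: continuous_subspaceT => x; apply: differentiable_continuous.
  by apply/derivable1_diffP; have [] := Hd x.
by rewrite in_itv /= => cab E; exists c.
Qed.

(** * The bound 2 / h on the susceptibility *)

Section susceptibility.
Context {R : realType} {T : choiceType}.
Variables (s : seq T) (B : seq (T * T)) (J : R).
Hypothesis J0 : 0 <= J.

Let w h := gibbs s B J h.
Let M (eta : T -> bool) : R := \sum_(y <- s) sg (eta y).

Let gibbs_gt0 h eta : (0 < w h eta)%R. Proof. exact: expR_gt0. Qed.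

Lemma is_derive_sumv_gibbs F eta (h : R) :
  is_derive h 1 (fun k => sumv s (fun xi => F xi * gibbs s B J k xi) eta)
    (sumv s (fun xi => F xi * M xi * gibbs s B J h xi) eta).
Proof.
rewrite sumv_confs; under eq_fun do rewrite sumv_confs.
elim: (confs s eta) => [|xi l IH].
  rewrite big_nil; under eq_fun do rewrite big_nil; exact: is_derive_cst.
rewrite big_cons.
have -> : (fun k => \sum_(z <- xi :: l) F z * gibbs s B J k z)
  = (fun k => F xi * gibbs s B J k xi) \+ (fun k => \sum_(z <- l) F z * gibbs s B J k z).
  by apply/funext => k; rewrite big_cons.
apply: is_deriveD.
pose c := J * \sum_(p <- B) sg (xi p.1) * sg (xi p.2).
have -> : (fun k => F xi * gibbs s B J k xi) = F xi *: (expR \o (fun k : R => c + k * M xi)).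
  by apply/funext => k.
have -> : F xi * M xi * gibbs s B J h xi = F xi *: (M xi * expR (c + h * M xi)).
  by rewrite -mulrA.
apply: is_deriveZ.
have D : is_derive h 1 (fun k : R => c + k * M xi) (M xi).
  have -> : (fun k => c + k * M xi) = (cst c \+ (M xi *: id)).
    by apply/funext => k /=; rewrite mulrC.
  apply: is_derive_eq; rewrite add0r /GRing.scale /=; exact: mulr1.
by rewrite mulrC; apply: is_derive1_comp.
Qed.

Lemma is_derive_magnetisation x (h : R) :
  is_derive h 1 (fun k => gavg s (gibbs s B J k) (fun eta => sg (eta x)) plus1)
    (\sum_(y <- s) cov_plus s B J h x y).
Proof.
pose N k := sumv s (fun xi => sg (xi x) * gibbs s B J k xi) plus1.
pose Z k := sumv s (fun xi => 1 * gibbs s B J k xi) plus1.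
have ZE k : Z k = sumv s (gibbs s B J k) plus1 by apply: eq_sumv => xi; rewrite mul1r.
have Z0 k : Z k != 0 by rewrite ZE gt_eqF // sumvw_gt0.
have -> : (fun k => gavg s (gibbs s B J k) (fun eta => sg (eta x)) plus1)
        = N * (fun k => (Z k)^-1).
  by apply/funext => k; rewrite /gavg -ZE.
apply: is_derive_eq.
  apply: is_deriveM; first exact: is_derive_sumv_gibbs.
  by apply: is_deriveV => //; exact: is_derive_sumv_gibbs.
rewrite /cov_plus sumrB -mulr_sumr -!gavg_sum /gavg -!ZE -/(N h).
set N1 := sumv s _ plus1; set Z1 := sumv s _ plus1.
have <- : Z1 = sumv s (fun xi => (\sum_(i <- s) sg (xi x) * sg (xi i)) * gibbs s B J h xi) plus1.
  by apply: eq_sumv => xi; rewrite -mulr_sumr.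
have <- : N1 = sumv s (fun xi => (\sum_(i <- s) sg (xi i)) * gibbs s B J h xi) plus1.
  by apply: eq_sumv => xi; rewrite mul1r.
rewrite /GRing.scale /=; move: (N h) (Z h) (Z0 h) N1 Z1 => n z z0 n1 z1.
by field.
Qed.

Lemma gavg_sg_norm h x eta :
  `|gavg s (gibbs s B J h) (fun eta => sg (eta x)) eta| <= 1 :> R.
Proof. by apply: gavg_norm => xi; [exact: gibbs_gt0|rewrite sg_norm]. Qed.

(** By GHS the susceptibility does not increase with the field, so h times its value at h is at most
    the increase of the magnetisation over [0, h], which is at most 2. *)
Lemma susceptibility_le x h : 0 < h -> \sum_(y <- s) cov_plus s B J h x y <= 2 / h.
Proof.
move=> h0; have [c /andP [c0 ch]] := MVT_everywhere (is_derive_magnetisation x) (ltW h0).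
rewrite subr0 => E; rewrite ler_pdivlMr //.
apply: (@le_trans _ _ ((\sum_(y <- s) cov_plus s B J c x y) * h)).
  by rewrite ler_pM2r //; apply: ler_sum => y _; exact: ghs.
rewrite -E; have := gavg_sg_norm h x plus1; have := gavg_sg_norm 0 x plus1.
by rewrite !ler_norml => /andP [? ?] /andP [? ?]; lra.
Qed.

Lemma magnetisation_lipschitz x h h' : 0 < h' -> h' <= h ->
  gavg s (gibbs s B J h) (fun eta => sg (eta x)) plus1
  - gavg s (gibbs s B J h') (fun eta => sg (eta x)) plus1 <= 2 / h' * (h - h').
Proof.
move=> h0 hh; have [c /andP [c0 ch] ->] := MVT_everywhere (is_derive_magnetisation x) hh.
apply: ler_wpM2r; first by rewrite subr_ge0.
apply: le_trans (susceptibility_le x (lt_le_trans h0 c0)) _.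
by rewrite ler_pM2l // lef_pV2 // posrE ?(lt_le_trans h0 c0).
Qed.
End susceptibility.

(** Jensen's inequality from the tangent line of the exponential at the mean [m]. *)
Lemma gavg_expR_ge {R : realType} {T : choiceType} (s : seq T) w (f : (T -> bool) -> R) eta :
  (forall xi, 0 < w xi) ->
  expR (gavg s w f eta) <= gavg s w (fun xi => expR (f xi)) eta.
Proof.
move=> w0; set m := gavg s w f eta.
have -> : expR m = gavg s w (fun xi => expR m * (1 + (f xi - m))) eta.
  by rewrite gavgZ gavgD gavgB !gavg_cst // subrr addr0 mulr1.
apply: ler_gavg => // xi; rewrite -[in leRHS](subrK m (f xi)) expRD mulrC.
by rewrite ler_pM2r ?expR_gt0 // expR_ge1Dx.
Qed.

Lemma ler_sumv2 {R : realType} {T : choiceType} {A : finType} (s : seq T)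
    (F G : (T -> A) -> R) (eta xi : T -> A) :
  (forall z z', (forall x, x \in s -> z x = z' x) -> F z <= G z') ->
  sumv s F eta <= sumv s G xi.
Proof.
(* The induction needs to remember in [D] the sites already summed, at which both configurations
   carry the same value. *)
suff H D : (forall x, x \in D -> eta x = xi x) ->
  (forall z z', (forall x, x \in D ++ s -> z x = z' x) -> F z <= G z') ->
  sumv s F eta <= sumv s G xi by exact: (H [::]).
elim: s D eta xi => [|x s IH] D eta xi HD H /=.
  by apply: H => x; rewrite cats0; exact: HD.
apply: ler_sum => a _; apply: (IH (x :: D)) => [y|z z' Hz].
  rewrite in_cons /upd; case: eqVneq => //= _; exact: HD.
apply: H => y yD; apply: Hz; move: yD.
by rewrite mem_cat !in_cons /= mem_cat orbCA.
Qed.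

(** * Cubes, boxes and surface energies *)

Section cubes.
Implicit Types (k M : nat).

Definition row_of k M (g : {ffun 'I_k -> 'I_(M.*2.+1)}) : 'rV[int]_k :=
  \row_i (Posz (g i) - Posz M).

Definition cube k M : {fset 'rV[int]_k} :=
  [fset row_of g | g in {: {ffun 'I_k -> 'I_(M.*2.+1)}}]%fset.

Lemma row_of_inj k M : injective (@row_of k M).
Proof.
move=> g1 g2 H; apply/ffunP => i; apply/val_inj.
by have := congr1 (fun v : 'rV_k => v 0 i) H; rewrite !mxE => /addIr [].
Qed.

Lemma int_segment (z : int) M : `|z| <= Posz M ->
  exists j : 'I_(M.*2.+1), z = Posz j - Posz M.
Proof.
rewrite ler_norml => /andP [h1 h2].
have jM : (absz (z + Posz M)%R < M.*2.+1)%N by lia.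
by exists (Ordinal jM) => /=; lia.
Qed.

Lemma mem_cube k M (y : 'rV[int]_k) : (y \in cube k M) = [forall i, `|y 0 i| <= Posz M].
Proof.
apply/imfsetP/forallP => [[g _ ->] i|H].
  by rewrite mxE ler_norml; move: (ltn_ord (g i)); move: (nat_of_ord (g i)) => j; lia.
have /choice [g gE] : forall i, exists j : 'I_(M.*2.+1), y 0 i = Posz j - Posz M.
  by move=> i; apply: int_segment.
exists [ffun i => g i] => //=; apply/rowP => i.
by rewrite mxE ffunE gE.
Qed.

Lemma card_cube k M : #|` cube k M| = (M.*2.+1 ^ k)%N.
Proof.
rewrite (perm_size (enum_imfset _ _)) => [|? ? _ _]; last exact: row_of_inj.
by rewrite size_map -cardE card_ffun !card_ord.
Qed.
End cubes.

Section boxes.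
Context {d : nat}.
Implicit Types (n : nat) (x e : site d).

Let boxl n : seq (site d) :=
  [seq ((Posz j - Posz n, y) : site d) | j <- iota 0 n.*2.+1, y <- enum_fset (cube d.-1 n)].

Let mem_boxl n z :
  (z \in boxl n) = (`|z.1| <= Posz n) && [forall i, `|z.2 0 i| <= Posz n].
Proof.
apply/allpairsP/andP => [[[j y] []]|[z1 z2]].
  rewrite mem_iota => jn yn ->; rewrite -mem_cube yn ler_norml; split => //.
  by move: jn => /=; lia.
have [j zj] := int_segment z1; exists (val j, z.2); split.
- by rewrite mem_iota; exact: ltn_ord.
- by rewrite mem_cube.
- by rewrite -zj; case: (z).
Qed.

Lemma mem_box n x :
  (x \in box d n) = (`|x.1| <= Posz n) && [forall i, `|x.2 0 i| <= Posz n].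
Proof.
rewrite -mem_boxl -[RHS](seq_fsetE tt).
suff -> : box d n = seq_fset tt (boxl n) by [].
rewrite -[RHS]set_fsetK; congr fset_set; apply/seteqP; split => z.
  by move=> [z1 z2]; rewrite /mkset seq_fsetE mem_boxl z1; apply/forallP.
by rewrite /mkset seq_fsetE mem_boxl => /andP [-> /forallP].
Qed.

Lemma card_box n : #|` box d n| = (n.*2.+1 * n.*2.+1 ^ d.-1)%N.
Proof.
have -> : (n.*2.+1 * n.*2.+1 ^ d.-1)%N = size (boxl n).
  by rewrite size_allpairs size_iota card_cube.
apply/perm_size/uniq_perm; rewrite ?fset_uniq //.
  apply: allpairs_uniq; rewrite ?iota_uniq ?fset_uniq //.
  by move=> [j y] [j' y'] _ _ /= [] jj ->; congr (_, _); lia.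
by move=> z; rewrite mem_box mem_boxl.
Qed.

Lemma box_subset m n : (m <= n)%N -> (box d m `<=` box d n)%fset.
Proof.
move=> mn; apply/fsubsetP => x; rewrite !mem_box => /andP [x1 /forallP x2].
apply/andP; split; first lia.
by apply/forallP => i; have := x2 i; lia.
Qed.

Lemma box_exhausts x : exists N, forall n z, z \in box d n -> z + x \in box d (n + N).
Proof.
pose N := (absz x.1 + \sum_(i < d.-1) absz (x.2 0%R i))%N.
exists N => n z; rewrite !mem_box => /andP [z1 /forallP z2]; apply/andP; split.
  by rewrite /= /N; lia.
apply/forallP => i; rewrite mxE; have := z2 i.
have : (absz (x.2 0%R i) <= N)%N.
  by rewrite /N (bigD1 i) //= addnCA leq_addr.
clearbody N; move: (z.2 0 i) (x.2 0 i) => u v; lia.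
Qed.

Lemma unit_vector_box n x e : e \in unit_vectors d -> x \in box d n ->
  x - e \in box d n.+1.
Proof.
rewrite /unit_vectors in_cons => /orP [/eqP ->|/mapP [i _ ->]];
  rewrite !mem_box => /andP [x1 /forallP x2]; apply/andP => /=; split; try lia.
- by apply/forallP => j; have := x2 j; rewrite !mxE; move: (x.2 0 j) => u; lia.
- by apply/forallP => j; have := x2 j; rewrite !mxE; move: (x.2 0 j) => u; case: (_ && _) => /=; lia.
Qed.

End boxes.
Section boundary.
Context {R : realType} {d : nat}.
Implicit Types (beta h : R) (n : nat) (x e : site d).

Lemma sum_mem_fset (A S : {fset site d}) : (A `<=` S)%fset ->
  \sum_(x <- S) (x \in A)%:R = #|` A|%:R :> R.
Proof.
move=> AS; rewrite (sum_fset_subset _ AS) -[RHS]addr0; congr (_ + _).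
  by rewrite -sum1_size natr_sum; apply: eq_big_seq => x ->.
by rewrite big_seq big1 // => x; rewrite in_fsetD => /andP [/negbTE ->].
Qed.

Definition box_boundary beta n : R :=
  beta * ((size (unit_vectors d))%:R * (4 * (#|` box d n.+1|%:R - #|` box d n|%:R))).

Lemma energy_boundary beta h n (z z' : site d -> bool) : 0 <= beta ->
  (forall x, x \in box d n -> z x = z' x) ->
  energy (enum_fset (box d n)) (bonds (box d n)) beta h z
  <= energy (enum_fset (box d n)) (bonds (box d n)) beta h z' + box_boundary beta n.
Proof.
move=> b0 zz; rewrite /energy.
have -> : \sum_(x <- enum_fset (box d n)) sg (z x) = \sum_(x <- box d n) sg (z' x) :> R.
  by apply: eq_big_seq => x xb; rewrite zz.
rewrite addrAC lerD2r /box_boundary -mulrDr; apply: ler_wpM2l => //.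
rewrite /bonds !big_allpairs_dep -lerBlDl -sumrB.
rewrite -sum1_size natr_sum mulr_suml big_seq [leRHS]big_seq; apply: ler_sum => e eu.
rewrite mul1r -sumrB /=; set S := bond_bases _ _; set L := box d n.
have SL : (L `<=` S)%fset by apply/fsubsetP => x xL; rewrite mem_bond_bases xL.
have SL' : (fshift (- e) L `<=` S)%fset.
  by apply/fsubsetP => x; rewrite mem_fshift opprK mem_bond_bases orbC => ->.
have cS : #|` S|%:R <= #|` box d n.+1|%:R :> R.
  rewrite ler_nat; apply/fsubset_leq_card/fsubsetP => x.
  rewrite mem_bond_bases => /orP [|xe]; first exact/fsubsetP/box_subset.
  by rewrite -[x](addrK e); exact: unit_vector_box.
have card' : #|` fshift (- e) L| = #|` L|.
  by rewrite (perm_size (perm_fshift _ _)) size_map.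
(* A bond with both ends in the box contributes 0; any other changes by at most 2, and the
   right-hand side counts 2 for each end outside. Summed over [S], this is the 4 of
   [box_boundary]. *)
apply: (@le_trans _ _ (\sum_(x <- S) 2 * ((1 - (x \in L)%:R) + (1 - (x \in fshift (- e) L)%:R)))).
  apply: ler_sum => x _; rewrite mem_fshift opprK.
  case: (boolP (x \in L)) => [xL|_].
    case: (boolP (x + e \in L)) => [xeL|_].
      by rewrite !zz //= ?mulr1n ?mulr0n; lra.
    by rewrite zz // /sg; case: (z' x); case: (z (x + e)); case: (z' (x + e)) => /=; rewrite ?mulr1n ?mulr0n; lra.
  by rewrite /sg; case: (z x); case: (z' x); case: (z (x + e)); case: (z' (x + e));
     case: (x + e \in L) => /=; rewrite ?mulr1n ?mulr0n; lra.
rewrite -mulr_sumr big_split /= !sumrB !sum_mem_fset // card'.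
have -> : \sum_(x <- S) 1 = #|` S|%:R :> R by rewrite -sum1_size natr_sum.
by move: cS; lra.
Qed.

Lemma card_box_gt0 n : 0 < #|` box d n|%:R :> R.
Proof. by rewrite ltr0n card_box muln_gt0 expn_gt0. Qed.

Lemma box_boundary_cvg beta :
  box_boundary beta n / #|` box d n|%:R @[n --> \oo] --> 0.
Proof.
have ratio n : box_boundary beta n / #|` box d n|%:R =
    beta * ((size (unit_vectors d))%:R
      * (4 * ((1 + 2 / n.*2.+1%:R) ^+ d.-1.+1 - 1))) :> R.
  rewrite /box_boundary !card_box -!expnS !natrX.
  have N0 : n.*2.+1%:R != 0 :> R by rewrite pnatr_eq0.
  have -> : 1 + 2 / n.*2.+1%:R = n.+1.*2.+1%:R / n.*2.+1%:R :> R.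
    have -> : n.+1.*2.+1 = (n.*2.+1 + 2)%N by lia.
    by rewrite (natrD R n.*2.+1 2); move: (n.*2.+1%:R) N0 => c c0; field.
  rewrite expr_div_n; have := expf_neq0 d.-1.+1 N0.
  by move: (n.*2.+1%:R ^+ _) (n.+1.*2.+1%:R ^+ _) => c c' c0; field.
have lim1 : (1 + 2 / n.*2.+1%:R) @[n --> \oo] --> (1 + 2 * 0 : R).
  apply: cvgD; [exact: cvg_cst|apply: cvgMl_tmp].
  apply: (@squeeze_cvgr _ _ _ _ (cst 0) (@harmonic R)).
  - apply: nearW => n; rewrite /cst /harmonic invr_ge0 ler0n /=.
    by rewrite lef_pV2 ?posrE ?ltr0n // ler_nat; lia.
  - exact: cvg_cst.
  - exact: cvg_harmonic.
rewrite mulr0 addr0 in lim1.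
have limD : (1 + 2 / n.*2.+1%:R) ^+ d.-1.+1 @[n --> \oo] --> (1 : R).
  elim: d.-1.+1 => [|k IH]; first by under eq_fun do rewrite expr0; exact: cvg_cst.
  by rewrite -[X in _ --> X](mulr1 1); under eq_fun do rewrite exprS; exact: cvgM.
have -> : (fun n => box_boundary beta n / #|` box d n|%:R) = (fun n => beta *
    ((size (unit_vectors d))%:R * (4 * ((1 + 2 / n.*2.+1%:R) ^+ d.-1.+1 - 1)))).
  exact/funext.
have -> : (0 : R) = beta * ((size (unit_vectors d))%:R * (4 * (1 - 1))).
  by rewrite subrr !mulr0.
by do 3 apply: cvgMl_tmp; apply: cvgB => //; exact: cvg_cst.
Qed.

End boundary.
Arguments box_boundary {R} d.

(** * Equality of the plus and minus magnetisations *)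

Section uniqueness.
Context {R : realType} {d : nat} (beta : R).
Hypothesis b0 : 0 <= beta.
Implicit Types (h : R) (n : nat) (x e : site d) (L : {fset site d}).

Let sx x : (site d -> bool) -> R := fun eta => sg (eta x).

Let bsx x : bounded_below (sx x).
Proof. by exists (-1) => z; rewrite /sx /sg; case: (z x); lra. Qed.

Let incsx x : increasing (sx x).
Proof. exact: increasing_sg. Qed.

(** By monotonicity in the volume this infimum is the limiting plus magnetisation, and as an infimum
    it bounds every finite volume at once; likewise [mminus]. *)
Definition mplus h : R := inf (range (fun n => fv beta h (box d n) (sx 0) allp)).
Definition mminus h : R := sup (range (fun n => fv beta h (box d n) (sx 0) allm)).

Let fv_sx_norm h L x eta : `|fv beta h L (sx x) eta| <= 1.
Proof. exact: gavg_sg_norm. Qed.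

Lemma mplus_le_box h n : mplus h <= fv beta h (box d n) (sx 0) allp.
Proof.
apply: ge_inf; last by exists n.
by exists (-1) => _ [m _ <-]; have := fv_sx_norm h (box d m) 0 allp; rewrite ler_norml => /andP [].
Qed.

Lemma box_le_mminus h n : fv beta h (box d n) (sx 0) allm <= mminus h.
Proof.
apply: ub_le_sup; last by exists n.
by exists 1 => _ [m _ <-]; have := fv_sx_norm h (box d m) 0 allm; rewrite ler_norml => /andP [].
Qed.

Lemma fset_sub_box L : exists n, (L `<=` box d n)%fset.
Proof.
have /choice [f Hf] : forall x, exists k, x \in box d k.
  move=> x; have [N HN] := box_exhausts x.
  exists (0 + N)%N; rewrite -[x]add0r; apply: HN; rewrite mem_box.
  by apply/andP; split => //; apply/forallP => i; rewrite mxE normr0.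
exists (\max_(x <- L) f x); apply/fsubsetP => x xL.
by apply: (fsubsetP (box_subset _)) (Hf x); apply: (@leq_bigmax_seq _ _ xpredT).
Qed.

Let shiftK_sx x : sx 0 \o shift x = sx x.
Proof. by apply/funext => z; rewrite /sx /shift /= add0r. Qed.

Lemma fv_sx_shift h L x b : fv beta h (fshift x L) (sx x) (fun=> b) = fv beta h L (sx 0) (fun=> b).
Proof. by rewrite -shiftK_sx fv_shift. Qed.

Lemma mplus_le h L x : mplus h <= fv beta h L (sx x) allp.
Proof.
have [n Ln] := fset_sub_box (fshift (- x) L).
apply: le_trans (mplus_le_box h n) _; rewrite -(fv_sx_shift h (box d n) x true).
apply: fv_plus_subset => //; apply/fsubsetP => y yL.
by rewrite mem_fshift; apply: (fsubsetP Ln); rewrite mem_fshift opprK subrK.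
Qed.

Lemma mminus_ge h L x : fv beta h L (sx x) allm <= mminus h.
Proof.
have [n Ln] := fset_sub_box (fshift (- x) L).
apply: le_trans (box_le_mminus h n); rewrite -(fv_sx_shift h (box d n) x false).
apply: fv_minus_subset => //; apply/fsubsetP => y yL.
by rewrite mem_fshift; apply: (fsubsetP Ln); rewrite mem_fshift opprK subrK.
Qed.

(** The ratio of the partition functions is the mean at field h of the exponential of (h' - h) times
    the total spin; Jensen moves the mean into the exponent. *)
Lemma partition_ratio h h' L eta :
  expR ((h' - h) * \sum_(x <- L) fv beta h L (sx x) eta)
    * sumv (enum_fset L) (fvw beta h L) eta <= sumv (enum_fset L) (fvw beta h' L) eta.
Proof.
have Z0 : 0 < sumv (enum_fset L) (fvw beta h L) eta.
  by apply: sumvw_gt0 => ?; exact: fvw_gt0.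
have -> : (h' - h) * \sum_(x <- L) fv beta h L (sx x) eta
  = fv beta h L (fun z => (h' - h) * \sum_(x <- L) sx x z) eta.
  by rewrite /fv gavgZ gavg_sum.
rewrite -ler_pdivlMr //; apply: le_trans (gavg_expR_ge _ _ _ _) _.
  by move=> ?; exact: fvw_gt0.
rewrite /gavg ler_pM2r ?invr_gt0 //; apply: ler_sumv => z.
rewrite /fvw /gibbs -expRD ler_expR /energy le_eqVlt; apply/orP; left; apply/eqP.
by rewrite /sx; ring.
Qed.

(* Jensen's inequality bounds Z(h) / Z(h') from below with plus and from above
   with minus boundary conditions; the two quotients differ by a surface factor,
   so the volume terms must already be ordered. *)
Lemma mplus_le_mminus h h' : h' < h -> mplus h' <= mminus h.
Proof.
move=> hh; rewrite leNgt; apply/negP => lt.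
pose D := (h - h') * (mplus h' - mminus h).
have D0 : 0 < D by rewrite mulr_gt0 // subr_gt0.
have key n : D <= 2 * (box_boundary d beta n / #|` box d n|%:R).
  rewrite mulrA ler_pdivlMr ?card_box_gt0 //.
  set L := box d n; pose Z k eta := sumv (enum_fset L) (fvw beta k L) eta : R.
  have Z0 k eta : 0 < Z k eta by apply: sumvw_gt0 => ?; exact: fvw_gt0.
  have bc k eta eta' : Z k eta <= expR (box_boundary d beta n) * Z k eta'.
    rewrite /Z -sumvZ; apply: ler_sumv2 => z z' zz.
    by rewrite /fvw /gibbs -expRD ler_expR [leRHS]addrC; exact: energy_boundary.
  have r1 := partition_ratio h' h L allp.
  have r2 := partition_ratio h h' L allm.
  rewrite -/(Z _ _) -/(Z _ _) in r1; rewrite -/(Z _ _) -/(Z _ _) in r2.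
  have r3 : expR (D * #|` L|%:R) * (Z h' allp * Z h allm)
     <= expR (2 * box_boundary d beta n) * (Z h' allp * Z h allm).
    apply: (@le_trans _ _ (Z h allp * Z h' allm)).
      apply: le_trans (ler_pM _ _ r1 r2); last 2 first.
      - by rewrite mulr_ge0 ?expR_ge0 // ltW.
      - by rewrite mulr_ge0 ?expR_ge0 // ltW.
      have lp : mplus h' * #|` L|%:R <= \sum_(x <- L) fv beta h' L (sx x) allp.
        rewrite -sum1_size natr_sum mulr_sumr; apply: ler_sum => x _.
        by rewrite mulr1; exact: mplus_le.
      have lm : \sum_(x <- L) fv beta h L (sx x) allm <= mminus h * #|` L|%:R.
        rewrite -sum1_size natr_sum mulr_sumr; apply: ler_sum => x _.
        by rewrite mulr1; exact: mminus_ge.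
      rewrite mulrACA -expRD ler_pM2r ?mulr_gt0 // ler_expR /D.
      move: lp lm; move: (\sum_(x <- L) _) (\sum_(x <- L) _) (#|` L|%:R) => B A N lp lm.
      rewrite -subr_ge0.
      have -> : (h - h') * A + (h' - h) * B - (h - h') * (mplus h' - mminus h) * N
        = (h - h') * ((A - mplus h' * N) + (mminus h * N - B)) by ring.
      by apply: mulr_ge0; lra.
    have := ler_pM (ltW (Z0 h allp)) (ltW (Z0 h' allm)) (bc h allp allm) (bc h' allm allp).
    by rewrite [2 * _]mulr_natl mulr2n expRD; congr (_ <= _); ring.
  by move: r3; rewrite ler_pM2r ?mulr_gt0 // ler_expR.
have lim0 : 2 * (box_boundary d beta n / #|` box d n|%:R) @[n --> \oo] --> (2 * 0 : R).
  by apply: cvgMl_tmp; exact: box_boundary_cvg.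
have : D <= limn (fun n => 2 * (box_boundary d beta n / #|` box d n|%:R)).
  by apply: limr_ge; [apply/cvg_ex; eexists; exact: lim0|exact: nearW].
by rewrite (cvg_lim _ lim0) // mulr0 leNgt D0.
Qed.

Lemma mplus_eq_mminus h : 0 < h -> mplus h <= mminus h.
Proof.
move=> h0; apply/ler_addgt0Pl => e e0.
(* Since h' >= h / 2 the Lipschitz constant 2 / h' is at most 4 / h, and h - h' <= e h / 4 makes the
   loss at most e. *)
pose h' := Num.max (h / 2) (h - e * (h / 4)).
have h'0 : 0 < h' by rewrite lt_max divr_gt0.
have h'h : h' < h.
  by rewrite gt_max ltr_pdivrMr // mulr_natr mulr2n ltrDl h0 ltrBlDr ltrDl mulr_gt0 // divr_gt0.
have h'2 : h / 2 <= h' by rewrite le_max lexx.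
have h'e : h - h' <= e * (h / 4) by rewrite lerBlDr -lerBlDl le_max lexx orbT.
apply: (@le_trans _ _ (mplus h' + e)); last by rewrite addrC lerD2l; exact: mplus_le_mminus.
rewrite -lerBlDr; apply: lb_le_inf; first by eexists; exists 0%N.
move=> _ [n _ <-]; rewrite lerBlDr; apply: le_trans (mplus_le_box h n) _.
rewrite -lerBlDl; have := magnetisation_lipschitz (enum_fset (box d n)) (bonds (box d n)) b0 0 h'0 (ltW h'h).
move=> /le_trans; apply; apply: (@le_trans _ _ (2 / h' * (e * (h / 4)))).
  by rewrite ler_wpM2l // divr_ge0 // ltW.
rewrite mulrAC ler_pdivrMr //.
have -> : 2 * (e * (h / 4)) = e * (h / 2) by field.
by rewrite ler_pM2l.
Qed.

(** Large boxes contain the translates to [x] of two fixed boxes whose plus and minus magnetisations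
    are within e / 2 of [mplus] and [mminus], and volume monotonicity traps the gap between them. *)
Theorem box_uniqueness h x (e : R) : 0 < h -> 0 < e -> exists N, forall n, (N <= n)%N ->
  fv beta h (box d n) (sx x) allp - fv beta h (box d n) (sx x) allm <= e.
Proof.
move=> h0 e0; have e2 : 0 < e / 2 by rewrite divr_gt0.
have hi : has_inf (range (fun n => fv beta h (box d n) (sx 0) allp)).
  split; first by eexists; exists 0%N.
  by exists (-1) => _ [m _ <-]; have := fv_sx_norm h (box d m) 0 allp; rewrite ler_norml => /andP [].
have hs : has_sup (range (fun n => fv beta h (box d n) (sx 0) allm)).
  split; first by eexists; exists 0%N.
  by exists 1 => _ [m _ <-]; have := fv_sx_norm h (box d m) 0 allm; rewrite ler_norml => /andP [].
have [_ [n1 _ <-] l1] := inf_adherent e2 hi.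
have [_ [n2 _ <-] l2] := sup_adherent e2 hs.
have [N HN] := box_exhausts x.
have shiftbox m n : (m + N <= n)%N -> (fshift x (box d m) `<=` box d n)%fset.
  move=> mn; apply/fsubsetP => y; rewrite mem_fshift => /HN; rewrite subrK.
  exact/fsubsetP/box_subset.
exists (maxn (n1 + N) (n2 + N)) => n; rewrite geq_max => /andP [nn1 nn2].
have u1 : fv beta h (box d n) (sx x) allp <= fv beta h (box d n1) (sx 0) allp.
  by rewrite -(fv_sx_shift h (box d n1) x true); apply: fv_plus_subset => //; exact: shiftbox.
have u2 : fv beta h (box d n2) (sx 0) allm <= fv beta h (box d n) (sx x) allm.
  by rewrite -(fv_sx_shift h (box d n2) x false); apply: fv_minus_subset => //; exact: shiftbox.
have := mplus_eq_mminus h0; rewrite /mplus /mminus => mm.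
by lra.
Qed.
End uniqueness.

(** * Gibbs measures in a positive field *)

Section real_sequences.
Context {R : realType}.
Implicit Types (u v : nat -> R) (a b c : R).

Lemma seqD u v a b : u n @[n --> \oo] --> a -> v n @[n --> \oo] --> b ->
  u n + v n @[n --> \oo] --> a + b.
Proof. by move=> ua vb; exact: cvgD. Qed.

Lemma seqM u v a b : u n @[n --> \oo] --> a -> v n @[n --> \oo] --> b ->
  u n * v n @[n --> \oo] --> a * b.
Proof. by move=> ua vb; exact: cvgM. Qed.

Lemma seqZ c u a : u n @[n --> \oo] --> a -> c * u n @[n --> \oo] --> c * a.
Proof. by move=> ua; apply: seqM => //; exact: cvg_cst. Qed.

Lemma seq_sum (I : Type) (r : seq I) (u : I -> nat -> R) (a : I -> R) :
  (forall i, u i n @[n --> \oo] --> a i) ->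
  \sum_(i <- r) u i n @[n --> \oo] --> \sum_(i <- r) a i.
Proof.
move=> H; elim: r => [|i r IH].
  by rewrite big_nil; under eq_fun do rewrite big_nil; exact: cvg_cst.
by rewrite big_cons; under eq_fun do rewrite big_cons; exact: seqD.
Qed.

Lemma seq_le u v a b : u n @[n --> \oo] --> a -> v n @[n --> \oo] --> b ->
  (\forall n \near \oo, u n <= v n) -> a <= b.
Proof.
move=> ua vb uv; rewrite -(cvg_lim _ ua) // -(cvg_lim _ vb) //; apply: ler_lim => //.
  by apply/cvg_ex; exists a.
by apply/cvg_ex; exists b.
Qed.

Lemma seq_unique u a b : u n @[n --> \oo] --> a -> u n @[n --> \oo] --> b -> a = b.
Proof. by move=> ua ub; apply: cvg_unique ua ub. Qed.

End real_sequences.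

(** * Real-valued expectations of bounded measurable functions *)

Section bounded_expectation.
Context {R : realType} {dT} {T : measurableType dT} (P : probability T R).
Implicit Types (f g : T -> R) (c : R).

Definition bm f := measurable_fun [set: T] f /\ exists M : R, forall x, `|f x| <= M.
Definition Ex f : R := \int[P]_w f w.

Lemma bm_integrable f : bm f -> P.-integrable setT (EFin \o f).
Proof.
move=> [mf [M fM]]; apply: measurable_bounded_integrable => //.
  by rewrite (le_lt_trans (probability_le1 P measurableT)) ?ltry.
exists M; split; [exact: num_real|move=> N MN x _ /=].
exact: le_trans (fM x) (ltW MN).
Qed.

Lemma bm_cst c : bm (fun=> c).
Proof. by split; [exact: measurable_cst|exists `|c|]. Qed.

Lemma bmD f g : bm f -> bm g -> bm (fun x => f x + g x).
Proof.
move=> [mf [M fM]] [mg [N gN]]; split; first exact: measurable_funD.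
by exists (M + N) => x; rewrite (le_trans (ler_normD _ _)) // lerD.
Qed.

Lemma bmM f g : bm f -> bm g -> bm (fun x => f x * g x).
Proof.
move=> [mf [M fM]] [mg [N gN]]; split; first exact: measurable_funM.
by exists (M * N) => x; rewrite normrM ler_pM.
Qed.

Lemma bmZ c f : bm f -> bm (fun x => c * f x).
Proof. exact/bmM/bm_cst. Qed.

Lemma bmN f : bm f -> bm (fun x => - f x).
Proof. by move=> bf; under eq_fun do rewrite -mulN1r; exact: bmZ. Qed.

Lemma bmB f g : bm f -> bm g -> bm (fun x => f x - g x).
Proof. by move=> bf bg; apply: bmD bf _; exact: bmN. Qed.

Lemma bm_sum (I : Type) (r : seq I) (Q : pred I) (f : I -> T -> R) : (forall i, bm (f i)) ->
  bm (fun x => \sum_(i <- r | Q i) f i x).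
Proof.
move=> bf; elim: r => [|i r IH].
  by under eq_fun do rewrite big_nil; exact: bm_cst.
by under eq_fun do rewrite big_cons; case: (Q i) => //; exact: bmD.
Qed.

Lemma bm_comp (h : R -> R) f M : continuous h -> (forall x, `|h x| <= M) ->
  measurable_fun [set: T] f -> bm (h \o f).
Proof.
move=> ch hM mf; split; last by exists M => x; exact: hM.
by apply: measurableT_comp mf; exact: continuous_measurable_fun.
Qed.

Lemma Ex_cst c : Ex (fun=> c) = c.
Proof.
rewrite /Ex Rintegral_cst // -[RHS]mulr1; congr (_ * _).
by rewrite -[RHS]/(fine 1%E); congr fine; exact: probability_setT.
Qed.

Lemma ExD f g : bm f -> bm g -> Ex (fun x => f x + g x) = Ex f + Ex g.
Proof. by move=> /bm_integrable bf /bm_integrable bg; exact: RintegralD. Qed.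

Lemma ExB f g : bm f -> bm g -> Ex (fun x => f x - g x) = Ex f - Ex g.
Proof. by move=> /bm_integrable bf /bm_integrable bg; exact: RintegralB. Qed.

Lemma ExZ c f : bm f -> Ex (fun x => c * f x) = c * Ex f.
Proof. by move=> /bm_integrable bf; exact: RintegralZl. Qed.

Lemma Ex_sum (I : Type) (r : seq I) (Q : pred I) (f : I -> T -> R) : (forall i, bm (f i)) ->
  Ex (fun x => \sum_(i <- r | Q i) f i x) = \sum_(i <- r | Q i) Ex (f i).
Proof.
move=> bf; elim: r => [|i r IH].
  by rewrite big_nil; under eq_fun do rewrite big_nil; exact: Ex_cst.
rewrite big_cons -IH; under eq_fun do rewrite big_cons; case: (Q i) => //.
by rewrite ExD //; exact: bm_sum.
Qed.

Lemma le_Ex f g : bm f -> bm g -> (forall x, f x <= g x) -> Ex f <= Ex g.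
Proof. by move=> /bm_integrable bf /bm_integrable bg fg; exact: le_Rintegral. Qed.

Lemma Ex_norm f : bm f -> `|Ex f| <= Ex (fun x => `|f x|).
Proof. by move=> /bm_integrable bf; exact: le_normr_Rintegral. Qed.

Lemma bm_norm f : bm f -> bm (fun x => `|f x|).
Proof.
move=> [mf [M fM]]; split; first exact: measurableT_comp.
by exists M => x; rewrite normr_id.
Qed.

Lemma Ex_norm_le f M : bm f -> (forall x, `|f x| <= M) -> `|Ex f| <= M.
Proof.
move=> bf fM; apply: le_trans (Ex_norm bf) _; rewrite -[leRHS]Ex_cst.
by apply: le_Ex => //; [exact: bm_norm|exact: bm_cst].
Qed.

Lemma Ex_indic (A : set T) : measurable A -> Ex (\1_A) = fine (P A).
Proof. by move=> mA; rewrite /Ex /Rintegral integral_indic // setIT. Qed.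

Lemma expectationE f : bm f -> ('E_P[f] = (Ex f)%:E)%E.
Proof.
move=> /bm_integrable bf; rewrite unlock /Ex /Rintegral fineK //.
exact: integrable_fin_num.
Qed.

Lemma bm_indic (A : set T) : measurable A -> bm (\1_A).
Proof.
move=> mA; split; first exact: measurable_indic.
by exists 1 => x; rewrite indicE; case: (x \in A); rewrite ?normr1 ?normr0.
Qed.

End bounded_expectation.

(** * Functions of finitely many spins *)

Section local_functions.
Context {R : realType} {d : nat}.
Implicit Types (S : seq (site d)) (f g : config d -> R) (eta xi : site d -> bool).

Definition local_on S f := forall eta xi, (forall x, x \in S -> eta x = xi x) -> f eta = f xi.
Definition local f := exists S, local_on S f.

Lemma local_cst (c : R) : local (fun=> c). Proof. by exists [::]. Qed.

Lemma local_op2 (op : R -> R -> R) f g : local f -> local g -> local (fun z => op (f z) (g z)).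
Proof.
move=> [S Sf] [S' Sg]; exists (S ++ S') => eta xi H.
by rewrite (Sf eta xi) ?(Sg eta xi) // => x xS; apply: H; rewrite mem_cat xS ?orbT.
Qed.

Lemma local_op (op : R -> R) f : local f -> local (fun z => op (f z)).
Proof. by move=> [S Sf]; exists S => eta xi H; rewrite (Sf eta xi). Qed.

Lemma localM f g : local f -> local g -> local (fun z => f z * g z).
Proof. exact: (local_op2 *%R). Qed.

Lemma localD f g : local f -> local g -> local (fun z => f z + g z).
Proof. exact: (local_op2 +%R). Qed.

Lemma localB f g : local f -> local g -> local (fun z => f z - g z).
Proof. exact: (local_op2 (fun x y => x - y)). Qed.

Lemma local_sum (I : Type) (r : seq I) (Q : pred I) (f : I -> config d -> R) :
  (forall i, local (f i)) -> local (fun z => \sum_(i <- r | Q i) f i z).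
Proof.
move=> lf; elim: r => [|i r IH].
  by under eq_fun do rewrite big_nil; exact: local_cst.
by under eq_fun do rewrite big_cons; case: (Q i) => //; exact: localD.
Qed.

Lemma local_sg x : local (fun z => sg (z x)).
Proof. by exists [:: x] => eta xi H; rewrite H // mem_head. Qed.

Lemma local_sumv S f : local f -> local (fun z => sumv S f z).
Proof.
move=> [S' Sf]; exists S' => eta xi; elim: S eta xi => [|x S IH] eta xi H /=.
  exact: Sf.
apply: eq_bigr => a _; apply: IH => y yS; rewrite /upd; case: eqP => // _; exact: H.
Qed.

Lemma local_gibbs S B (J h : R) : local (gibbs S B J h).
Proof.
apply: (local_op expR); apply: localD; apply: localM; try exact: local_cst.
  by apply: local_sum => p; apply: localM; exact: local_sg.
by apply: local_sum => p; exact: local_sg.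
Qed.

Lemma local_fv beta h Lam f : local f -> local (fun z => fv beta h Lam f z).
Proof.
move=> lf; apply: localM; first apply: local_sumv; first apply: localM => //.
  exact: local_gibbs.
by apply: (local_op (@GRing.inv R)); apply: local_sumv; exact: local_gibbs.
Qed.

Definition cylinder S xi : set (config d) := [set eta | forall x, x \in S -> eta x = xi x].

Lemma measurable_coordinate x b : measurable [set eta : config d | eta x = b].
Proof. by apply: sub_sigma_algebra; exists x, b. Qed.

Lemma measurable_cylinder S xi : measurable (cylinder S xi).
Proof.
elim: S => [|x S IH].
  suff -> : cylinder [::] xi = setT by exact: measurableT.
  by apply/seteqP; split.
have -> : cylinder (x :: S) xi = [set eta | eta x = xi x] `&` cylinder S xi.
  apply/seteqP; split => [eta H|eta [H1 H2] y].
    by split => [|y yS]; apply: H; rewrite ?mem_head // in_cons yS orbT.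
  by rewrite in_cons => /orP [/eqP ->|/H2].
by apply: measurableI => //; exact: measurable_coordinate.
Qed.

(** Reduces local functions to indicators of cylinders, so that measurability and the DLR equations,
    which speak of events, extend to them by linearity. *)
Lemma local_decomposition f : local f -> exists S, uniq S /\ forall eta : config d,
  f eta = \sum_(xi <- confs S (@allp d)) f xi * \1_(cylinder S xi) eta.
Proof.
move=> [S' Sf]; exists (undup S'); split; first exact: undup_uniq.
move=> eta; set S := undup S'; pose xi0 x := if x \in S then eta x else true.
have uS : uniq S by exact: undup_uniq.
have xi0S : xi0 \in confs S (@allp d).
  by rewrite mem_confs //; apply/asboolP => x xS; rewrite /xi0 (negbTE xS).
rewrite (bigD1_seq xi0) ?uniq_confs //= indicE mem_set; last first.
  by move=> x xS; rewrite /xi0 xS.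
rewrite mulr1 big_seq_cond big1 ?addr0.
  by apply: Sf => x xS; rewrite /xi0 mem_undup xS.
move=> xi /andP [xiS nxi]; rewrite indicE memNset ?mulr0 // => H.
case/eqP: nxi; apply/funext => x; rewrite /xi0; case: ifP => [/H //|/negbT xS].
by move: xiS; rewrite mem_confs // => /asboolP ->.
Qed.

Lemma local_bm f : local f -> bm f.
Proof.
move=> /local_decomposition [S [_ fE]].
have -> : f = fun eta : config d => \sum_(xi <- confs S (@allp d)) f xi * \1_(cylinder S xi) eta.
  exact/funext.
by apply: bm_sum => xi; apply: bmZ; apply: bm_indic; exact: measurable_cylinder.
Qed.

End local_functions.

(** * Consequences of the DLR equations in a positive field *)

Section gibbs_measure.
Context {R : realType} {d : nat} (beta h : R) (mu : probability (config d) R).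
Hypotheses (b0 : 0 <= beta) (h0 : 0 < h) (hmu : ising_measure beta h mu).
Implicit Types (f g : config d -> R) (x y : site d) (L : {fset site d}).

Notation E := (Ex mu).

Lemma local_dlr L f : local f -> E f = E (fun eta => fv beta h L f eta).
Proof.
move=> lf; have [S [uS fE]] := local_decomposition lf.
have E1 xi : E (\1_(cylinder S xi)) = E (fun eta => fv beta h L (\1_(cylinder S xi)) eta).
  rewrite Ex_indic; last exact: measurable_cylinder.
  rewrite (hmu L (measurable_cylinder S xi)) /Ex /Rintegral; congr fine.
  by apply: eq_integral => eta _; rewrite finite_volume_avgE.
have l1 xi : local (\1_(cylinder S xi) : config d -> R).
  exists S => z z' zz; rewrite !indicE; congr (_%:R); congr nat_of_bool.
  by apply/idP/idP => /set_mem H; apply/mem_set => x xS; rewrite -H // zz.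
transitivity (\sum_(xi <- confs S (@allp d)) f xi * E (\1_(cylinder S xi))).
  rewrite {1}(funext fE) Ex_sum.
    by apply: eq_bigr => xi _; rewrite ExZ //; exact: local_bm.
  by move=> xi; apply/bmZ/local_bm.
have -> : (fun eta => fv beta h L f eta) = fun eta =>
    \sum_(xi <- confs S (@allp d)) f xi * fv beta h L (\1_(cylinder S xi)) eta.
  apply/funext => eta; rewrite {1}(funext fE) /fv gavg_sum; apply: eq_bigr => xi _.
  exact: gavgZ.
rewrite Ex_sum.
  by apply: eq_bigr => xi _; rewrite E1 ExZ //; exact/local_bm/local_fv.
by move=> xi; apply/bmZ/local_bm/local_fv.
Qed.

Lemma bm_bounded_below f : bm f -> bounded_below f.
Proof. by move=> [_ [M fM]]; exists (- M) => z; have := fM z; rewrite ler_norml => /andP []. Qed.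

Lemma Ex_le_plus L f : local f -> increasing f -> E f <= fv beta h L f allp.
Proof.
move=> lf incf; rewrite (local_dlr L lf) -[leRHS](Ex_cst mu); apply: le_Ex.
- exact/local_bm/local_fv.
- exact: bm_cst.
- by move=> z; apply: fv_mono => //; [exact/bm_bounded_below/local_bm|exact: lec_allp].
Qed.

Lemma minus_le_Ex L f : local f -> increasing f -> fv beta h L f allm <= E f.
Proof.
move=> lf incf; rewrite (local_dlr L lf) -[leLHS](Ex_cst mu); apply: le_Ex.
- exact: bm_cst.
- exact/local_bm/local_fv.
- by move=> z; apply: fv_mono => //; exact/bm_bounded_below/local_bm.
Qed.

(** If two ordered configurations differ on [S], some spin jumps from -1 to 1; this raises the spin
    sum by at least 2, and 2 M dominates any change of [f]. *)
Lemma local_lipschitz S f : local_on S f -> exists M : R, 0 <= M /\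
  increasing (fun z => M * \sum_(x <- S) sg (z x) + f z) /\
  increasing (fun z => M * \sum_(x <- S) sg (z x) - f z).
Proof.
move=> Sf; have [_ [M fM]] := local_bm (ex_intro _ S Sf).
have M0 : 0 <= M by exact: le_trans (normr_ge0 _) (fM (fun=> true)).
exists M; split => //.
have key eta xi : lec eta xi -> `|f xi - f eta| <=
    M * \sum_(x <- S) sg (xi x) - M * \sum_(x <- S) sg (eta x).
  move=> le; rewrite -mulrBr -sumrB.
  have [/allP H|] := boolP (all (fun x => eta x == xi x) S).
    rewrite (Sf eta xi) => [|x /H /eqP //].
    rewrite subrr normr0 mulr_ge0 // sumr_ge0 // => x _.
    by rewrite subr_ge0; apply: increasing_sg.
  move=> /allPn [x xS nx]; apply: (@le_trans _ _ (M * 2)).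
    by have := fM xi; have := fM eta; rewrite !ler_norml => /andP [? ?] /andP [? ?]; apply/andP; split; lra.
  apply: ler_wpM2l => //; rewrite (big_rem x) //= -[leLHS]addr0; apply: lerD.
    by move: nx (le x); rewrite /sg; case: (eta x); case: (xi x) => //= _ _; lra.
  by apply: sumr_ge0 => y _; rewrite subr_ge0; apply: increasing_sg.
by split=> eta xi /key; rewrite ler_norml => /andP [? ?]; lra.
Qed.

(** Comparing the increasing functions M times the spin sum plus or minus [f] with plus boundary
    conditions, and the spin sum itself with minus ones, controls every local function by the gaps
    between one-point functions. *)
Lemma Ex_fv_approx S f : local_on S f -> exists M : R, 0 <= M /\ forall L,
  `|E f - fv beta h L f allp|
  <= M * \sum_(x <- S) (fv beta h L (fun z => sg (z x)) allp - fv beta h L (fun z => sg (z x)) allm).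
Proof.
move=> Sf; have lf : local f by exists S.
have [M [M0 [i1 i2]]] := local_lipschitz Sf; exists M; split => // L.
have lS : local (fun z : config d => M * \sum_(x <- S) sg (z x)).
  apply: localM; first exact: local_cst.
  by apply: local_sum => x; exact: local_sg.
have Ssum eta : fv beta h L (fun z => M * \sum_(x <- S) sg (z x)) eta
     = M * \sum_(x <- S) fv beta h L (fun z => sg (z x)) eta.
  by rewrite /fv gavgZ gavg_sum.
have ES : M * \sum_(x <- S) fv beta h L (fun z => sg (z x)) allm
    <= E (fun z => M * \sum_(x <- S) sg (z x)).
  rewrite ExZ; last by apply: local_bm; apply: local_sum => x; exact: local_sg.
  apply: ler_wpM2l => //; rewrite Ex_sum; last by move=> x; exact/local_bm/local_sg.
  by apply: ler_sum => x _; apply: minus_le_Ex; [exact: local_sg|exact: increasing_sg].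
have h1 := @Ex_le_plus L _ (localD lS lf) i1.
have h2 := @Ex_le_plus L _ (localB lS lf) i2.
rewrite (ExD _ (local_bm lS) (local_bm lf)) /fv gavgD -!/(fv _ _ _ _ _) Ssum in h1.
rewrite (ExB _ (local_bm lS) (local_bm lf)) /fv gavgB -!/(fv _ _ _ _ _) Ssum in h2.
rewrite sumrB mulrBr ler_norml.
by apply/andP; split; lra.
Qed.

Lemma fv_sg_gap_cvg a x :
  fv beta h (fshift a (box d n)) (fun z => sg (z x)) allp
  - fv beta h (fshift a (box d n)) (fun z => sg (z x)) allm @[n --> \oo] --> (0 : R).
Proof.
have sh (b : bool) n : fv beta h (fshift a (box d n)) (fun z => sg (z x)) (fun=> b)
    = fv beta h (box d n) (fun z => sg (z (x - a))) (fun=> b).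
  rewrite -[RHS]/(fv beta h (box d n) _ (shift a (fun=> b))) -fv_shift; congr fv.
  by apply/funext => z; rewrite /= /shift subrK.
apply/cvgrPdist_le => e e0; have [N HN] := @box_uniqueness R d beta b0 h (x - a) e h0 e0.
near=> n; rewrite sub0r normrN (sh true) (sh false).
have Hn : (N <= n)%N by near: n; exact: nbhs_infty_ge.
rewrite ger0_norm; last first.
  rewrite subr_ge0; apply: fv_mono => //; first exact: increasing_sg.
  exact/bm_bounded_below/local_bm/local_sg.
exact: HN.
Unshelve. all: end_near. Qed.

(** The limit is the same for boxes centred anywhere; translation invariance follows by comparing
    two centres. *)
Lemma fv_shift_cvg a f : local f -> fv beta h (fshift a (box d n)) f allp @[n --> \oo] --> E f.
Proof.
move=> [S Sf]; have [M [M0 HM]] := Ex_fv_approx Sf.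
apply/cvgrPdist_le => e e0.
have lim0 : \sum_(x <- S) (fv beta h (fshift a (box d n)) (fun z => sg (z x)) allp
    - fv beta h (fshift a (box d n)) (fun z => sg (z x)) allm) @[n --> \oo] --> (0 : R).
  elim: S {Sf HM} => [|x S IH].
    by under eq_fun do rewrite big_nil; exact: cvg_cst.
  under eq_fun do rewrite big_cons.
  have := cvgD (fv_sg_gap_cvg a x) IH; rewrite addr0 => H; exact: H.
have {}lim0 := @cvgMl_tmp _ _ _ eventually_filter _ M _ lim0.
rewrite mulr0 in lim0.
have /cvgrPdist_le /(_ e e0) := lim0.
apply: filterS => n; rewrite sub0r normrN => H.
exact: le_trans (HM _) (le_trans (ler_norm _) H).
Qed.

Lemma fshift0 L : fshift 0 L = L.
Proof. by apply/fsetP => x; rewrite mem_fshift subr0. Qed.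

Lemma fv_box_cvg f : local f -> fv beta h (box d n) f allp @[n --> \oo] --> E f.
Proof.
by move=> lf; have := @fv_shift_cvg 0 f lf; under eq_fun do rewrite fshift0.
Qed.

Lemma local_shift a f : local f -> local (f \o shift a).
Proof.
move=> [S Sf]; exists [seq x + a | x <- S] => eta xi H; apply: Sf => x xS.
by rewrite /shift; apply: H; apply: map_f.
Qed.

Lemma Ex_shift a f : local f -> E (f \o shift a) = E f.
Proof.
move=> lf; have c1 := fv_box_cvg lf; have c2 := fv_shift_cvg a (local_shift a lf).
have sh n : fv beta h (fshift a (box d n)) (f \o shift a) allp = fv beta h (box d n) f allp.
  exact: fv_shift.
rewrite (funext sh) in c2; exact: cvg_unique c2 c1.
Qed.

Lemma Ex_fkg f g : local f -> local g -> increasing f -> increasing g ->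
  E f * E g <= E (fun z => f z * g z).
Proof.
move=> lf lg incf incg.
apply: (seq_le (seqM (fv_box_cvg lf) (fv_box_cvg lg)) (fv_box_cvg (localM lf lg))).
apply: nearW => n; apply: gavg_fkg => //.
- exact: fvw_gt0.
- exact: gibbs_log_supermodular.
- exact/bm_bounded_below/local_bm.
- exact/bm_bounded_below/local_bm.
Qed.

Definition Cov f g := E (fun z => f z * g z) - E f * E g.
Definition sgx x : config d -> R := fun z => sg (z x).
Definition corr u := Cov (sgx 0) (sgx u).

Lemma Cov_sgx x y : Cov (sgx x) (sgx y) = corr (y - x).
Proof.
rewrite /corr /Cov.
rewrite -(Ex_shift x (local_sg 0)) -(Ex_shift x (local_sg (y - x))).
rewrite -(Ex_shift x (localM (local_sg 0) (local_sg (y - x)))).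
have -> : (fun z : site d -> bool => sg (z 0) : R) \o shift x = sgx x.
  by apply/funext => z; rewrite /= /shift add0r.
have -> : (fun z : site d -> bool => sg (z (y - x)) : R) \o shift x = sgx y.
  by apply/funext => z; rewrite /= /shift subrK.
congr (E _ - _); apply/funext => z; by rewrite /= /shift subrK add0r.
Qed.

Lemma corr_ge0 u : 0 <= corr u.
Proof.
by rewrite subr_ge0; apply: Ex_fkg; try exact: local_sg; exact: increasing_sg.
Qed.

(** The bound is taken in finite volume: once the box contains [F], the sum over [F] is part of the
    susceptibility, whose other terms are nonnegative by FKG. *)
Lemma sum_corr_le (F : seq (site d)) : uniq F -> \sum_(u <- F) corr u <= 2 / h.
Proof.
move=> uF; have [N HN] := fset_sub_box [fset x in F]%fset.
have c : \sum_(u <- F) cov_plus (enum_fset (box d n)) (bonds (box d n)) beta h 0 u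
    @[n --> \oo] --> \sum_(u <- F) corr u.
  apply: seq_sum => u; apply: cvgB; first exact: (fv_box_cvg (localM (local_sg 0) (local_sg u))).
  by apply: seqM; exact: (fv_box_cvg (local_sg _)).
apply: (seq_le c (cvg_cst _)); exists N => // n /= Nn.
apply: le_trans (susceptibility_le (enum_fset (box d n)) (bonds (box d n)) b0 0 h0).
have FL : {subset F <= box d n}.
  move=> x xF; apply: (fsubsetP (box_subset Nn)); apply: (fsubsetP HN).
  by rewrite in_fset.
have cov0 u : 0 <= cov_plus (enum_fset (box d n)) (bonds (box d n)) beta h 0 u.
  rewrite subr_ge0; apply: gavg_fkg => //; try exact: increasing_sg.
  - by move=> ?; exact: expR_gt0.
  - exact: gibbs_log_supermodular.
  - exact/bm_bounded_below/local_bm/local_sg.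
  - exact/bm_bounded_below/local_bm/local_sg.
rewrite [leRHS](bigID (mem F)) /= -[leLHS]addr0; apply: lerD; last first.
  by apply: sumr_ge0 => u _; exact: cov0.
rewrite -[leRHS]big_filter; suff p : perm_eq F [seq u <- enum_fset (box d n) | u \in F].
  by rewrite (perm_big _ p).
apply: uniq_perm => //; first exact/filter_uniq/fset_uniq.
by move=> x; rewrite mem_filter andb_idr // => /FL.
Qed.

(** Finite energy: in the one-site volume both spin values have positive weight, so the mean spin
    lies strictly between -1 and 1. *)
Lemma corr0_gt0 : 0 < corr 0.
Proof.
have key eta : -1 < fv beta h [fset 0]%fset (sgx 0) eta < 1.
  have -> : fv beta h [fset 0]%fset (sgx 0) eta
      = gavg [:: 0] (fvw beta h [fset 0]%fset) (sgx 0) eta.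
    have p : perm_eq (enum_fset [fset (0 : site d)]%fset) [:: 0].
      by apply: uniq_perm => // x; rewrite in_fset1 inE.
    by rewrite /fv /gavg !(perm_sumv _ _ (fset_uniq _) p).
  rewrite /gavg /= !big_bool /= /sgx /upd !eqxx /=.
  set wp := fvw _ _ _ _; set wm := fvw _ _ _ _.
  have wp0 : 0 < wp by exact: fvw_gt0.
  have wm0 : 0 < wm by exact: fvw_gt0.
  rewrite ltr_pdivrMr ?ltr_pdivlMr ?addr_gt0 //.
  by apply/andP; split; lra.
have m1 : E (sgx 0) < 1.
  have /andP [_] := key allp; apply: le_lt_trans; apply: Ex_le_plus; first exact: local_sg.
  exact: increasing_sg.
have m2 : -1 < E (sgx 0).
  have /andP [+ _] := key allm; move=> /lt_le_trans; apply; apply: minus_le_Ex; first exact: local_sg.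
  exact: increasing_sg.
rewrite /corr /Cov.
have -> : (fun z => sgx 0 z * sgx 0 z) = fun=> 1.
  by apply/funext => z; rewrite /sgx /sg; case: (z 0); rewrite ?mulr1 ?mulrNN ?mulr1.
by rewrite Ex_cst; move: (E (sgx 0)) m1 m2 => m m1 m2; nra.
Qed.
End gibbs_measure.

(** * Newman's inequality for characteristic functions *)

Section elementary_bounds.
Context {R : realType}.
Implicit Types (x y u v : R) (f df : R -> R).

(** Taylor estimates with constant 1 instead of inverse factorials: by the mean value theorem each
    integration raises the power by one. *)
Lemma taylor_step f df k : (forall x, is_derive x 1 f (df x)) -> f 0 = 0 ->
  (forall x, `|df x| <= `|x| ^+ k) -> forall x, `|f x| <= `|x| ^+ k.+1.
Proof.
move=> Hd f0 dfk x; have [x0|x0] := leP 0 x.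
  have [c /andP [c0 cx]] := MVT_everywhere Hd x0.
  rewrite f0 !subr0 => ->; rewrite normrM exprSr ler_wpM2r //.
  by apply: le_trans (dfk c) _; rewrite lerXn2r ?nnegrE // !ger0_norm.
have [c /andP [c0 cx]] := MVT_everywhere Hd (ltW x0).
rewrite f0 !sub0r => /eqP; rewrite eqr_oppLR => /eqP ->.
rewrite mulrN opprK normrM exprSr ler_wpM2r //.
apply: le_trans (dfk c) _; rewrite lerXn2r ?nnegrE // !ler0_norm ?lerN2 //.
exact: ltW.
Qed.

Lemma lipschitz1 f df : (forall x, is_derive x 1 f (df x)) ->
  (forall x, `|df x| <= 1) -> forall x y, `|f x - f y| <= `|x - y|.
Proof.
move=> Hd df1 x y; wlog xy : x y / y <= x => [H|].
  by have [/H //|/ltW/H] := leP y x; rewrite distrC (distrC x).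
have [c _ ->] := MVT_everywhere Hd xy.
by rewrite normrM ler_piMl.
Qed.

Lemma cos_lipschitz x y : `|cos x - cos y| <= `|x - y|.
Proof. by apply: (lipschitz1 (df := fun x => - sin x)) => z; rewrite normrN sin_max. Qed.

Lemma sin_lipschitz x y : `|sin x - sin y| <= `|x - y|.
Proof. by apply: (lipschitz1 (df := cos)) => z; rewrite cos_max. Qed.

Lemma sin_le_norm x : `|sin x| <= `|x|.
Proof. by have := sin_lipschitz x 0; rewrite sin0 !subr0. Qed.

Lemma cos_taylor1 x : `|cos x - 1| <= `|x| ^+ 2.
Proof.
apply: (taylor_step (f := fun x => cos x - 1) (df := fun x => - sin x)).
- by move=> z; apply: is_derive_eq; rewrite subr0.
- by rewrite cos0 subrr.
- by move=> z; rewrite normrN expr1 sin_le_norm.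
Qed.

Lemma sin_taylor x : `|sin x - x| <= `|x| ^+ 3.
Proof.
apply: (taylor_step (f := fun x => sin x - x) (df := fun x => cos x - 1)).
- by rewrite subr0 sin0.
- exact: cos_taylor1.
Qed.

Lemma cos_taylor x : `|cos x - 1 + x ^+ 2 / 2| <= `|x| ^+ 4.
Proof.
apply: (taylor_step (f := fun x => cos x - 1 + x ^+ 2 / 2) (df := fun x => - (sin x - x))).
- move=> z.
  have -> : (fun x => cos x - 1 + x ^+ 2 / 2) = (cos \- cst 1) \+ (2^-1 *: (id ^+ 2)).
    by apply/funext => t /=; rewrite /GRing.scale /= mulrC.
  by apply: is_derive_eq; rewrite /GRing.scale /= expr1 subr0; field.
- by rewrite cos0 subrr expr0n mul0r addr0.
- by move=> z; rewrite normrN sin_taylor.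
Qed.

Lemma expRN_taylor u : 0 <= u -> `|expR (- u) - (1 - u)| <= u ^+ 2.
Proof.
move=> u0; rewrite ger0_norm ?subr_ge0 ?expR_ge1Dx //.
have e0 : 0 < expR u by exact: expR_gt0.
rewrite expRN lerBlDr -[leLHS]mul1r ler_pdivrMr //.
have := expR_ge1Dx u; have : 0 <= u ^+ 2 + (1 - u) by nra.
move: (expR u) e0 => e e0; nra.
Qed.

Lemma expRN_lipschitz x y : 0 <= x -> 0 <= y -> `|expR (- x) - expR (- y)| <= `|x - y|.
Proof.
wlog xy : x y / x <= y => [H x0 y0|x0 y0].
  have [/H|/ltW/H] := leP x y; first exact.
  by rewrite distrC (distrC x); apply.
rewrite ger0_norm ?subr_ge0 ?ler_expR ?lerN2 // ler0_norm ?subr_le0 // opprB.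
have -> : - y = - x + - (y - x) by ring.
rewrite expRD -[X in X - _]mulr1 -mulrBr.
have := expR_ge1Dx (- (y - x)); have e1 : expR (- x) <= 1 by rewrite -[leRHS]expR0 ler_expR oppr_le0.
have e2 : expR (- (y - x)) <= 1 by rewrite -[leRHS]expR0 ler_expR oppr_le0 subr_ge0.
have := expR_gt0 (- x); move: (expR (- x)) (expR _) e1 e2 => a b; nra.
Qed.

End elementary_bounds.

Section newman.
Context {R : realType} {d : nat} (beta h : R) (mu : probability (config d) R).
Hypotheses (b0 : 0 <= beta) (h0 : 0 < h) (hmu : ising_measure beta h mu).
Implicit Types (f g : config d -> R) (x y : site d) (I J : seq (site d)).

Notation E := (Ex mu).
Notation Cov := (Cov mu).
Notation corr := (corr mu).

Lemma CovC f g : Cov f g = Cov g f.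
Proof. by rewrite /Cov mulrC; congr (E _ - _); apply/funext => z; rewrite mulrC. Qed.

Lemma Cov_suml (T : Type) (r : seq T) (c : T -> R) (f : T -> config d -> R) g :
  (forall i, local (f i)) -> local g ->
  Cov (fun z => \sum_(i <- r) c i * f i z) g = \sum_(i <- r) c i * Cov (f i) g.
Proof.
move=> lf lg; rewrite /Cov Ex_sum; last by move=> i; exact/bmZ/local_bm.
have -> : (fun z => (\sum_(i <- r) c i * f i z) * g z) =
    fun z => \sum_(i <- r) c i * (f i z * g z).
  by apply/funext => z; rewrite mulr_suml; apply: eq_bigr => i _; rewrite mulrA.
rewrite Ex_sum; last by move=> i; apply/bmZ/local_bm/localM.
rewrite mulr_suml -sumrB; apply: eq_bigr => i _.
by rewrite !ExZ ?mulrBr ?mulrA //; [exact: local_bm|exact/local_bm/localM].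
Qed.

(* Newman's relation f << f1, under which |Cov(f, g)| <= Cov(f1, g1). *)
Definition dominates f1 f := increasing (fun z => f1 z + f z) /\ increasing (fun z => f1 z - f z).

(** FKG applies to the four pairs formed by f1 + f, f1 - f and g1 + g, g1 - g; adding the
    inequalities two by two cancels the mixed covariances. *)
Lemma Cov_dominated f f1 g g1 : local f -> local f1 -> local g -> local g1 ->
  dominates f1 f -> dominates g1 g -> `|Cov f g| <= Cov f1 g1.
Proof.
move=> lf lf1 lg lg1 [fp fm] [gp gm].
have E2 (s t : R) : E (fun z => (f1 z + s * f z) * (g1 z + t * g z)) =
    E (fun z => f1 z * g1 z) + t * E (fun z => f1 z * g z)
    + s * E (fun z => f z * g1 z) + s * t * E (fun z => f z * g z).
  have -> : (fun z => (f1 z + s * f z) * (g1 z + t * g z)) = fun z =>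
     (f1 z * g1 z + t * (f1 z * g z)) + (s * (f z * g1 z) + s * t * (f z * g z)).
    by apply/funext => z; ring.
  rewrite !ExD ?ExZ ?addrA //; do ? [apply: bmD | apply: bmZ | apply: local_bm | exact: localM].
have E1 (s : R) k k1 : local k -> local k1 -> E (fun z => k1 z + s * k z) = E k1 + s * E k.
  by move=> lk lk1; rewrite ExD ?ExZ //; do ? [apply: bmZ | apply: local_bm].
have P (s t : R) : increasing (fun z => f1 z + s * f z) -> increasing (fun z => g1 z + t * g z) ->
   0 <= Cov f1 g1 + t * Cov f1 g + s * Cov f g1 + s * t * Cov f g.
  move=> i1 i2.
  have := Ex_fkg b0 h0 hmu (localD lf1 (localM (local_cst s) lf))
                (localD lg1 (localM (local_cst t) lg)) i1 i2.
  by rewrite E2 !E1 // /Cov; lra.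
have mulN k : (fun z : config d => k z) = fun z => 1 * k z :> (config d -> R).
  by apply/funext => z; rewrite mul1r.
have eP f' f1' : (fun z : config d => f1' z + 1 * f' z) = fun z => f1' z + f' z :> R.
  by apply/funext => z; rewrite mul1r.
have eM f' f1' : (fun z : config d => f1' z + (-1) * f' z) = fun z => f1' z - f' z :> R.
  by apply/funext => z; rewrite mulN1r.
have p1 := P 1 1; have p2 := P 1 (-1); have p3 := P (-1) 1; have p4 := P (-1) (-1).
rewrite !eP ?eM in p1 p2 p3 p4.
move: (p1 fp gp) (p2 fp gm) (p3 fm gp) (p4 fm gm) => {}p1 {}p2 {}p3 {}p4.
by rewrite ler_norml; apply/andP; split; lra.
Qed.

Variable r : site d -> R.

Definition lin I : config d -> R := fun z => \sum_(x <- I) r x * (sg (z x) - E (sgx x)).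
Definition linabs I : config d -> R := fun z => \sum_(x <- I) `|r x| * sgx x z.

Lemma local_lin I : local (lin I).
Proof.
apply: local_sum => x; apply: localM; first exact: local_cst.
by apply: localB; [exact: local_sg|exact: local_cst].
Qed.

Lemma local_linabs I : local (linabs I).
Proof. by apply: local_sum => x; apply: localM; [exact: local_cst|exact: local_sg]. Qed.

Lemma lin_cat I J z : lin (I ++ J) z = lin I z + lin J z.
Proof. by rewrite /lin big_cat. Qed.

(** Raising spins changes [lin] by at most the increase of [linabs], whose coefficients are the
    absolute values. *)
Lemma linabs_dominates (phi : R -> R) I : (forall s t, `|phi s - phi t| <= `|s - t|) ->
  dominates (linabs I) (fun z => phi (lin I z)).
Proof.
move=> lip; have key eta xi : lec eta xi ->
    `|phi (lin I xi) - phi (lin I eta)| <= linabs I xi - linabs I eta.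
  move=> le; apply: le_trans (lip _ _) _; rewrite /lin /linabs -!sumrB.
  apply: le_trans (ler_norm_sum _ _ _) _; apply: ler_sum => x _.
  rewrite -!mulrBr normrM ler_wpM2l //.
  have -> : sg (xi x) - E (sgx x) - (sg (eta x) - E (sgx x)) = sg (xi x) - sg (eta x) by ring.
  by rewrite ger0_norm // subr_ge0; apply: increasing_sg.
by split=> eta xi /key; rewrite ler_norml => /andP [? ?]; lra.
Qed.

Lemma Ex_lin I : E (lin I) = 0.
Proof.
rewrite /lin Ex_sum; last first.
  move=> x; apply: bmZ; apply: local_bm; apply: localB; [exact: local_sg|exact: local_cst].
rewrite big1 // => x _; rewrite ExZ; last first.
  by apply: local_bm; apply: localB; [exact: local_sg|exact: local_cst].
rewrite ExB; [|exact/local_bm/local_sg|exact: bm_cst].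
by rewrite Ex_cst subrr mulr0.
Qed.

Lemma Cov_sg_shift x c g : local g -> Cov (fun z => sg (z x) - c) g = Cov (sgx x) g.
Proof.
move=> lg; rewrite /Cov ExB; [|exact/local_bm/local_sg|exact: bm_cst].
have -> : (fun z => (sg (z x) - c) * g z) = fun z : config d => sgx x z * g z - c * g z.
  by apply/funext => z; rewrite mulrBl.
rewrite ExB ?ExZ ?Ex_cst; do ? [apply: bmZ]; try exact: local_bm.
  by rewrite /sgx; ring.
by apply/local_bm/localM => //; exact: local_sg.
Qed.

Lemma Cov_lin I J : Cov (lin I) (lin J) = \sum_(x <- I) \sum_(y <- J) r x * r y * corr (y - x).
Proof.
have lc x : local (fun z : config d => sg (z x) - E (sgx x)).
  by apply: localB; [exact: local_sg|exact: local_cst].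
rewrite Cov_suml //; last exact: local_lin.
apply: eq_bigr => x _; rewrite CovC Cov_suml // mulr_sumr; apply: eq_bigr => y _.
rewrite Cov_sg_shift // CovC Cov_sg_shift; last exact: local_sg.
by rewrite (Cov_sgx b0 h0 hmu) mulrA.
Qed.

Lemma Cov_linabs I J : Cov (linabs I) (linabs J)
  = \sum_(x <- I) \sum_(y <- J) `|r x| * `|r y| * corr (y - x).
Proof.
have lc x : local (@sgx R d x) by exact: local_sg.
rewrite Cov_suml //; last exact: local_linabs.
apply: eq_bigr => x _; rewrite CovC Cov_suml // mulr_sumr; apply: eq_bigr => y _.
by rewrite CovC (Cov_sgx b0 h0 hmu) mulrA.
Qed.

Lemma Ex_sgx_norm x : `|E (sgx x)| <= 1.
Proof. by apply: Ex_norm_le => [|z]; [exact/local_bm/local_sg|rewrite /sgx sg_norm]. Qed.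

(** A sup bound for [lin]: a centred spin is at most 2 in absolute value. *)
Definition width I := 2 * \sum_(x <- I) `|r x|.

Lemma lin_le_width I z : `|lin I z| <= width I.
Proof.
apply: le_trans (ler_norm_sum _ _ _) _; rewrite /width mulr_sumr; apply: ler_sum => x _.
rewrite normrM mulrC ler_wpM2r //; apply: le_trans (ler_normB _ _) _.
by rewrite sg_norm; have := Ex_sgx_norm x; lra.
Qed.

Lemma width_ge0 I : 0 <= width I.
Proof. by rewrite mulr_ge0 // sumr_ge0. Qed.

Definition Var I := Cov (lin I) (lin I).

Lemma VarE I : Var I = E (fun z => lin I z ^+ 2).
Proof.
rewrite /Var /Cov Ex_lin mulr0 subr0; congr E; apply/funext => z; exact: esym (expr2 _).
Qed.

Lemma Var_ge0 I : 0 <= Var I.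
Proof.
by rewrite VarE; apply: Rintegral_ge0 => z _; exact: sqr_ge0.
Qed.

Lemma bm_lin (phi : R -> R) I : bm (fun z => phi (lin I z)).
Proof. by apply: local_bm; apply: local_op; exact: local_lin. Qed.

(** Taylor expansion under the expectation. The linear term has mean zero, the variance is at most
    the squared width, and since the width is at most 1 all remainders fit into its cube. *)
Lemma single_cell I : width I <= 1 ->
  `|E (fun z => cos (lin I z)) - expR (- (Var I / 2))| <= 2 * width I ^+ 3 /\
  `|E (fun z => sin (lin I z))| <= width I ^+ 3.
Proof.
move=> w1; have w0 := width_ge0 I; set w := width I in w0 w1 *.
have v1 : Var I <= w ^+ 2.
  rewrite VarE -(Ex_cst mu (w ^+ 2)); apply: le_Ex; [exact: (bm_lin (fun t => t ^+ 2))|exact: bm_cst|].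
  by move=> z; rewrite -real_normK ?num_real // lerXn2r ?nnegrE // lin_le_width.
have v0 := Var_ge0 I; split; last first.
  have -> : E (fun z => sin (lin I z)) = E (fun z => sin (lin I z) - lin I z).
    by rewrite (ExB _ (bm_lin sin I) (bm_lin id I)) (Ex_lin I) subr0.
  apply: Ex_norm_le => [|z]; first exact: (bm_lin (fun t => sin t - t)).
  by apply: le_trans (sin_taylor _) _; rewrite lerXn2r ?nnegrE // lin_le_width.
have cE : E (fun z => cos (lin I z) - 1 + lin I z ^+ 2 / 2)
    = E (fun z => cos (lin I z)) - 1 + Var I / 2.
  rewrite (ExD _ (bm_lin (fun t => cos t - 1) I) (bm_lin (fun t => t ^+ 2 / 2) I)).
  rewrite (ExB _ (bm_lin cos I) (bm_cst 1)) Ex_cst VarE; congr (_ + _).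
  rewrite mulrC -ExZ; last exact: (bm_lin (fun t => t ^+ 2)).
  by congr E; apply/funext => z; rewrite mulrC.
have c1 : `|E (fun z => cos (lin I z)) - 1 + Var I / 2| <= w ^+ 4.
  rewrite -cE; apply: Ex_norm_le => [|z]; first exact: (bm_lin (fun t => cos t - 1 + t ^+ 2 / 2)).
  by apply: le_trans (cos_taylor _) _; rewrite lerXn2r ?nnegrE // lin_le_width.
have c2 : `|expR (- (Var I / 2)) - (1 - Var I / 2)| <= (Var I / 2) ^+ 2.
  by apply: expRN_taylor; rewrite divr_ge0.
have w43 : w ^+ 4 <= w ^+ 3 by rewrite exprS ler_piMl // exprn_ge0.
have v43 : (Var I / 2) ^+ 2 <= w ^+ 4.
  have -> : w ^+ 4 = (w ^+ 2) ^+ 2 by rewrite -exprM.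
  rewrite lerXn2r ?nnegrE ?divr_ge0 ?exprn_ge0 //; lra.
move: c1 c2; rewrite !ler_norml => /andP [? ?] /andP [? ?].
by apply/andP; split; lra.
Qed.

(** Dominating covariances over pairs of cells, each pair counted once. *)
Fixpoint cross (cs : seq (seq (site d))) : R :=
  if cs is c :: cs' then Cov (linabs c) (linabs (flatten cs')) + cross cs' else 0.

Lemma linabs_lin_lip (phi psi : R -> R) I J :
  (forall s t, `|phi s - phi t| <= `|s - t|) -> (forall s t, `|psi s - psi t| <= `|s - t|) ->
  `|E (fun z => phi (lin I z) * psi (lin J z))
    - E (fun z => phi (lin I z)) * E (fun z => psi (lin J z))| <= Cov (linabs I) (linabs J).
Proof.
move=> l1 l2; apply: Cov_dominated; try exact: linabs_dominates; try exact: local_linabs.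
  by apply: local_op; exact: local_lin.
by apply: local_op; exact: local_lin.
Qed.

(** Induction through the addition formulas, which tie cosine to sine. A new cell costs 2 w for its
    cosine, w for its sine, w being its cubed width, and one cross covariance for each of the two
    products to factorise; hence the constants 3 and 2. *)
Lemma newman_cells cs : (forall c, c \in cs -> width c <= 1) ->
  `|E (fun z => cos (lin (flatten cs) z)) - expR (- (\sum_(c <- cs) Var c / 2))|
    <= \sum_(c <- cs) 3 * width c ^+ 3 + 2 * cross cs /\
  `|E (fun z => sin (lin (flatten cs) z))|
    <= \sum_(c <- cs) 3 * width c ^+ 3 + 2 * cross cs.
Proof.
elim: cs => [_|c cs IH cs1].
  rewrite !big_nil /= mulr0 addr0 oppr0 expR0.
  have l0 z : lin [::] z = 0 by rewrite /lin big_nil.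
  under eq_fun do rewrite l0 cos0; under [X in _ /\ `|E X| <= _]eq_fun do rewrite l0 sin0.
  by rewrite !Ex_cst subrr normr0.
have {}IH := IH (fun c' H => cs1 c' (mem_behead (s := c :: cs) H)).
have /single_cell [k1 k2] : width c <= 1 by apply: cs1; rewrite mem_head.
rewrite /= !big_cons; set J := flatten cs in IH *.
set W := \sum_(c' <- cs) 3 * _ in IH *; set V := \sum_(c' <- cs) _ in IH *.
have cc := linabs_lin_lip c J cos_lipschitz cos_lipschitz.
have ss := linabs_lin_lip c J sin_lipschitz sin_lipschitz.
have cs' := linabs_lin_lip c J cos_lipschitz sin_lipschitz.
have sc := linabs_lin_lip c J sin_lipschitz cos_lipschitz.
have -> : E (fun z => cos (lin (c ++ J) z)) = E (fun z => cos (lin c z) * cos (lin J z))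
     - E (fun z => sin (lin c z) * sin (lin J z)).
  rewrite -ExB; [|by apply: bmM; exact: bm_lin..].
  by congr E; apply/funext => z; rewrite lin_cat cosD.
have -> : E (fun z => sin (lin (c ++ J) z)) = E (fun z => sin (lin c z) * cos (lin J z))
     + E (fun z => cos (lin c z) * sin (lin J z)).
  rewrite -ExD; [|by apply: bmM; exact: bm_lin..].
  by congr E; apply/funext => z; rewrite lin_cat sinD.
have n1 : `|E (fun z => cos (lin J z))| <= 1 by apply: Ex_norm_le => [|z]; [exact: bm_lin|exact: cos_max].
have n2 : `|E (fun z => sin (lin J z))| <= 1 by apply: Ex_norm_le => [|z]; [exact: bm_lin|exact: sin_max].
have e1 : expR (- (Var c / 2)) <= 1.
  by rewrite -[leRHS]expR0 ler_expR oppr_le0 divr_ge0 // Var_ge0.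
have e0 := expR_gt0 (- (Var c / 2)).
rewrite opprD expRD.
move: IH k1 k2 cc ss cs' sc n1 n2 e1 e0.
move: (E (fun z => cos (lin c z) * cos (lin J z))) (E (fun z => sin (lin c z) * sin (lin J z))).
move: (E (fun z => cos (lin c z) * sin (lin J z))) (E (fun z => sin (lin c z) * cos (lin J z))).
move: (E (fun z => cos (lin c z))) (E (fun z => cos (lin J z))).
move: (E (fun z => sin (lin c z))) (E (fun z => sin (lin J z))).
move: (expR (- (Var c / 2))) (expR (- V)) (Cov _ _) (width c ^+ 3) (cross cs).
move=> e eV D w X s sJ k kJ sc cs' ss cc [IH1 IH2] k1 k2 cc1 ss1 cs1' sc1 n1 n2 e1 e0.
have a1 : `|(k - e) * kJ| <= 2 * w.
  by rewrite normrM; apply: le_trans k1; rewrite ler_piMr.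
have a2 : `|s * sJ| <= w by rewrite normrM; apply: le_trans k2; rewrite ler_piMr.
have a3 : `|e * (kJ - eV)| <= W + 2 * X.
  by rewrite normrM; apply: le_trans IH1; rewrite ler_piMl // gtr0_norm.
have a4 : `|s * kJ| <= w by rewrite normrM; apply: le_trans k2; rewrite ler_piMr.
have a5 : `|(k - e) * sJ| <= 2 * w.
  by rewrite normrM; apply: le_trans k1; rewrite ler_piMr.
have a6 : `|e * sJ| <= W + 2 * X.
  by rewrite normrM; apply: le_trans IH2; rewrite ler_piMl // gtr0_norm.
move: a1 a2 a3 a4 a5 a6 cc1 ss1 cs1' sc1; rewrite !ler_norml.
move=> /andP [? ?] /andP [? ?] /andP [? ?] /andP [? ?] /andP [? ?] /andP [? ?].
move=> /andP [? ?] /andP [? ?] /andP [? ?] /andP [? ?].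
by split; apply/andP; split; lra.
Qed.

Lemma CovDl f1 f2 g : local f1 -> local f2 -> local g ->
  Cov (fun z => f1 z + f2 z) g = Cov f1 g + Cov f2 g.
Proof.
move=> l1 l2 lg; rewrite /Cov ExD; try exact: local_bm.
have -> : (fun z => (f1 z + f2 z) * g z) = fun z => f1 z * g z + f2 z * g z.
  by apply/funext => z; rewrite mulrDl.
by rewrite ExD; [ring|exact/local_bm/localM|exact/local_bm/localM].
Qed.

Lemma Var_cells cs : `|Var (flatten cs) - \sum_(c <- cs) Var c| <= 2 * cross cs.
Proof.
elim: cs => [|c cs IH] /=.
  rewrite big_nil /Var Cov_lin !big_nil subrr normr0; lra.
rewrite big_cons; set J := flatten cs in IH *.
have -> : Var (c ++ J) = Var c + 2 * Cov (lin c) (lin J) + Var J.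
  have E1 : lin (c ++ J) = fun z => lin c z + lin J z by apply/funext => z; exact: lin_cat.
  rewrite /Var E1 CovDl; try exact: local_lin; last by apply: localD; exact: local_lin.
  rewrite CovC (CovC (lin J)) !CovDl; try exact: local_lin.
  by rewrite (CovC (lin J)); ring.
(* The identity is itself 1-Lipschitz, so the covariance of the two linear forms is dominated as
   well. *)
have := @linabs_lin_lip id id c J (fun _ _ => lexx _) (fun _ _ => lexx _).
rewrite -/(Cov (lin c) (lin J)).
move: IH; rewrite !ler_norml => /andP [? ?] /andP [? ?].
by apply/andP; split; lra.
Qed.

Variables (K : eqType) (kappa : site d -> K) (I : seq (site d)).

Let cells (ks : seq K) := [seq [seq x <- I | kappa x == k] | k <- ks].

Lemma sum_cells (g : site d -> R) ks : uniq ks ->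
  \sum_(x <- flatten (cells ks)) g x = \sum_(x <- I | kappa x \in ks) g x.
Proof.
elim: ks => [|k ks IH] /=; first by rewrite big_nil big1.
move=> /andP [kks uks]; rewrite big_cat /= IH // big_filter.
rewrite [RHS](bigID (fun x => kappa x == k)) /=; congr (_ + _).
  by apply: eq_bigl => x; rewrite andb_idl // => /eqP ->; rewrite mem_head.
apply: eq_bigl => x; rewrite in_cons; case: (eqVneq (kappa x) k) => [->|_] /=; last by rewrite andbT.
by rewrite (negbTE kks).
Qed.

Let off := \sum_(x <- I) \sum_(y <- I | kappa y != kappa x) `|r x| * `|r y| * corr (y - x).

Lemma cross_cells ks : uniq ks ->
  cross (cells ks) <= \sum_(x <- I | kappa x \in ks)
     \sum_(y <- I | kappa y != kappa x) `|r x| * `|r y| * corr (y - x).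
Proof.
have w0 x y : 0 <= `|r x| * `|r y| * corr (y - x).
  by rewrite !mulr_ge0 // (corr_ge0 b0 h0 hmu).
elim: ks => [|k ks IH] /=; first by rewrite big1.
move=> /andP [kks uks]; rewrite (bigID (fun x => kappa x == k)) /=; apply: lerD.
  rewrite Cov_linabs big_filter.
  have -> : \sum_(i <- I | (kappa i \in k :: ks) && (kappa i == k))
      \sum_(y <- I | kappa y != kappa i) `|r i| * `|r y| * corr (y - i)
    = \sum_(i <- I | kappa i == k)
      \sum_(y <- I | kappa y != kappa i) `|r i| * `|r y| * corr (y - i).
    by apply: eq_bigl => x; rewrite andb_idl // => /eqP ->; rewrite mem_head.
  apply: ler_sum => x /eqP kx; rewrite (sum_cells (fun y => `|r x| * `|r y| * corr (y - x))) //.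
  rewrite [leRHS](bigID (fun y => kappa y \in ks)) /= -[leLHS]addr0; apply: lerD.
    rewrite le_eqVlt; apply/orP; left; apply/eqP; apply: eq_bigl => y.
    by rewrite kx; case: eqP => //= ->; rewrite (negbTE kks).
  by apply: sumr_ge0.
apply: le_trans (IH uks) _; rewrite le_eqVlt; apply/orP; left; apply/eqP.
apply: eq_bigl => x; rewrite in_cons; case: (eqVneq (kappa x) k) => [->|_] /=; last by rewrite andbT.
by rewrite (negbTE kks).
Qed.

(** Bounding two factors of each cubed width by b turns the sum of cubes into b^2 times the total
    width. Of the three copies of [off], two come from [newman_cells] and one from replacing the sum
    of the cell variances by the variance of the sum. *)
Theorem newman_clt_bound (b : R) : b <= 1 ->
  (forall k, width [seq x <- I | kappa x == k] <= b) ->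
  `|E (fun z => cos (lin I z)) - expR (- (Var I / 2))| <= 3 * b ^+ 2 * width I + 3 * off /\
  `|E (fun z => sin (lin I z))| <= 3 * b ^+ 2 * width I + 3 * off.
Proof.
move=> b1 wb; set ks := undup [seq kappa x | x <- I].
have uks : uniq ks by exact: undup_uniq.
have kI x : x \in I -> kappa x \in ks by move=> xI; rewrite mem_undup; apply: map_f.
have sumI (g : site d -> R) : \sum_(x <- flatten (cells ks)) g x = \sum_(x <- I) g x.
  rewrite sum_cells // big_seq_cond [RHS]big_seq_cond; apply: eq_bigl => x.
  by case: (boolP (x \in I)) => //= /kI ->.
have linI z : lin (flatten (cells ks)) z = lin I z by rewrite /lin sumI.
have VarI : Var (flatten (cells ks)) = Var I by rewrite /Var (funext linI).
have wk c : c \in cells ks -> width c <= b by move=> /mapP [k _ ->].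
have crI : cross (cells ks) <= off.
  apply: le_trans (cross_cells uks) _; rewrite /off big_seq_cond [leRHS]big_seq_cond.
  rewrite le_eqVlt; apply/orP; left; apply/eqP; apply: eq_bigl => x.
  by case: (boolP (x \in I)) => //= /kI ->.
have wI : \sum_(c <- cells ks) 3 * width c ^+ 3 <= 3 * b ^+ 2 * width I.
  have -> : width I = \sum_(c <- cells ks) width c.
    rewrite /width -mulr_sumr -sumI; congr (2 * _).
    by elim: (cells ks) => [|c cs IH]; rewrite ?big_nil //= big_cat big_cons IH.
  rewrite mulr_sumr big_seq [leRHS]big_seq; apply: ler_sum => c /wk cb.
  rewrite -mulrA ler_wpM2l // exprSr ler_wpM2r ?width_ge0 //.
  by rewrite lerXn2r ?nnegrE ?width_ge0 // (le_trans (width_ge0 c)).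
have [h1 h2] := @newman_cells (cells ks) (fun c H => le_trans (wk c H) b1).
have V1 := Var_cells (cells ks); rewrite VarI in V1.
have lip := @expRN_lipschitz R (\sum_(c <- cells ks) Var c / 2) (Var I / 2).
rewrite -mulr_suml in h1 lip.
have V0 : 0 <= \sum_(c <- cells ks) Var c by apply: sumr_ge0 => c _; exact: Var_ge0.
have {}lip := lip (divr_ge0 V0 (ler0n _ 2)) (divr_ge0 (Var_ge0 I) (ler0n _ 2)).
have {}lip : `|expR (- ((\sum_(c <- cells ks) Var c) / 2)) - expR (- (Var I / 2))| <= cross (cells ks).
  apply: le_trans lip _; rewrite -mulrBl normrM distrC (ger0_norm (_ : 0 <= 2^-1)) //; lra.
have cr0 : 0 <= cross (cells ks) by exact: le_trans (normr_ge0 _) lip.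
have w0 := width_ge0 I.
rewrite (funext (fun z => congr1 cos (linI z))) in h1.
rewrite (funext (fun z => congr1 sin (linI z))) in h2.
split.
  move: h1 lip; rewrite !ler_norml => /andP [? ?] /andP [? ?].
  by apply/andP; split; lra.
by apply: le_trans h2 _; lra.
Qed.

End newman.

(** * Slices *)

Section family_sums.
Context {R : realType} {I : choiceType}.
Implicit Types (f : I -> R) (F : {fset I}).

(** Reduces infinite sums to finite partial sums, the only form in which they are handled
    afterwards. *)
Lemma nonneg_family_sum f (C : R) : (forall i, 0 <= f i) ->
  (forall F, \sum_(i <- F) f i <= C) ->
  [/\ summable [set: I] (fun i => (f i)%:E),
      forall F, \sum_(i <- F) f i <= family_sum f &
      forall e : R, 0 < e -> exists F, family_sum f - e < \sum_(i <- F) f i].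
Proof.
move=> f0 fC.
have sumE F : (\sum_(i <- F) (f i)%:E = (\sum_(i <- F) f i)%:E)%E by rewrite sumEFin.
have esE : (\esum_(i in [set: I]) (f i)%:E =
    ereal_sup [set (\sum_(i <- F) f i)%:E | F in [set: {fset I}]])%E.
  rewrite /esum; congr ereal_sup; apply/seteqP; split => [_ [A [fA _] <-]|_ [F _ <-]].
    by exists (fset_set A) => //; rewrite -sumE fsbig_finite.
  exists [set` F]; first by split; [exact: finite_fset|].
  by rewrite -sumE fsbig_finite //= set_fsetK.
set s := (\esum_(i in [set: I]) (f i)%:E)%E.
have sC : (s <= C%:E)%E.
  by rewrite /s esE; apply: ge_ereal_sup => _ [F _ <-]; rewrite lee_fin.
have s0 : (0 <= s)%E by apply: esum_ge0 => i _; rewrite lee_fin.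
have sfin : s \is a fin_num by rewrite ge0_fin_numE // (le_lt_trans sC) ?ltry.
have fs : family_sum f = fine s.
  rewrite /family_sum /s.
  have -> : f^\+ = f by apply/funext => i; rewrite /funrpos; apply/max_idPl.
  have -> : f^\- = fun=> 0.
    by apply/funext => i; rewrite /funrneg; apply/max_idPr; rewrite oppr_le0.
  by rewrite [X in _ - fine X]esum1 // fine0 subr0.
split.
- rewrite /summable; apply: le_lt_trans (ltry C); apply: le_trans sC.
  by rewrite /s le_eqVlt; apply/orP; left; apply/eqP; apply: eq_esum => i _; rewrite gee0_abs ?lee_fin.
- move=> F; rewrite fs -lee_fin fineK // /s esE; apply: ereal_sup_ubound.
  by exists F.
- move=> e e0; rewrite fs.
  have sfin' := sfin; rewrite /s esE in sfin'.
  have [_ [F _ <-]] := ub_ereal_sup_adherent e0 sfin'; rewrite -esE -/s.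
  by rewrite -[X in (X - _ < _)%E]fineK // -EFinB lte_fin => H; exists F.
Qed.

End family_sums.

(** * Counting the translated grids that separate two sites *)

Section shifted_cells.
Implicit Types (w v : int) (l : nat).

(** Hermite's identity up to a constant: moving w to w + 1 trades the term of w for that of w + l,
    which is larger by exactly one. *)
Lemma sum_divz_shift l w v : (0 < l)%N ->
  \sum_(0 <= j < l) ((w + Posz j) %/ Posz l)%Z - \sum_(0 <= j < l) ((v + Posz j) %/ Posz l)%Z = w - v.
Proof.
move=> l0; pose G w := \sum_(0 <= j < l) ((w + Posz j) %/ Posz l)%Z.
have step u : G (u + 1) = G u + 1.
  have E1 : \sum_(0 <= j < l.+1) ((u + Posz j) %/ Posz l)%Z = (u %/ Posz l)%Z + G (u + 1).
    rewrite big_nat_recl // addr0; congr (_ + _); apply: eq_bigr => j _.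
    by congr (_ %/ _)%Z; lia.
  have E2 : \sum_(0 <= j < l.+1) ((u + Posz j) %/ Posz l)%Z = G u + ((u + Posz l) %/ Posz l)%Z.
    by rewrite big_nat_recr.
  have E3 : ((u + Posz l) %/ Posz l)%Z = (u %/ Posz l)%Z + 1.
    by rewrite divzDr ?dvdzz // divzz; case: l l0 {G E1 E2}.
  rewrite E3 in E2; rewrite E1 in E2; move: E2; lia.
have up u (m : nat) : G (u + Posz m) = G u + Posz m.
  elim: m => [|m IH]; first by rewrite !addr0.
  have -> : u + Posz m.+1 = (u + Posz m) + 1 by lia.
  rewrite step IH; lia.
rewrite -/(G w) -/(G v); have [vw|wv] := leP v w.
  have -> : w = v + Posz `|w - v|%N by lia.
  by rewrite up; lia.
have -> : v = w + Posz `|v - w|%N by lia.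
by rewrite up; lia.
Qed.

(** For v <= w the quotients differ in the same direction for all offsets, by at least 1 where they
    differ, and the total difference is w - v. *)
Lemma count_cell_changes l w v : (0 < l)%N ->
  (\sum_(0 <= j < l) (((w + Posz j) %/ Posz l)%Z != ((v + Posz j) %/ Posz l)%Z) <= `|w - v|)%N.
Proof.
move=> l0; wlog vw : w v / v <= w => [H|].
  have [/H //|/ltW/H] := leP v w; rewrite distnC.
  by congr (_ <= _)%N; apply: eq_bigr => j _; rewrite eq_sym.
have := sum_divz_shift w v l0; rewrite -sumrB => E.
rewrite -lez_nat gez0_abs ?subr_ge0 // -E.
rewrite [X in X <= _](big_morph Posz PoszD (erefl _)); apply: ler_sum => j _.
have : ((v + Posz j) %/ Posz l)%Z <= ((w + Posz j) %/ Posz l)%Z.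
  by apply: (@lez_pdiv2r (Posz l)); lia.
move: ((v + Posz j) %/ Posz l)%Z ((w + Posz j) %/ Posz l)%Z => p q.
by case: eqVneq => /=; lia.
Qed.

Context {R : realType} {d : nat}.
Implicit Types (x y u : site d) (I : seq (site d)).

Definition cell l (j : nat) x : 'rV[int]_d.-1 := \row_(i < d.-1) ((x.2 0%R i + Posz j) %/ Posz l)%Z.

Definition norm1 u : nat := (\sum_(i < d.-1) `|u.2 0%R i|)%N.

Lemma count_cell l x y : (0 < l)%N ->
  (\sum_(0 <= j < l) (cell l j y != cell l j x) <= norm1 (y - x)%R)%N.
Proof.
move=> l0; apply: (@leq_trans (\sum_(0 <= j < l) \sum_i
    (((y.2 0%R i + Posz j) %/ Posz l)%Z != ((x.2 0%R i + Posz j) %/ Posz l)%Z))%N).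
  apply: leq_sum => j _; have [//|/eqP ne] := eqVneq (cell l j y) (cell l j x).
  have [i Hi] : exists i, ((y.2 0%R i + Posz j) %/ Posz l)%Z != ((x.2 0%R i + Posz j) %/ Posz l)%Z.
    apply: contrapT => /forallNP H; apply: ne; apply/rowP => i; rewrite !mxE.
    by apply/eqP/negPn/negP; exact: H.
  by rewrite (bigD1 i) //= Hi.
rewrite exchange_big /=; apply: leq_sum => i _.
by apply: leq_trans (count_cell_changes _ _ l0) _; rewrite !mxE.
Qed.

(** Inside a cell a site is determined by its time and the residues modulo [l] of its shifted
    coordinates. *)
Lemma size_cell l j I (ts : seq int) k : (0 < l)%N -> uniq I -> (forall x, x \in I -> x.1 \in ts) ->
  (size [seq x <- I | cell l j x == k] <= size ts * l ^ d.-1)%N.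
Proof.
case: l => // l _ uI It.
pose g x : {ffun 'I_d.-1 -> 'I_l.+1} :=
  [ffun i => inord `|((x.2 0%R i + Posz j) %% Posz l.+1)%Z|].
have -> : (size ts * l.+1 ^ d.-1)%N = size [seq (t, f) | t <- ts, f <- enum {: {ffun 'I_d.-1 -> 'I_l.+1}}].
  by rewrite size_allpairs -cardE card_ffun !card_ord.
rewrite -(size_map (fun x => (x.1, g x))); apply: uniq_leq_size.
  rewrite map_inj_in_uniq ?filter_uniq // => x y; rewrite !mem_filter.
  move=> /andP [/eqP xk _] /andP [/eqP yk _] [x1 gxy].
  rewrite -xk in yk; case: x y x1 yk gxy {xk} => [t x] [t' y] /= -> yk gxy; congr pair.
  apply/rowP => i; have := congr1 (fun v : 'rV_d.-1 => v 0 i) yk.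
  rewrite /cell !mxE /= => q.
  have := congr1 (fun f : {ffun 'I_d.-1 -> 'I_l.+1} => val (f i)) gxy; rewrite !ffunE /=.
  have md (z : int) : (absz (z %% Posz l.+1)%Z < l.+1)%N.
    by have := @ltz_pmod z (Posz l.+1) isT; have := @modz_ge0 z (Posz l.+1) isT; lia.
  rewrite !inordK ?md // => m.
  have e1 := divz_eq (x 0 i + Posz j) (Posz l.+1); have e2 := divz_eq (y 0 i + Posz j) (Posz l.+1).
  have p1 := @modz_ge0 (x 0 i + Posz j) (Posz l.+1) isT.
  have p2 := @modz_ge0 (y 0 i + Posz j) (Posz l.+1) isT.
  rewrite q in e2; lia.
move=> _ /mapP [x xI ->]; apply/allpairsP; exists (x.1, g x); split => //=.
  by apply: It; move: xI; rewrite mem_filter => /andP [].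
by rewrite mem_enum.
Qed.

End shifted_cells.

Section slices.
Context {R : realType} {d : nat} (beta h : R) (mu : probability (config d) R).
Hypotheses (b0 : 0 <= beta) (h0 : 0 < h) (hmu : ising_measure beta h mu).
Implicit Types (x y u : site d) (I J : seq (site d)).

Notation E := (Ex mu).
Notation Cov := (Cov mu).
Notation corr := (corr mu).

Let corr0 u : 0 <= corr u. Proof. exact: (corr_ge0 b0 h0 hmu). Qed.

Lemma corr_tail (e : R) : 0 < e -> exists N : nat, forall I, uniq I ->
  \sum_(u <- I | (N < norm1 u)%N) corr u <= e.
Proof.
move=> e0; have sc (F : {fset site d}) : \sum_(u <- F) corr u <= 2 / h.
  by apply: (sum_corr_le b0 h0 hmu); exact: fset_uniq.
have [_ ub /(_ e e0) [F HF]] := nonneg_family_sum corr0 sc.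
exists (\max_(u <- F) norm1 u) => I uI.
have := ub (F `|` [fset u in [seq u <- I | (\max_(u <- F) norm1 u < norm1 u)%N]])%fset.
set G := [fset u in _]%fset.
have FG : [disjoint F & G]%fset.
  apply/fdisjointP => u uF; rewrite in_fset mem_filter negb_and -leqNgt.
  by rewrite (@leq_bigmax_seq _ _ xpredT).
have -> : \sum_(u <- (F `|` G)%fset) corr u = \sum_(u <- F) corr u + \sum_(u <- G) corr u.
  rewrite (sum_fset_subset (A := F)) ?fsubsetUl // fsetDUl fsetDv fset0U.
  by move: FG; rewrite fdisjoint_sym => /fsetDidPl ->.
have -> : \sum_(u <- G) corr u = \sum_(u <- I | (\max_(u <- F) norm1 u < norm1 u)%N) corr u.
  rewrite -[RHS]big_filter; apply/perm_big/uniq_perm; rewrite ?fset_uniq ?filter_uniq //.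
  by move=> u; rewrite in_fset.
by move: HF; lra.
Qed.

(* Two sites are separated by at most |x - y|_1 of the l translated grids of mesh
   l; averaging over the translations makes the correlations across cells small. *)
Lemma good_cells (e : R) : 0 < e -> exists l : nat, (0 < l)%N /\ forall I, uniq I ->
  exists j, \sum_(x <- I) \sum_(y <- I | cell l j y != cell l j x) corr (y - x)
     <= e * (size I)%:R.
Proof.
move=> e0; have e2 : 0 < e / 2 by rewrite divr_gt0.
have [N HN] := corr_tail e2.
(* Near pairs, at distance at most [N], are separated by at most [N] of the [l] grids and cost at
   most N (2 / h) / l per site on average; far pairs cost at most e / 2 by the choice of [N]. *)
pose l := (Num.bound ((N%:R * (2 / h)) / (e / 2) : R)).+1%N.
have lb : N%:R * (2 / h) <= (e / 2) * l%:R.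
  rewrite [leRHS]mulrC -ler_pdivrMr // ltW //.
  apply: (@lt_le_trans _ _ (Num.bound ((N%:R * (2 / h)) / (e / 2) : R))%:R).
    by apply: archi_boundP; rewrite !mulr_ge0 ?invr_ge0 // ltW.
  by rewrite ler_nat leqnSn.
exists l; split => // I uI.
have l0 : (0 < l)%N by [].
have lR : 0 < l%:R :> R by rewrite ltr0n.
pose Q j := \sum_(x <- I) \sum_(y <- I | cell l j y != cell l j x) corr (y - x).
have avg : \sum_(0 <= j < l) Q j <= e * (size I)%:R * l%:R.
  rewrite /Q exchange_big /=.
  have -> : e * (size I)%:R * l%:R = \sum_(x <- I) (e * l%:R).
    by rewrite big_const_seq count_predT iter_addr_0 -[RHS]mulr_natr mulrAC.
  apply: ler_sum => x _.
  have -> : \sum_(0 <= j < l) \sum_(y <- I | cell l j y != cell l j x) corr (y - x)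
    = \sum_(y <- I) corr (y - x) * (\sum_(0 <= j < l) (cell l j y != cell l j x))%N%:R.
    under eq_bigr do rewrite big_mkcond.
    rewrite exchange_big /=; apply: eq_bigr => y _.
    rewrite natr_sum mulr_sumr; apply: eq_bigr => j _.
    by case: (cell l j y != _); rewrite ?mulr1 ?mulr0.
  have uJ : uniq [seq y - x | y <- I] by rewrite map_inj_uniq // => ? ? /addIr.
  apply: (@le_trans _ _ (\sum_(u <- [seq y - x | y <- I])
     (N%:R * corr u + (if (N < norm1 u)%N then l%:R * corr u else 0)))).
    rewrite big_map; apply: ler_sum => y _.
    have [Nu|Nu] := ltnP N (norm1 (y - x)).
      apply: (@le_trans _ _ (l%:R * corr (y - x))); last by rewrite lerDr mulr_ge0.
      rewrite mulrC ler_wpM2r // ler_nat -[leqRHS]subn0 -[leqRHS]muln1 -sum_nat_const_nat.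
      by apply: leq_sum => j _; case: (_ != _).
    rewrite addr0 mulrC ler_wpM2r // ler_nat; exact: leq_trans (count_cell _ _ l0) Nu.
  rewrite big_split /= -mulr_sumr -big_mkcond -mulr_sumr.
  have h1 : N%:R * \sum_(u <- [seq y - x | y <- I]) corr u <= (e / 2) * l%:R.
    by apply: le_trans lb; apply: ler_wpM2l => //; exact: (sum_corr_le b0 h0 hmu).
  have h2 : l%:R * \sum_(u <- [seq y - x | y <- I] | (N < norm1 u)%N) corr u <= (e / 2) * l%:R.
    by rewrite mulrC ler_pM2r //; exact: HN.
  have := lerD h1 h2; congr (_ <= _); by field.
(* If every translate exceeded the bound, so would their average. *)
apply: contrapT => /forallNP H.
have : \sum_(0 <= j < l) (e * (size I)%:R) < \sum_(0 <= j < l) Q j.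
  apply: ltr_sum_nat => // j _; rewrite ltNge; apply/negP; exact: H.
by rewrite big_const_nat subn0 iter_addr_0 -[X in X < _]mulr_natr ltNge avg.
Qed.

End slices.

Lemma seq_cst {R : realType} (c : R) : (fun=> c) n @[n --> \oo] --> c.
Proof. exact: cvg_cst. Qed.

Lemma seqV {R : realType} (u : nat -> R) (a : R) : a != 0 -> u n @[n --> \oo] --> a ->
  (u n)^-1 @[n --> \oo] --> a^-1.
Proof. by move=> a0 ua; exact: cvgV. Qed.

(** * Covariances of slices and the limit of their characteristic functions *)

Section slice_covariances.
Context {R : realType} {d : nat} (beta h : R) (mu : probability (config d) R).
Hypotheses (b0 : 0 <= beta) (h0 : 0 < h) (hmu : ising_measure beta h mu).
Implicit Types (M m n : nat) (t : int) (y : 'rV[int]_d.-1).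

Notation E := (Ex mu).
Notation corr := (corr mu).
Notation cubeM := (cube d.-1).

Definition pt t y : site d := (t, y).

Let corr_nonneg u : 0 <= corr u. Proof. exact: (corr_ge0 b0 h0 hmu). Qed.

Definition slice_corr t y : R := corr (pt t y).
Definition kap t : R := family_sum (slice_corr t).
Definition slice_cov M t : R :=
  \sum_(y <- cubeM M) \sum_(y' <- cubeM M) slice_corr t (y' - y).

Lemma slice_corr_sum_le t (F : seq 'rV[int]_d.-1) : uniq F ->
  \sum_(y <- F) slice_corr t y <= 2 / h.
Proof.
move=> uF; rewrite -(big_map (pt t) xpredT corr); apply: (sum_corr_le b0 h0 hmu).
by rewrite map_inj_uniq // => y y' [].
Qed.

Lemma slice_corr_family t :
  [/\ summable [set: 'rV[int]_d.-1] (fun y => (slice_corr t y)%:E),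
      forall F : {fset 'rV[int]_d.-1}, \sum_(y <- F) slice_corr t y <= kap t &
      forall e : R, 0 < e -> exists F : {fset 'rV[int]_d.-1},
         kap t - e < \sum_(y <- F) slice_corr t y].
Proof.
apply: (nonneg_family_sum (C := 2 / h)) => [y|F]; first exact: corr_nonneg.
exact/slice_corr_sum_le/fset_uniq.
Qed.

Lemma sum_slice_corr_le t (F : seq 'rV[int]_d.-1) : uniq F ->
  \sum_(y <- F) slice_corr t y <= kap t.
Proof.
move=> uF; have [_ H _] := slice_corr_family t.
have := H [fset y in F]%fset; congr (_ <= _); apply/perm_big/uniq_perm => // y.
by rewrite in_fset.
Qed.

Lemma card_cubeR M : #|` cubeM M|%:R = (M.*2.+1%:R : R) ^+ d.-1.
Proof. by rewrite card_cube natrX. Qed.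

Lemma card_cubeR_gt0 M : 0 < #|` cubeM M|%:R :> R.
Proof. by rewrite card_cubeR exprn_gt0 // ltr0n. Qed.

Lemma fset_sub_cube (F : {fset 'rV[int]_d.-1}) : exists m, (F `<=` cubeM m)%fset.
Proof.
exists (\max_(y <- F) \sum_(i < d.-1) `|y 0%R i|)%N; apply/fsubsetP => y yF.
rewrite mem_cube; apply/forallP => i.
suff : (`|y 0%R i| <= \max_(y <- F) \sum_(i < d.-1) `|y 0%R i|)%N.
  by move: (\max_(y <- F) _)%N (y 0 i) => m u; lia.
apply: (@leq_trans (\sum_(i < d.-1) `|y 0%R i|)%N); first by rewrite (bigD1 i) //= leq_addr.
exact: (@leq_bigmax_seq _ _ xpredT (fun y : 'rV[int]_d.-1 => (\sum_(i < d.-1) `|y 0%R i|)%N)).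
Qed.

Lemma inv_odd_cvg m : (n + m).*2.+1%:R^-1 @[n --> \oo] --> (0 : R).
Proof.
apply: (@squeeze_cvgr _ _ _ _ (cst 0) (@harmonic R)).
- apply: nearW => n; rewrite /cst /harmonic invr_ge0 ler0n /=.
  by rewrite lef_pV2 ?posrE ?ltr0n // ler_nat; lia.
- exact: cvg_cst.
- exact: cvg_harmonic.
Qed.

Lemma cube_ratio_cvg m :
  #|` cubeM n|%:R / #|` cubeM (n + m)|%:R @[n --> \oo] --> (1 : R).
Proof.
have E1 n : #|` cubeM n|%:R / #|` cubeM (n + m)|%:R
    = (1 + - (m.*2)%:R * (n + m).*2.+1%:R^-1) ^+ d.-1 :> R.
  rewrite !card_cubeR -expr_div_n; congr (_ ^+ _).
  have N0 : (n + m).*2.+1%:R != 0 :> R by rewrite pnatr_eq0.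
  apply: (mulIf N0); rewrite divfK // mulrDl mul1r -mulrA mulVf // mulr1.
  have -> : (n + m).*2.+1 = (n.*2.+1 + m.*2)%N by lia.
  by rewrite natrD; ring.
under eq_fun do rewrite E1.
have L : 1 + - (m.*2)%:R * (n + m).*2.+1%:R^-1 @[n --> \oo] --> (1 : R).
  have := seqD (@seq_cst R 1) (seqZ (c := - (m.*2)%:R) (inv_odd_cvg m)).
  by rewrite mulr0 addr0 => H; apply: H.
elim: d.-1 => [|k IH]; first by under eq_fun do rewrite expr0; exact: cvg_cst.
under eq_fun do rewrite exprS.
by have := seqM L IH; rewrite mulr1 => H; apply: H.
Qed.

Lemma slice_cov_le M t : slice_cov M t <= #|` cubeM M|%:R * kap t.
Proof.
rewrite -sum1_size natr_sum mulr_suml; apply: ler_sum => y _; rewrite mul1r.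
rewrite -(big_map (fun y' => y' - y) xpredT (slice_corr t)); apply: sum_slice_corr_le.
by rewrite map_inj_uniq ?fset_uniq // => ? ? /addIr.
Qed.

Lemma sum_subset_le (T : choiceType) (s s' : seq T) (f : T -> R) : uniq s -> uniq s' ->
  {subset s <= s'} -> (forall x, 0 <= f x) -> \sum_(x <- s) f x <= \sum_(x <- s') f x.
Proof.
move=> us us' ss f0; rewrite [leRHS](bigID (mem s)) /= -[leLHS]addr0; apply: lerD; last first.
  exact: sumr_ge0.
rewrite -[leRHS]big_filter; suff p : perm_eq s [seq x <- s' | x \in s] by rewrite (perm_big _ p).
apply: uniq_perm => //; first exact: filter_uniq.
by move=> x; rewrite mem_filter andb_idr // => /ss.
Qed.

(** A point of the inner cube, translated by any element of [F], stays in the outer cube, so it sees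
    all the correlations indexed by [F]; FKG allows the rest to be dropped. *)
Lemma slice_cov_ge n m t (F : {fset 'rV[int]_d.-1}) : (F `<=` cubeM m)%fset ->
  #|` cubeM n|%:R * (\sum_(y <- F) slice_corr t y) <= slice_cov (n + m) t.
Proof.
move=> Fm; apply: (@le_trans _ _ (\sum_(y <- cubeM n) \sum_(y' <- cubeM (n + m)) slice_corr t (y' - y))).
  rewrite -sum1_size natr_sum mulr_suml big_seq [leRHS]big_seq; apply: ler_sum => y yn.
  rewrite mul1r -(big_map (fun y' => y' - y) xpredT (slice_corr t)).
  apply: sum_subset_le; rewrite ?fset_uniq //.
  - by rewrite map_inj_uniq ?fset_uniq // => ? ? /addIr.
  - move=> z zF; apply/mapP; exists (z + y); last by rewrite addrK.
    move: yn (fsubsetP Fm _ zF); rewrite !mem_cube => /forallP yn /forallP zm.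
    by apply/forallP => i; have := yn i; have := zm i; rewrite !mxE; move: (z 0 i) (y 0 i) => p q; lia.
  - by move=> z; exact: corr_nonneg.
apply: sum_subset_le; rewrite ?fset_uniq //.
- move=> y; rewrite !mem_cube => /forallP H; apply/forallP => i; have := H i; lia.
- by move=> y; apply: sumr_ge0 => y' _; exact: corr_nonneg.
Qed.

Lemma slice_cov_cvg t : slice_cov M t / #|` cubeM M|%:R @[M --> \oo] --> kap t.
Proof.
apply/cvgrPdist_le => e e0; have e2 : 0 < e / 2 by rewrite divr_gt0.
have [_ _ /(_ _ e2) [F HF]] := slice_corr_family t.
have [m Fm] := fset_sub_cube F.
have S0 : 0 <= \sum_(y <- F) slice_corr t y by apply: sumr_ge0 => y _; exact: corr_nonneg.
have := seqM (cube_ratio_cvg m) (@seq_cst R (\sum_(y <- F) slice_corr t y)).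
rewrite mul1r => /cvgrPdist_le /(_ _ e2) [N _ HN].
exists (N + m)%N => // M /= NM; have := HN (M - m)%N; rewrite /= leq_subRL; last lia.
rewrite addnC => /(_ NM); rewrite subnK; last lia.
move=> H; have := @slice_cov_ge (M - m) m t F Fm; rewrite subnK; last lia.
move=> lo; have up := slice_cov_le M t; have c0 := card_cubeR_gt0 M.
have lo' : #|` cubeM (M - m)|%:R / #|` cubeM M|%:R * \sum_(y <- F) slice_corr t y
   <= slice_cov M t / #|` cubeM M|%:R.
  by rewrite mulrAC ler_pM2r // invr_gt0.
have up' : slice_cov M t / #|` cubeM M|%:R <= kap t by rewrite ler_pdivrMr // mulrC.
move: H; rewrite !ler_norml => /andP [? ?]; apply/andP; split; lra.
Qed.

Lemma slice_corr0_gt0 : 0 < slice_corr 0 0.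
Proof. exact: (corr0_gt0 b0 hmu). Qed.

Lemma kap0_gt0 : 0 < kap 0.
Proof.
apply: lt_le_trans slice_corr0_gt0 _.
by have := @sum_slice_corr_le 0 [:: 0] isT; rewrite big_seq1.
Qed.

Lemma slice_cov0_ge M : #|` cubeM M|%:R * slice_corr 0 0 <= slice_cov M 0.
Proof.
have := @slice_cov_ge M 0 0 [fset 0]%fset.
rewrite addn0 big_seq_fset1; apply; apply/fsubsetP => y; rewrite in_fset1 => /eqP ->.
by rewrite mem_cube; apply/forallP => i; rewrite mxE normr0.
Qed.

Lemma slice_cov0_gt0 M : 0 < slice_cov M 0.
Proof.
apply: lt_le_trans (slice_cov0_ge M); rewrite mulr_gt0 ?card_cubeR_gt0 //.
exact: slice_corr0_gt0.
Qed.

Lemma slice_cov_ratio_cvg t : slice_cov M t / slice_cov M 0 @[M --> \oo] --> kap t / kap 0.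
Proof.
have k0 : kap 0 != 0 by rewrite gt_eqF // kap0_gt0.
have H := seqM (@slice_cov_cvg t) (seqV k0 (@slice_cov_cvg 0)).
have E1 M : slice_cov M t / #|` cubeM M|%:R * (slice_cov M 0 / #|` cubeM M|%:R)^-1
   = slice_cov M t / slice_cov M 0.
  have := card_cubeR_gt0 M; have := slice_cov0_gt0 M.
  move: (slice_cov M 0) (slice_cov M t) (#|` cubeM M|%:R) => a b c a0 c0.
  by field; rewrite !gt_eqF.
rewrite (funext E1) in H; exact: H.
Qed.

Definition scale M : R := (Num.sqrt (slice_cov M 0))^-1.

Lemma scale_gt0 M : 0 < scale M.
Proof. by rewrite invr_gt0 sqrtr_gt0 slice_cov0_gt0. Qed.

Lemma scale_sqr M : scale M ^+ 2 = (slice_cov M 0)^-1.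
Proof. by rewrite exprVn sqr_sqrtr // ltW // slice_cov0_gt0. Qed.

Lemma scale_card M : scale M ^+ 2 * #|` cubeM M|%:R <= (slice_corr 0 0)^-1.
Proof.
rewrite scale_sqr mulrC ler_pdivrMr ?slice_cov0_gt0 //.
by rewrite mulrC ler_pdivlMr ?slice_corr0_gt0 // slice_cov0_ge.
Qed.

(** The variance of a slice is at least the number of its sites times the variance of one spin, and
    in dimension d - 1 >= 1 the cube has more than M sites. *)
Lemma scale_cvg0 : (2 <= d)%N -> scale M @[M --> \oo] --> (0 : R).
Proof.
move=> d2; apply/cvgrPdist_le => e e0.
pose q := (e ^+ 2)^-1 / slice_corr 0 0.
have q0 : 0 <= q by rewrite divr_ge0 ?invr_ge0 ?exprn_ge0 ?ltW // slice_corr0_gt0.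
exists (Num.bound q) => // M /= NM.
rewrite sub0r normrN gtr0_norm ?scale_gt0 //.
rewrite -(@ler_pXn2r _ 2) ?nnegrE ?(ltW (scale_gt0 M)) ?(ltW e0) // scale_sqr.
have -> : e ^+ 2 = ((e ^+ 2)^-1)^-1 by rewrite invrK.
rewrite lef_pV2 ?posrE ?slice_cov0_gt0 ?invr_gt0 ?exprn_gt0 //.
apply: le_trans (slice_cov0_ge M); rewrite -ler_pdivrMr ?slice_corr0_gt0 //.
apply: (@le_trans _ _ (M%:R)).
  by apply: ltW; apply: lt_le_trans (archi_boundP q0) _; rewrite ler_nat.
rewrite ler_nat card_cube; case: d d2 => [|[|k]] //= _.
apply: (@leq_trans (M.*2.+1 ^ 1)); first by rewrite expn1; lia.
exact: leq_pexp2l.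
Qed.

Section normalised_slices.
Variables (n : nat) (k : 'I_n -> int) (theta : 'I_n -> R).
Hypotheses (injk : injective k) (d2 : (2 <= d)%N).

Definition slice_field M : config d -> R := fun z =>
  scale M * \sum_(i < n) theta i * \sum_(y <- cubeM M) (sg (z (pt (k i) y)) - E (sgx (pt (k i) y))).

Let sites M : seq (site d) := [seq pt (k i) y | i <- enum 'I_n, y <- enum_fset (cubeM M)].

(** The coefficient sees only the time of the site; injectivity of [k] leaves at most one
    summand. *)
Let coef M (x : site d) : R := scale M * \sum_(i | k i == x.1) theta i.

Let coefE M i y : coef M (pt (k i) y) = scale M * theta i.
Proof. by rewrite /coef (big_pred1 i) // => j; rewrite /= (inj_eq injk). Qed.

Let sum_sites M (g : site d -> R) :
  \sum_(x <- sites M) g x = \sum_(i < n) \sum_(y <- cubeM M) g (pt (k i) y).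
Proof. by rewrite big_allpairs_dep /= big_enum. Qed.

Let lin_sites M z : lin mu (coef M) (sites M) z = slice_field M z.
Proof.
rewrite /lin sum_sites /slice_field mulr_sumr; apply: eq_bigr => i _.
rewrite mulrA mulr_sumr; apply: eq_bigr => y _; by rewrite coefE.
Qed.

Let Var_sites M : Var mu (coef M) (sites M)
  = \sum_(i < n) \sum_(j < n) theta i * theta j * (slice_cov M (k j - k i) / slice_cov M 0).
Proof.
rewrite /Var (Cov_lin b0 h0 hmu) sum_sites; apply: eq_bigr => i _.
have -> : \sum_(y <- cubeM M) \sum_(y0 <- sites M)
    coef M (pt (k i) y) * coef M y0 * corr (y0 - pt (k i) y)
  = \sum_(y <- cubeM M) \sum_(j < n) \sum_(y' <- cubeM M)
      (theta i * theta j / slice_cov M 0) * slice_corr (k j - k i) (y' - y).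
  apply: eq_bigr => y _; rewrite sum_sites; apply: eq_bigr => j _; apply: eq_bigr => y' _.
  rewrite !coefE -scale_sqr; congr (_ * _); ring.
rewrite exchange_big /=; apply: eq_bigr => j _.
under eq_bigr do rewrite -mulr_sumr.
by rewrite -mulr_sumr -/(slice_cov M (k j - k i)); ring.
Qed.

Let uniq_sites M : uniq (sites M).
Proof.
apply: allpairs_uniq; rewrite ?enum_uniq ?fset_uniq //.
by move=> [i y] [j y'] _ _ [] /injk -> ->.
Qed.

Let size_sites M : (size (sites M))%:R = n%:R * #|` cubeM M|%:R :> R.
Proof. by rewrite size_allpairs size_enum_ord natrM. Qed.

Let Theta := \sum_(i < n) `|theta i|.

Let Theta0 : 0 <= Theta. Proof. exact: sumr_ge0. Qed.

Let coef_le M x : `|coef M x| <= scale M * Theta.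
Proof.
rewrite normrM gtr0_norm ?scale_gt0 // ler_pM2l ?scale_gt0 //.
apply: le_trans (ler_norm_sum _ _ _) _; rewrite /Theta [leRHS](bigID (fun i => k i == x.1)) /=.
by rewrite lerDl sumr_ge0.
Qed.

Let sum_coef_le M (s : seq (site d)) : \sum_(x <- s) `|coef M x| <= scale M * Theta * (size s)%:R.
Proof.
rewrite -sum1_size natr_sum mulr_sumr; apply: ler_sum => x _; rewrite mulr1; exact: coef_le.
Qed.

(** The mesh [l] depends on [e] alone. The correlations across cells are then small uniformly in M,
    and the widths of the cells vanish with [scale M]. *)
Lemma slice_field_bound (e : R) : 0 < e -> \forall M \near \oo,
  `|E (fun z => cos (slice_field M z)) - expR (- (Var mu (coef M) (sites M) / 2))| <= e /\
  `|E (fun z => sin (slice_field M z))| <= e.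
Proof.
move=> e0; set C0 := slice_corr 0 0; have C00 : 0 < C0 := slice_corr0_gt0.
(* Makes the contribution across cells at most e / 2, as [scale M] squared times the size of the
   cube is at most 1 / C0; the added 1 keeps the divisor positive. *)
pose e' := e / 2 / (3 * Theta ^+ 2 * n%:R / C0 + 1).
have den0 : 0 < 3 * Theta ^+ 2 * n%:R / C0 + 1.
  by rewrite ltr_wpDl // !mulr_ge0 ?invr_ge0 ?exprn_ge0 // ltW.
have e'0 : 0 < e' by rewrite !divr_gt0.
have [l [l0 Hl]] := good_cells b0 h0 hmu e'0.
(* A cell has at most n l^(d - 1) sites, so its width is at most [B * scale M]. *)
pose B : R := 2 * Theta * (n * l ^ d.-1)%N%:R.
have B0 : 0 <= B by rewrite !mulr_ge0.
(* Bounds the Taylor term: two factors [scale M] come from the cell width, one from the total width,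
   and two of the three are absorbed by the size of the cube. *)
pose K := 3 * B ^+ 2 * (2 * Theta * n%:R) / C0.
have K0 : 0 <= K by rewrite !mulr_ge0 ?invr_ge0 ?exprn_ge0 // ltW.
have sc := scale_cvg0 d2.
have /cvgrPdist_le /(_ 1 ltr01) n1 := seqZ (c := B) sc.
have e2 : 0 < e / 2 by rewrite divr_gt0.
have /cvgrPdist_le /(_ _ e2) n2 := seqZ (c := K) sc.
near=> M.
have m1 : B * scale M <= 1.
  have : `|B * 0 - B * scale M| <= 1 by near: M.
  by rewrite mulr0 sub0r normrN; apply: le_trans; exact: ler_norm.
have m2 : K * scale M <= e / 2.
  have : `|K * 0 - K * scale M| <= e / 2 by near: M.
  by rewrite mulr0 sub0r normrN; apply: le_trans; exact: ler_norm.
have [j Hj] := Hl _ (uniq_sites M).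
have s0 := scale_gt0 M.
have wk kk : width (coef M) [seq x <- sites M | cell l j x == kk] <= B * scale M.
  rewrite /width /B.
  have sz : (size [seq x <- sites M | cell l j x == kk] <= n * l ^ d.-1)%N.
    have := @size_cell d l j (sites M) [seq k i | i <- enum 'I_n] kk l0 (uniq_sites M).
    rewrite size_map size_enum_ord; apply.
    by move=> x /allpairsP [[i y] [_ _ ->]] /=; apply: map_f; rewrite mem_enum.
  have -> : 2 * Theta * (n * l ^ d.-1)%N%:R * scale M = 2 * (scale M * Theta * (n * l ^ d.-1)%N%:R) by ring.
  rewrite ler_pM2l //; apply: le_trans (sum_coef_le M _) _.
  by apply: ler_wpM2l; [rewrite mulr_ge0 // ltW|rewrite ler_nat].
have [c1 c2] := newman_clt_bound b0 h0 hmu (kappa := cell l j) m1 wk.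
  suff fin : 3 * (B * scale M) ^+ 2 * width (coef M) (sites M) +
     3 * (\sum_(x <- sites M) \sum_(y <- sites M | cell l j y != cell l j x)
       `|coef M x| * `|coef M y| * corr (y - x)) <= e.
    rewrite (funext (fun z => congr1 cos (lin_sites M z))) in c1.
    rewrite (funext (fun z => congr1 sin (lin_sites M z))) in c2.
    by split; [exact: le_trans c1 fin|exact: le_trans c2 fin].
  have scl := scale_card M; rewrite -/C0 in scl.
  have w1 : width (coef M) (sites M) <= 2 * Theta * n%:R * (scale M * #|` cubeM M|%:R).
    rewrite /width; have := sum_coef_le M (sites M); rewrite size_sites; move: (\sum_(x <- _) _) => S HS.
    have -> : 2 * Theta * n%:R * (scale M * #|` cubeM M|%:R)
       = 2 * (scale M * Theta * (n%:R * #|` cubeM M|%:R)) by ring.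
    by rewrite ler_pM2l.
  have o1 : \sum_(x <- sites M) \sum_(y <- sites M | cell l j y != cell l j x)
       `|coef M x| * `|coef M y| * corr (y - x)
     <= Theta ^+ 2 * e' * n%:R * (scale M ^+ 2 * #|` cubeM M|%:R).
    apply: (@le_trans _ _ ((scale M * Theta) ^+ 2 *
       \sum_(x <- sites M) \sum_(y <- sites M | cell l j y != cell l j x) corr (y - x))).
      rewrite mulr_sumr; apply: ler_sum => x _; rewrite mulr_sumr; apply: ler_sum => y _.
      apply: ler_wpM2r; first exact: corr_nonneg.
      by rewrite expr2; apply: ler_pM => //; exact: coef_le.
    apply: le_trans (ler_wpM2l _ Hj) _; first by rewrite exprn_ge0 // mulr_ge0 // ltW.
    by rewrite size_sites le_eqVlt; apply/orP; left; apply/eqP; ring.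
  have p1 : 3 * (B * scale M) ^+ 2 * width (coef M) (sites M) <= e / 2.
    apply: le_trans m2.
    apply: le_trans (ler_wpM2l _ w1) _; first by rewrite mulr_ge0 // exprn_ge0 // mulr_ge0 // ltW.
    have -> : 3 * (B * scale M) ^+ 2 * (2 * Theta * n%:R * (scale M * #|` cubeM M|%:R))
      = (3 * B ^+ 2 * (2 * Theta * n%:R) * scale M) * (scale M ^+ 2 * #|` cubeM M|%:R) by ring.
    have -> : K * scale M = (3 * B ^+ 2 * (2 * Theta * n%:R) * scale M) * C0^-1 by rewrite /K; ring.
    by apply: ler_wpM2l => //; rewrite !mulr_ge0 ?exprn_ge0 // ltW.
  have p2 : 3 * (Theta ^+ 2 * e' * n%:R * (scale M ^+ 2 * #|` cubeM M|%:R)) <= e / 2.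
    apply: (@le_trans _ _ (e' * (3 * Theta ^+ 2 * n%:R / C0 + 1))); last by rewrite /e' divfK // gt_eqF.
    have -> : 3 * (Theta ^+ 2 * e' * n%:R * (scale M ^+ 2 * #|` cubeM M|%:R))
       = e' * (3 * Theta ^+ 2 * n%:R * (scale M ^+ 2 * #|` cubeM M|%:R)) by ring.
    apply: ler_wpM2l; first exact: ltW.
    apply: (@le_trans _ _ (3 * Theta ^+ 2 * n%:R * C0^-1)); last by rewrite lerDl.
    by apply: ler_wpM2l => //; rewrite !mulr_ge0 ?exprn_ge0.
  by move: o1 p1 p2; lra.
Unshelve. all: end_near. Qed.

Definition limit_var : R :=
  \sum_(i < n) \sum_(j < n) theta i * theta j * (kap (k j - k i) / kap 0).

Theorem slice_field_cos_cvg :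
  E (fun z => cos (slice_field M z)) @[M --> \oo] --> expR (- (limit_var / 2)).
Proof.
have vc : Var mu (coef M) (sites M) @[M --> \oo] --> limit_var.
  rewrite (funext Var_sites); apply: seq_sum => i; apply: seq_sum => j.
  by apply: seqZ; exact: slice_cov_ratio_cvg.
have ec : expR (- (Var mu (coef M) (sites M) / 2)) @[M --> \oo] --> expR (- (limit_var / 2)).
  apply: continuous_cvg; first exact: continuous_expR.
  by apply: cvgN; apply: seqM => //; exact: cvg_cst.
have dc : E (fun z => cos (slice_field M z)) - expR (- (Var mu (coef M) (sites M) / 2)) @[M --> \oo] --> (0 : R).
  apply/cvgrPdist_le => e e0; have := slice_field_bound e0.
  by apply: filterS => M [? _]; rewrite sub0r normrN.
have := seqD dc ec; rewrite add0r.
have -> : (fun M => E (fun z => cos (slice_field M z)) - expR (- (Var mu (coef M) (sites M) / 2))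
   + expR (- (Var mu (coef M) (sites M) / 2))) = fun M => E (fun z => cos (slice_field M z)).
  by apply/funext => M; rewrite subrK.
by move=> H; apply: H.
Qed.

Theorem slice_field_sin_cvg : E (fun z => sin (slice_field M z)) @[M --> \oo] --> (0 : R).
Proof.
apply/cvgrPdist_le => e e0; have := slice_field_bound e0.
by apply: filterS => M [_ ?]; rewrite sub0r normrN.
Qed.

End normalised_slices.
End slice_covariances.

(** * Characteristic functions of random vectors *)

Section bernstein_weights.
Context {R : realType}.
Implicit Types (p : R) (N j : nat).

(* The binomial weight C(N, j) p^j (1 - p)^(N - j). *)
Fixpoint bw N p j : R :=
  if N is N'.+1 then p * (if j is j'.+1 then bw N' p j' else 0) + (1 - p) * bw N' p j
  else (j == 0%N)%:R.

Lemma bw_ge0 N p j : 0 <= p <= 1 -> 0 <= bw N p j.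
Proof.
move=> /andP [p0 p1]; elim: N j => [|N IH] j /=; first by case: (j == 0%N).
by apply: addr_ge0; apply: mulr_ge0; rewrite ?subr_ge0 //; case: j.
Qed.

Lemma bw_out N p j : (N < j)%N -> bw N p j = 0.
Proof.
elim: N j => [|N IH] [|j] //= Nj.
by rewrite !IH ?mulr0 ?addr0 // ltnW.
Qed.

Lemma bw_sumS N p (phi : nat -> R) :
  \sum_(0 <= j < N.+2) bw N.+1 p j * phi j =
  p * (\sum_(0 <= j < N.+1) bw N p j * phi j.+1) + (1 - p) * (\sum_(0 <= j < N.+1) bw N p j * phi j).
Proof.
have E1 j : bw N.+1 p j * phi j = p * ((if j is j'.+1 then bw N p j' else 0) * phi j)
    + (1 - p) * (bw N p j * phi j) by rewrite /= mulrDl !mulrA.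
under eq_bigr do rewrite E1.
rewrite big_split /= -!mulr_sumr; congr (_ * _ + _ * _).
  by rewrite [LHS]big_nat_recl // mul0r add0r.
by rewrite [LHS]big_nat_recr //= bw_out // mul0r addr0.
Qed.

(** Quadratic polynomials in j are stable under the shift of the recursion, so a single induction
    with free coefficients gives mass, mean and second moment. *)
Lemma bw_moment N p (a b c : R) :
  \sum_(0 <= j < N.+1) bw N p j * (a * j%:R ^+ 2 + b * j%:R + c)
  = a * (N%:R * p * (1 - p) + N%:R ^+ 2 * p ^+ 2) + b * (N%:R * p) + c.
Proof.
elim: N a b c => [|N IH] a b c; first by rewrite big_nat1 /=; ring.
rewrite bw_sumS IH.
have E1 j : bw N p j * (a * j.+1%:R ^+ 2 + b * j.+1%:R + c)
   = bw N p j * (a * j%:R ^+ 2 + (2 * a + b) * j%:R + (a + b + c)) by rewrite -natr1; ring.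
under eq_bigr do rewrite E1.
by rewrite IH -natr1; ring.
Qed.

Lemma bw_sum1 N p : \sum_(0 <= j < N.+1) bw N p j = 1.
Proof.
have := bw_moment N p 0 0 1; rewrite !mul0r !add0r => <-.
by apply: eq_bigr => j _; rewrite !mul0r !add0r mulr1.
Qed.

Lemma bw_variance N p : (0 < N)%N -> 0 <= p <= 1 ->
  \sum_(0 <= j < N.+1) bw N p j * (p - j%:R / N%:R) ^+ 2 <= N%:R^-1.
Proof.
move=> N0 /andP [p0 p1]; have NR : 0 < N%:R :> R by rewrite ltr0n.
have E1 j : bw N p j * (p - j%:R / N%:R) ^+ 2
   = bw N p j * (N%:R^-1 ^+ 2 * j%:R ^+ 2 + (- (2 * p / N%:R)) * j%:R + p ^+ 2) by ring.
under eq_bigr do rewrite E1.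
rewrite bw_moment.
have -> : N%:R^-1 ^+ 2 * (N%:R * p * (1 - p) + N%:R ^+ 2 * p ^+ 2) + - (2 * p / N%:R) * (N%:R * p) + p ^+ 2
  = (p * (1 - p)) * N%:R^-1 by field; rewrite gt_eqF.
by rewrite ler_piMl ?invr_ge0 //; nra.
Qed.

Definition bern {n} N (w : 'I_n -> R) (g : {ffun 'I_n -> 'I_N.+1}) : R :=
  \prod_i bw N (w i) (g i).

Lemma bern_ge0 n N (w : 'I_n -> R) (g : {ffun 'I_n -> 'I_N.+1}) : (forall i, 0 <= w i <= 1) -> 0 <= bern w g.
Proof. by move=> w01; apply: prodr_ge0 => i _; exact: bw_ge0. Qed.

Lemma bern_sum1 n N (w : 'I_n -> R) : \sum_(g : {ffun 'I_n -> 'I_N.+1}) bern w g = 1.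
Proof.
rewrite /bern -(bigA_distr_bigA (fun i (j : 'I_N.+1) => bw N (w i) j)) big1 // => i _.
by rewrite -[RHS](bw_sum1 N (w i)) big_mkord.
Qed.

Lemma bern_variance n N (w : 'I_n -> R) i : (0 < N)%N -> (forall i, 0 <= w i <= 1) ->
  \sum_(g : {ffun 'I_n -> 'I_N.+1}) bern w g * (w i - (g i)%:R / N%:R) ^+ 2 <= N%:R^-1.
Proof.
move=> N0 w01; pose F i' (j : 'I_N.+1) := bw N (w i') j *
   (if i' == i then (w i - j%:R / N%:R) ^+ 2 else 1).
have -> : \sum_(g : {ffun 'I_n -> 'I_N.+1}) bern w g * (w i - (g i)%:R / N%:R) ^+ 2
   = \sum_(g : {ffun 'I_n -> 'I_N.+1}) \prod_i' F i' (g i').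
  apply: eq_bigr => g _; rewrite /F big_split /=; congr (_ * _).
  rewrite (bigD1 i) //= eqxx -[LHS]mulr1; congr (_ * _); rewrite big1 // => i' ni.
  by rewrite (negbTE ni).
rewrite -(bigA_distr_bigA F) (bigD1 i) //= [X in _ * X <= _]big1 ?mulr1; last first.
  move=> i' /negbTE ni; rewrite -[RHS](bw_sum1 N (w i')) big_mkord.
  by apply: eq_bigr => j _; rewrite /F ni mulr1.
rewrite /F eqxx; have := bw_variance N0 (w01 i); by rewrite big_mkord.
Qed.

End bernstein_weights.

(** * Trigonometric approximation on cubes *)

Section trigonometric_sums.
Context {R : realType} {n : nat}.
Implicit Types (theta x : 'rV[R]_n) (H : 'rV[R]_n -> R).

Definition dot theta x : R := \sum_i theta 0 i * x 0 i.

(** The phase includes the sines, and the product-to-sum formula makes these functions an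
    algebra. *)
Definition trig H := exists l : seq (R * ('rV[R]_n * R)),
  forall x, H x = \sum_(p <- l) p.1 * cos (dot p.2.1 x + p.2.2).

Lemma dotD theta theta' x : dot (theta + theta') x = dot theta x + dot theta' x.
Proof. by rewrite /dot -big_split; apply: eq_bigr => i _; rewrite mxE mulrDl. Qed.

Lemma dotN theta x : dot (- theta) x = - dot theta x.
Proof. by rewrite /dot -sumrN; apply: eq_bigr => i _; rewrite mxE mulNr. Qed.

Lemma dot0 x : dot 0 x = 0.
Proof. by rewrite /dot big1 // => i _; rewrite mxE mul0r. Qed.

Lemma trig_cst (c : R) : trig (fun=> c).
Proof. by exists [:: (c, (0, 0))] => x; rewrite big_seq1 /= dot0 addr0 cos0 mulr1. Qed.

Lemma trigD H H' : trig H -> trig H' -> trig (fun x => H x + H' x).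
Proof. by move=> [l Hl] [l' Hl']; exists (l ++ l') => x; rewrite big_cat /= Hl Hl'. Qed.

Lemma trig_cosM (c : R) theta (phi : R) H : trig H ->
  trig (fun x => c * cos (dot theta x + phi) * H x).
Proof.
move=> [l Hl]; exists (flatten [seq [:: (c * p.1 / 2, (theta + p.2.1, phi + p.2.2));
   (c * p.1 / 2, (theta - p.2.1, phi - p.2.2))] | p <- l]) => x.
rewrite Hl big_flatten big_map mulr_sumr; apply: eq_bigr => p _.
rewrite big_cons big_seq1 /= !dotD dotN.
have -> : dot theta x + dot p.2.1 x + (phi + p.2.2) = (dot theta x + phi) + (dot p.2.1 x + p.2.2) by ring.
have -> : dot theta x - dot p.2.1 x + (phi - p.2.2) = (dot theta x + phi) - (dot p.2.1 x + p.2.2) by ring.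
by move: (dot theta x + phi) (dot p.2.1 x + p.2.2) => A A'; rewrite cosB cosD; field.
Qed.

Lemma trigM H H' : trig H -> trig H' -> trig (fun x => H x * H' x).
Proof.
move=> [l Hl] tH'; elim: l H Hl => [|p l IH] H Hl.
  have -> : (fun x => H x * H' x) = fun=> 0 by apply/funext => x; rewrite Hl big_nil mul0r.
  exact: trig_cst.
have -> : (fun x => H x * H' x) = fun x => p.1 * cos (dot p.2.1 x + p.2.2) * H' x
    + (\sum_(p <- l) p.1 * cos (dot p.2.1 x + p.2.2)) * H' x.
  by apply/funext => x; rewrite Hl big_cons mulrDl.
by apply: trigD; [exact: trig_cosM|exact: IH].
Qed.

Lemma trig_prod (I : Type) (r : seq I) (H : I -> 'rV[R]_n -> R) : (forall i, trig (H i)) ->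
  trig (fun x => \prod_(i <- r) H i x).
Proof.
move=> tH; elim: r => [|i r IH].
  by under eq_fun do rewrite big_nil; exact: trig_cst.
by under eq_fun do rewrite big_cons; exact: trigM.
Qed.

Lemma trig_sum (I : Type) (r : seq I) (H : I -> 'rV[R]_n -> R) : (forall i, trig (H i)) ->
  trig (fun x => \sum_(i <- r) H i x).
Proof.
move=> tH; elim: r => [|i r IH].
  by under eq_fun do rewrite big_nil; exact: trig_cst.
by under eq_fun do rewrite big_cons; exact: trigD.
Qed.

Lemma trig_sin (c : R) i : trig (fun x => sin (c * x 0 i)).
Proof.
exists [:: (1, (c *: delta_mx 0 i, - (pi / 2)))] => x.
rewrite big_seq1 mul1r -cosBpihalf; congr (cos (_ - _)).
rewrite /dot (bigD1 i) //= !mxE !eqxx mulr1 big1 ?addr0 // => j ji.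
by rewrite !mxE (negbTE ji) andbF mulr0 mul0r.
Qed.

Lemma trig_bw N j H : trig H -> trig (fun x => bw N (H x) j).
Proof.
move=> tH; elim: N j => [|N IH] j /=; first exact: trig_cst.
apply: trigD; apply: trigM => //.
  by case: j => [|j] //; exact: trig_cst.
apply: trigD; first exact: trig_cst.
by have := trigM (trig_cst (-1)) tH; under eq_fun do rewrite mulN1r.
Qed.

End trigonometric_sums.

Section trigonometric_approximation.
Context {R : realType} {n : nat}.
Implicit Types (x t : 'rV[R]_n) (f : 'rV[R]_n -> R).

(** Uniform over the cube by compactness. Near a point x0, either t is close to x0 too and
    continuity applies, or some coordinate of x - t is at least r / 2 and the quadratic term exceeds
    2 B. *)
Lemma quadratic_modulus f (B K e : R) : continuous f -> (forall x, `|f x| <= B) -> 0 < e ->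
  exists C : R, 0 <= C /\ forall x t, (forall i, `|x 0 i| <= K) -> (forall i, `|t 0 i| <= K) ->
    `|f x - f t| <= e + C * \sum_i (x 0 i - t 0 i) ^+ 2.
Proof.
move=> cf fB e0; pose A := [set x : 'rV[R]_n | forall i, `[- K, K]%classic (x ord0 i)].
have cA : compact A.
  by apply: (@rV_compact _ n (fun=> `[- K, K]%classic)) => i; exact: segment_compact.
have B0 : 0 <= B by exact: le_trans (normr_ge0 _) (fB 0).
have := (compact_near_coveringP A).1 cA nat \oo
  (fun m x => forall t, A t -> `|f x - f t| <= e + m%:R * \sum_i (x 0 i - t 0 i) ^+ 2).
move=> /(_ _ _) [].
  move=> x0 _; have e2 : 0 < e / 2 by rewrite divr_gt0.
  have /cvgrPdist_le /(_ _ e2) /nbhs_ballP [r /= r0 Hr] := cf x0.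
  have r2 : 0 < (r : R) / 2 by exact: divr_gt0.
  pose q : R := 2 * B / (r / 2) ^+ 2.
  have q0 : 0 <= q by apply: divr_ge0; [exact: mulr_ge0|apply/exprn_ge0/ltW].
  exists (ball x0 (r / 2), [set m | (Num.bound q <= m)%N]).
    by split; [apply: nbhsx_ballx; rewrite divr_gt0|exists (Num.bound q)].
  move=> [x m] [/= bx mq] t _.
  have S0 : 0 <= \sum_i (x 0 i - t 0 i) ^+ 2 by apply: sumr_ge0 => i _; exact: sqr_ge0.
  have fx := Hr x (le_ball _ bx); have {}fx : `|f x0 - f x| <= e / 2.
    by apply: fx; rewrite ler_pdivrMr // ler_pMr // ler1n.
  have [bt|nbt] := pselect (ball x0 r t).
    have ft := Hr t bt; apply: (@le_trans _ _ e); last by rewrite lerDl mulr_ge0.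
    have -> : f x - f t = (f x0 - f t) - (f x0 - f x) by ring.
    by apply: le_trans (ler_normB _ _) _; move: ft => /=; lra.
  have [i Hi] : exists i, r / 2 <= `|x 0 i - t 0 i|.
    apply: contrapT => /forallNP H; apply: nbt; split => // j i; rewrite (ord1 j).
    have := bx.2 0 i; rewrite /ball /= => b1; have := H i => /negP; rewrite -ltNge => b2.
    have -> : x0 0 i - t 0 i = (x0 0 i - x 0 i) + (x 0 i - t 0 i) by ring.
    by apply: le_lt_trans (ler_normD _ _) _; lra.
  have Si : (r / 2) ^+ 2 <= \sum_i (x 0 i - t 0 i) ^+ 2.
    rewrite (bigD1 i) //= -[leLHS]addr0; apply: lerD.
      by rewrite -[leRHS]real_normK ?num_real // lerXn2r ?nnegrE ?divr_ge0 // ltW.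
    by apply: sumr_ge0 => j _; exact: sqr_ge0.
  apply: (@le_trans _ _ (2 * B)).
    by apply: le_trans (ler_normB _ _) _; have := fB x; have := fB t; lra.
  apply: (@le_trans _ _ (m%:R * (r / 2) ^+ 2)).
    rewrite -ler_pdivrMr ?exprn_gt0 ?divr_gt0 // -/q.
    by apply: ltW; apply: lt_le_trans (archi_boundP q0) _; rewrite ler_nat.
  by apply: le_trans (ler_wpM2l (ler0n _ m) Si) _; rewrite lerDr ltW.
move=> m0 _ /(_ m0 (leqnn _)) H; exists m0%:R; split => // x t xK tK.
by apply: H => i; rewrite /= in_itv /= -ler_norml.
Qed.

(** The derivative of the sine on [-1, 1] is at least cos 1. *)
Lemma sin_expands (u v : R) : -1 <= u <= 1 -> -1 <= v <= 1 ->
  cos 1 * `|u - v| <= `|sin u - sin v|.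
Proof.
wlog uv : u v / v <= u => [H u1 v1|u1 v1].
  by have [/H|/ltW/H] := leP v u; [exact|rewrite distrC (distrC (sin u)); apply].
have [c /andP [c1 c2] ->] := @MVT_everywhere R sin cos v u (fun z => is_derive_sin z) uv.
rewrite normrM; apply: ler_wpM2r => //; apply: le_trans (ler_norm _).
rewrite -(cos_norm c); have c1' : `|c| <= 1.
  by rewrite ler_norml; move: u1 v1 => /andP [? ?] /andP [? ?]; apply/andP; split; lra.
have p2 : 2 <= pi :> R := pi_ge2 R.
rewrite leNgt ltr_cos ?in_itv /= ?normr_ge0 ?ler01 /= -?leNgt //; lra.
Qed.

Lemma cos1_pos : 0 < cos (1 : R).
Proof. exact: cos1_gt0. Qed.

(** A grid value q may fall outside the range of the sine over [-1, 1]. Clamping it to that range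
    brings it no farther from any point of the range. *)
Lemma clamped_node (q : R) : exists u : R, -1 <= u <= 1 /\
  forall s, -1 <= s <= 1 -> `|sin u - sin s| <= `|q - sin s|.
Proof.
have sN : sin (-1) <= sin (1 : R).
  have s1 : 0 < sin (1 : R) by apply: sin2_gt0; rewrite ltr01 ltr1n.
  by rewrite sinN; lra.
pose q' := Num.max (sin (-1)) (Num.min q (sin 1)).
have q1 : sin (-1) <= q' by rewrite le_max lexx.
have q2 : q' <= sin 1 by rewrite ge_max sN ge_min lexx orbT.
have [u u1 su] : exists2 u, u \in `[-1, 1] & sin u = q' :> R.
  apply: IVT; [lra|by apply: continuous_subspaceT => z; exact: continuous_sin|].
  by rewrite (min_idPl sN) (max_idPr sN) q1.
move: u1; rewrite in_itv /= => u1; exists u; split => // s s1.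
have mono (a b : R) : -1 <= a -> b <= 1 -> a <= b -> sin a <= sin b.
  move=> a1 b1 ab; have p1 := @pihalf_ge1 R.
  by rewrite leNgt ltr_sin ?in_itv /= -?leNgt //; apply/andP; split; lra.
move: s1 => /andP [s1 s2]; have m1 := mono _ _ (lexx _) s2 s1; have m2 := mono _ _ s1 (lexx _) s2.
rewrite su; have [ql|qg] := leP q (sin (-1)).
  have -> : q' = sin (-1) by rewrite /q'; apply/max_idPl; rewrite ge_min ql.
  by rewrite !ler0_norm; lra.
have [qg'|ql'] := leP (sin 1) q.
  have -> : q' = sin 1 by rewrite /q' (min_idPr qg'); apply/max_idPr.
  by rewrite !ger0_norm; lra.
by have -> : q' = q by rewrite /q' (min_idPl (ltW ql')); apply/max_idPr/ltW.
Qed.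

(* Bernstein polynomials in the variables (1 + sin (x_i / K)) / 2 are
   trigonometric sums, so they approximate f by the law of large numbers. *)
Theorem trig_approx f (B K e : R) : continuous f -> (forall x, `|f x| <= B) -> 0 < K -> 0 < e ->
  exists T, [/\ trig T, forall x, `|T x| <= B &
    forall x, (forall i, `|x 0 i| <= K) -> `|f x - T x| <= e].
Proof.
move=> cf fB K0 e0; have e2 : 0 < e / 2 by rewrite divr_gt0.
have [C [C0 HC]] := quadratic_modulus K cf fB e2.
have c1 := cos1_pos.
(* The factor K 2 / cos 1 converts a deviation of j / N from [w] into one of the node from x. With n
   coordinates of variance at most 1 / N, the quadratic term is at most D / N. *)
pose D := C * ((K * 2 / cos 1) ^+ 2 * n%:R).
have Q0 : 0 <= (K * 2 / cos 1) ^+ 2 by exact: sqr_ge0.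
have D0 : 0 <= D by apply: mulr_ge0 => //; exact: mulr_ge0.
pose N := (Num.bound (D / (e / 2))).+1.
have ND : D / N%:R <= e / 2.
  rewrite ler_pdivrMr ?ltr0n // mulrC -ler_pdivrMr // ltW //.
  apply: lt_le_trans (archi_boundP _) _; first by rewrite divr_ge0 // ltW.
  by rewrite ler_nat leqnSn.
have /choice [u Hu] : forall j : 'I_N.+1, exists u : R, -1 <= u <= 1 /\
  forall s, -1 <= s <= 1 -> `|sin u - sin s| <= `|(2 * j%:R / N%:R - 1) - sin s|.
  by move=> j; exact: clamped_node.
pose w x i := (1 + sin (K^-1 * x 0 i)) / 2.
have w01 x i : 0 <= w x i <= 1.
  by rewrite /w; have := sin_geN1 (K^-1 * x 0 i); have := sin_le1 (K^-1 * x 0 i); lra.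
pose node (g : {ffun 'I_n -> 'I_N.+1}) : 'rV[R]_n := \row_i (K * u (g i)).
exists (fun x => \sum_(g : {ffun 'I_n -> 'I_N.+1}) f (node g) * bern (w x) g); split.
- apply: trig_sum => g; apply: trigM; first exact: trig_cst.
  apply: trig_prod => i; apply: trig_bw; apply: trigM; last exact: trig_cst.
  by apply: trigD; [exact: trig_cst|exact: trig_sin].
- move=> x; apply: le_trans (ler_norm_sum _ _ _) _.
  rewrite -[leRHS]mulr1 -(bern_sum1 N (w x)) mulr_sumr; apply: ler_sum => g _.
  by rewrite normrM (ger0_norm (bern_ge0 g (w01 x))) ler_wpM2r // bern_ge0.
move=> x xK.
have -> : f x - \sum_(g : {ffun 'I_n -> 'I_N.+1}) f (node g) * bern (w x) g
   = \sum_(g : {ffun 'I_n -> 'I_N.+1}) bern (w x) g * (f x - f (node g)).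
  rewrite -[X in X - _]mulr1 -(bern_sum1 N (w x)) mulr_sumr -sumrB.
  by apply: eq_bigr => g _; rewrite mulrBr mulrC [f _ * _]mulrC.
apply: le_trans (ler_norm_sum _ _ _) _.
apply: (@le_trans _ _ (\sum_(g : {ffun 'I_n -> 'I_N.+1}) (bern (w x) g * (e / 2) +
   \sum_i C * (K * 2 / cos 1) ^+ 2 * (bern (w x) g * (w x i - (g i)%:R / N%:R) ^+ 2)))).
  apply: ler_sum => g _; have b0 := bern_ge0 g (w01 x).
  rewrite normrM (ger0_norm b0).
  have -> : bern (w x) g * (e / 2) + \sum_i C * (K * 2 / cos 1) ^+ 2 *
      (bern (w x) g * (w x i - (g i)%:R / N%:R) ^+ 2)
    = bern (w x) g * (e / 2 + C * \sum_i ((K * 2 / cos 1) ^+ 2 * (w x i - (g i)%:R / N%:R) ^+ 2)).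
    rewrite [RHS]mulrDr; congr (_ + _); rewrite !mulr_sumr; apply: eq_bigr => i _; ring.
  apply: ler_wpM2l => //.
  have nK i : `|node g 0 i| <= K.
    rewrite mxE normrM gtr0_norm // ler_piMr ?(ltW K0) //.
    by have [] := Hu (g i); rewrite -ler_norml.
  apply: le_trans (HC x (node g) xK nK) _; rewrite lerD2l; apply: ler_wpM2l => //.
  apply: ler_sum => i _; rewrite mxE.
  have xi1 : -1 <= K^-1 * x 0 i <= 1.
    by rewrite -ler_norml normrM gtr0_norm ?invr_gt0 // mulrC ler_pdivrMr // mul1r.
  have [ui Hui] := Hu (g i).
  have h1 := sin_expands ui xi1; have h2 := Hui _ xi1.
  rewrite -[leLHS]real_normK ?num_real // -exprMn -[leRHS]real_normK ?num_real //.
  rewrite lerXn2r ?nnegrE //.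
  have -> : x 0 i - K * u (g i) = - K * (u (g i) - K^-1 * x 0 i).
    by field; rewrite gt_eqF.
  have -> : K * 2 / cos 1 * (w x i - (g i)%:R / N%:R)
    = - (K / cos 1) * ((2 * (g i)%:R / N%:R - 1) - sin (K^-1 * x 0 i)).
    have NR : 0 < N%:R :> R by rewrite ltr0n.
    by rewrite /w; move: (N%:R) NR => m m0; field; rewrite !gt_eqF.
  have -> : `|- K * (u (g i) - K^-1 * x 0 i)| = K * `|u (g i) - K^-1 * x 0 i|.
    by rewrite normrM normrN (gtr0_norm K0).
  set y := 2 * (g i)%:R / N%:R - 1 - _ in h2 *.
  have -> : `|- (K / cos 1) * y| = K * (`|y| / cos 1).
    by rewrite normrM normrN (gtr0_norm (divr_gt0 K0 c1)); ring.
  rewrite ler_pM2l // ler_pdivlMr // mulrC; exact: le_trans h1 h2.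
rewrite big_split /= -mulr_suml bern_sum1 mul1r exchange_big /=.
have : \sum_i \sum_(g : {ffun 'I_n -> 'I_N.+1}) C * (K * 2 / cos 1) ^+ 2 *
      (bern (w x) g * (w x i - (g i)%:R / N%:R) ^+ 2) <= D / N%:R.
  have -> : D / N%:R = \sum_(i < n) C * (K * 2 / cos 1) ^+ 2 * N%:R^-1.
    rewrite big_const card_ord iter_addr_0 -[RHS]mulr_natr /D; ring.
  apply: ler_sum => i _; rewrite -mulr_sumr; apply: ler_wpM2l.
    exact: mulr_ge0.
  exact: bern_variance.
by move: ND; lra.
Qed.

End trigonometric_approximation.

Section random_vectors.
Context {R : realType} {dS} {S : measurableType dS} (P : probability S R) {n : nat}.
Implicit Types (Y : 'I_n -> S -> R) (f : 'rV[R]_n -> R).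

Definition vec Y w : 'rV[R]_n := \row_i Y i w.

Lemma Ex_bounded_cvg (g : nat -> S -> R) (g0 : S -> R) (M : R) :
  (forall m, measurable_fun [set: S] (g m)) -> (forall m x, `|g m x| <= M) ->
  (forall x, g m x @[m --> \oo] --> g0 x) -> Ex P (g m) @[m --> \oo] --> Ex P g0.
Proof.
move=> mg gM gg0.
have mg0 : measurable_fun [set: S] g0 by apply: (measurable_fun_cvg mg) => x _; exact: gg0.
have M0 x : `|g0 x| <= M.
  apply: (seq_le (u := fun m => `|g m x|) (v := fun=> M)); last exact: nearW.
    by apply: cvg_norm; exact: gg0.
  exact: cvg_cst.
have bg m : bm (g m) by split => //; exists M.
have bg0 : bm g0 by split => //; exists M.
have [] := @dominated_convergence _ S R P setT measurableT (fun m x => (g m x)%:E)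
  (fun x => (g0 x)%:E) (fun=> M%:E).
- by move=> m; apply/measurable_EFinP.
- exact/measurable_EFinP.
- by apply: aeW => x _; apply/cvg_EFin; [exact: nearW|exact: gg0].
- exact: (bm_integrable P (bm_cst M)).
- by apply: aeW => x m _; rewrite lee_fin.
move=> _ _ H; apply: fine_cvg.
have e0 : ((Ex P g0)%:E = \int[P]_x (g0 x)%:E)%E.
  by rewrite /Ex /Rintegral fineK //; apply: integrable_fin_num => //; exact: bm_integrable.
by rewrite e0.
Qed.

Lemma measurable_dot (theta : 'rV[R]_n) (phi : R) Y : (forall i, measurable_fun [set: S] (Y i)) ->
  measurable_fun [set: S] (fun w => dot theta (vec Y w) + phi).
Proof.
move=> mY; apply: measurable_funD; last exact: measurable_cst.
apply: measurable_sum => i; apply: measurable_funM; first exact: measurable_cst.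
by under eq_fun do rewrite mxE; exact: mY.
Qed.

Lemma bm_cos_dot (theta : 'rV[R]_n) (phi : R) Y : (forall i, measurable_fun [set: S] (Y i)) ->
  bm (fun w => cos (dot theta (vec Y w) + phi)).
Proof.
move=> mY; apply: (bm_comp (h := cos) (M := 1)); [exact: continuous_cos|exact: cos_max|].
exact: measurable_dot.
Qed.

Lemma bm_trig (T : 'rV[R]_n -> R) Y : trig T -> (forall i, measurable_fun [set: S] (Y i)) ->
  bm (fun w => T (vec Y w)).
Proof.
move=> [l Tl] mY.
have -> : (fun w => T (vec Y w)) = fun w => \sum_(p <- l) p.1 * cos (dot p.2.1 (vec Y w) + p.2.2).
  by apply/funext => w; rewrite Tl.
by apply: bm_sum => p; apply: bmZ; exact: bm_cos_dot.
Qed.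

(** Measurability comes from trigonometric sums that converge pointwise, the cubes and the precision
    improving together, so no sigma-algebra on row vectors is involved. *)
Lemma bm_continuous f (B : R) Y : continuous f -> (forall x, `|f x| <= B) ->
  (forall i, measurable_fun [set: S] (Y i)) -> bm (fun w => f (vec Y w)).
Proof.
move=> cf fB mY; split; last by exists B.
have /choice [T HT] : forall m : nat, exists T, [/\ trig T, forall x, `|T x| <= B &
    forall x : 'rV[R]_n, (forall i, `|x 0 i| <= m.+1%:R) -> `|f x - T x| <= m.+1%:R^-1].
  by move=> m; apply: trig_approx => //; rewrite ?invr_gt0 ltr0n.
apply: (@measurable_fun_cvg _ _ _ _ (fun m w => T m (vec Y w))).
  by move=> m; have [tT _ _] := HT m; have [] := bm_trig tT mY.
move=> w _; apply/cvgrPdist_le => e e0.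
have [m1 _ Hm1] : \forall m \near \oo, (@harmonic R) m <= e.
  have /cvgrPdist_le /(_ _ e0) := @cvg_harmonic R.
  by apply: filterS => m; rewrite sub0r normrN; apply: le_trans; exact: ler_norm.
pose m2 := (\sum_i Num.bound (`|Y i w|))%N.
exists (maxn m1 m2) => // m /=; rewrite geq_max => /andP [mm1 mm2].
have [_ _ /(_ (vec Y w)) H] := HT m.
apply: le_trans (H _) (Hm1 m mm1) => i; rewrite mxE.
apply: ltW; apply: lt_le_trans (archi_boundP (normr_ge0 _)) _; rewrite ler_nat.
apply: leq_trans (leqW mm2); by rewrite /m2 (bigD1 i) //= leq_addr.
Qed.

Definition exceeds (K : R) (Z : S -> R) : set S := [set w | K < `|Z w|].

Lemma measurable_exceeds K (Z : S -> R) : measurable_fun [set: S] Z -> measurable (exceeds K Z).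
Proof.
move=> mZ; have mn : measurable_fun [set: S] (fun w => `|Z w|) by exact: measurableT_comp.
have := mn measurableT `]K, +oo[%classic (measurable_itv _); rewrite setTI.
congr measurable; apply/seteqP; split => w /=; by rewrite /exceeds /= in_itv /= andbT.
Qed.

Lemma single_tight (Z : S -> R) (e : R) : measurable_fun [set: S] Z -> 0 < e ->
  exists K0, forall K, K0 <= K -> Ex P (\1_(exceeds K Z)) <= e.
Proof.
move=> mZ e0.
have : Ex P (\1_(exceeds m%:R Z)) @[m --> \oo] --> Ex P (fun=> 0).
  apply: (Ex_bounded_cvg (M := 1)) => [m|m x|x].
  - exact/measurable_indic/measurable_exceeds.
  - by rewrite indicE; case: (_ \in _); rewrite ?normr1 ?normr0.
  apply/cvgrPdist_le => e' e'0; exists (Num.bound `|Z x|) => // m /= bm.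
  rewrite indicE memNset ?subrr ?normr0 ?ltW // => /= H.
  have := lt_trans H (archi_boundP (normr_ge0 (Z x))); rewrite ltr_nat.
  by rewrite ltnNge bm.
rewrite Ex_cst => /cvgrPdist_le /(_ _ e0) [m _ /(_ m (leqnn _)) Hm].
exists m%:R => K mK; move: Hm; rewrite /= sub0r normrN => /(le_trans (ler_norm _)).
apply: le_trans; apply: le_Ex; try exact/bm_indic/measurable_exceeds.
move=> w; rewrite !indicE; case: (boolP (w \in exceeds K Z)) => [/set_mem H|_].
  by rewrite mem_set //=; exact: le_lt_trans mK H.
by case: (_ \in _); rewrite ?ler01 ?lexx.
Qed.

(** Outside the cube only |f - T| <= 2 B is available, which is why the approximant has to share the
    bound of [f]. *)
Lemma trunc_approx f (T : 'rV[R]_n -> R) (B K e : R) Y : continuous f -> (forall x, `|f x| <= B) ->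
  trig T -> (forall x, `|T x| <= B) -> 0 <= e ->
  (forall x : 'rV[R]_n, (forall i, `|x 0 i| <= K) -> `|f x - T x| <= e) ->
  (forall i, measurable_fun [set: S] (Y i)) ->
  `|Ex P (fun w => f (vec Y w)) - Ex P (fun w => T (vec Y w))|
  <= e + 2 * B * \sum_i Ex P (\1_(exceeds K (Y i))).
Proof.
move=> cf fB tT TB e0 fT mY.
have bf := bm_continuous cf fB mY; have bT := bm_trig tT mY.
have b1 i : bm (\1_(exceeds K (Y i)) : S -> R) by exact/bm_indic/measurable_exceeds.
rewrite -ExB //; apply: le_trans (Ex_norm _ (bmB bf bT)) _.
have -> : e + 2 * B * \sum_i Ex P (\1_(exceeds K (Y i)))
   = Ex P (fun w => e + 2 * B * \sum_i \1_(exceeds K (Y i)) w).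
  rewrite ExD ?Ex_cst ?ExZ ?Ex_sum //; first [exact: bm_sum|exact: bm_cst|idtac].
  by apply: bmZ; exact: bm_sum.
apply: le_Ex; first exact/bm_norm/bmB.
  by apply: bmD; [exact: bm_cst|apply: bmZ; exact: bm_sum].
move=> w; have i0 i : 0 <= \1_(exceeds K (Y i)) w :> R by rewrite indicE; case: (_ \in _).
have B0 : 0 <= B by exact: le_trans (normr_ge0 _) (fB 0).
have [H|] := pselect (forall i, `|vec Y w 0 i| <= K).
  apply: le_trans (fT _ H) _; rewrite lerDl; apply: mulr_ge0; first exact: mulr_ge0.
  exact: sumr_ge0.
move=> /existsNP [i]; rewrite mxE => /negP; rewrite -ltNge => Ki.
apply: (@le_trans _ _ (2 * B)).
  by apply: le_trans (ler_normB _ _) _; have := fB (vec Y w); have := TB (vec Y w); lra.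
rewrite -[leLHS]add0r; apply: lerD => //; rewrite -[leLHS]mulr1; apply: ler_wpM2l.
  exact: mulr_ge0.
rewrite (bigD1 i) //= indicE mem_set // lerDl; exact: sumr_ge0.
Qed.

End random_vectors.

(** * Levy's continuity theorem and uniqueness of laws *)

Section levy.
Context {R : realType} {d1 d2} {S1 : measurableType d1} {S2 : measurableType d2}.
Context (P1 : probability S1 R) (P2 : probability S2 R) {n : nat}.

Definition same_charfun (Y : 'I_n -> S1 -> R) (Z : 'I_n -> S2 -> R) := forall theta,
  Ex P1 (fun w => cos (dot theta (vec Y w))) = Ex P2 (fun w => cos (dot theta (vec Z w))) /\
  Ex P1 (fun w => sin (dot theta (vec Y w))) = Ex P2 (fun w => sin (dot theta (vec Z w))).

Lemma measurable_dot0 dS (S : measurableType dS) (theta : 'rV[R]_n) (Y : 'I_n -> S -> R) :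
  (forall i, measurable_fun [set: S] (Y i)) -> measurable_fun [set: S] (fun w => dot theta (vec Y w)).
Proof. by move=> mY; have := measurable_dot theta 0 mY; under eq_fun do rewrite addr0. Qed.

Lemma Ex_cos_phase dS (S : measurableType dS) (P : probability S R) (theta : 'rV[R]_n) phi
    (Y : 'I_n -> S -> R) : (forall i, measurable_fun [set: S] (Y i)) ->
  Ex P (fun w => cos (dot theta (vec Y w) + phi)) =
  cos phi * Ex P (fun w => cos (dot theta (vec Y w))) - sin phi * Ex P (fun w => sin (dot theta (vec Y w))).
Proof.
move=> mY; have md := measurable_dot0 theta mY.
have bc : bm (fun w => cos (dot theta (vec Y w))).
  by apply: (bm_comp (h := cos) (M := 1)) md; [exact: continuous_cos|exact: cos_max].
have bs : bm (fun w => sin (dot theta (vec Y w))).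
  by apply: (bm_comp (h := sin) (M := 1)) md; [exact: continuous_sin|exact: sin_max].
rewrite -!ExZ // -ExB; [|exact: bmZ..].
by congr Ex; apply/funext => w; rewrite cosD mulrC [X in _ - X]mulrC.
Qed.

Theorem levy_continuity (Y : nat -> 'I_n -> S1 -> R) (Z : 'I_n -> S2 -> R) :
  (forall m i, measurable_fun [set: S1] (Y m i)) -> (forall i, measurable_fun [set: S2] (Z i)) ->
  (forall e : R, 0 < e -> exists K0, forall K, K0 <= K -> forall m i,
     Ex P1 (\1_(exceeds K (Y m i))) <= e) ->
  (forall theta, Ex P1 (fun w => cos (dot theta (vec (Y m) w))) @[m --> \oo]
     --> Ex P2 (fun w => cos (dot theta (vec Z w)))) ->
  (forall theta, Ex P1 (fun w => sin (dot theta (vec (Y m) w))) @[m --> \oo]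
     --> Ex P2 (fun w => sin (dot theta (vec Z w)))) ->
  forall (f : 'rV[R]_n -> R) (B : R), continuous f -> (forall x, `|f x| <= B) ->
    Ex P1 (fun w => f (vec (Y m) w)) @[m --> \oo] --> Ex P2 (fun w => f (vec Z w)).
Proof.
move=> mY mZ tY cc cs f B cf fB; apply/cvgrPdist_le => e e0.
have B0 : 0 <= B by exact: le_trans (normr_ge0 _) (fB 0).
have D0 : 0 < 2 * B * n%:R + 1 by rewrite ltr_wpDl // !mulr_ge0.
(* Makes n tail probabilities, each weighted by 2 B, cost at most e / 8. *)
pose e1 := e / 8 / (2 * B * n%:R + 1).
have e10 : 0 < e1 by rewrite !divr_gt0.
have [KY HY] := tY e1 e10.
have /choice [KZ HZ] : forall i, exists K0, forall K, K0 <= K -> Ex P2 (\1_(exceeds K (Z i))) <= e1.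
  by move=> i; exact: single_tight.
pose K := 1 + `|KY| + \sum_i `|KZ i|.
have S0 : 0 <= \sum_i `|KZ i| by exact: sumr_ge0.
have K0 : 0 < K by rewrite /K; have := normr_ge0 KY; lra.
have KYK : KY <= K by rewrite /K; have := ler_norm KY; lra.
have KZK i : KZ i <= K.
  have : KZ i <= \sum_i `|KZ i|.
    by apply: le_trans (ler_norm _) _; rewrite (bigD1 i) //= lerDl sumr_ge0.
  by rewrite /K; have := normr_ge0 KY; lra.
have e8 : 0 < e / 8 by rewrite divr_gt0.
have [T [tT TB fT]] := trig_approx cf fB K0 e8.
have small (s : 'I_n -> R) : (forall i, s i <= e1) -> 2 * B * \sum_i s i <= e / 8.
  move=> s1; apply: (@le_trans _ _ (2 * B * (n%:R * e1))).
    apply: ler_wpM2l; first exact: mulr_ge0.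
    have -> : n%:R * e1 = \sum_(i < n) e1 by rewrite big_const card_ord iter_addr_0 mulr_natl.
    exact: ler_sum.
  have -> : 2 * B * (n%:R * e1) = e1 * (2 * B * n%:R + 1) - e1 by ring.
  by rewrite {1}/e1 divfK ?gt_eqF //; lra.
have aY m : `|Ex P1 (fun w => f (vec (Y m) w)) - Ex P1 (fun w => T (vec (Y m) w))| <= e / 4.
  apply: le_trans (trunc_approx P1 cf fB tT TB (ltW e8) fT (mY m)) _.
  by have := small _ (HY K KYK m); lra.
have aZ : `|Ex P2 (fun w => f (vec Z w)) - Ex P2 (fun w => T (vec Z w))| <= e / 4.
  apply: le_trans (trunc_approx P2 cf fB tT TB (ltW e8) fT mZ) _.
  by have := small _ (fun i => HZ i K (KZK i)); lra.
have tc : Ex P1 (fun w => T (vec (Y m) w)) @[m --> \oo] --> Ex P2 (fun w => T (vec Z w)).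
  have [l Tl] := tT.
  have E1 dS (S : measurableType dS) (P : probability S R) (Y' : 'I_n -> S -> R) :
     (forall i, measurable_fun [set: S] (Y' i)) ->
     Ex P (fun w => T (vec Y' w)) = \sum_(p <- l) p.1 * (cos p.2.2 * Ex P (fun w => cos (dot p.2.1 (vec Y' w)))
         - sin p.2.2 * Ex P (fun w => sin (dot p.2.1 (vec Y' w)))).
    move=> mY'; have -> : (fun w => T (vec Y' w)) = fun w =>
       \sum_(p <- l) p.1 * cos (dot p.2.1 (vec Y' w) + p.2.2) by apply/funext => w; rewrite Tl.
    rewrite Ex_sum; last by move=> p; apply: bmZ; exact: bm_cos_dot.
    apply: eq_bigr => p _; rewrite ExZ; last exact: bm_cos_dot.
    by rewrite Ex_cos_phase.
  rewrite E1 //; under eq_fun do rewrite E1 //.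
  apply: seq_sum => p; apply: seqZ; apply: cvgB; apply: seqZ; [exact: cc|exact: cs].
have e4 : 0 < e / 4 by rewrite divr_gt0.
have /cvgrPdist_le /(_ _ e4) := tc; apply: filterS => m Hm.
have -> : Ex P2 (fun w => f (vec Z w)) - Ex P1 (fun w => f (vec (Y m) w))
  = (Ex P2 (fun w => f (vec Z w)) - Ex P2 (fun w => T (vec Z w)))
  + (Ex P2 (fun w => T (vec Z w)) - Ex P1 (fun w => T (vec (Y m) w)))
  - (Ex P1 (fun w => f (vec (Y m) w)) - Ex P1 (fun w => T (vec (Y m) w))) by ring.
apply: le_trans (ler_normB _ _) _; have := aY m.
by have := ler_normD (Ex P2 (fun w => f (vec Z w)) - Ex P2 (fun w => T (vec Z w)))
  (Ex P2 (fun w => T (vec Z w)) - Ex P1 (fun w => T (vec (Y m) w))); move: aZ Hm; lra.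
Qed.

Variables (Y : 'I_n -> S1 -> R) (Z : 'I_n -> S2 -> R).
Hypotheses (mY : forall i, measurable_fun [set: S1] (Y i)).
Hypotheses (mZ : forall i, measurable_fun [set: S2] (Z i)).
Hypothesis YZ : same_charfun Y Z.

Lemma same_charfun_continuous (f : 'rV[R]_n -> R) (B : R) : continuous f -> (forall x, `|f x| <= B) ->
  Ex P1 (fun w => f (vec Y w)) = Ex P2 (fun w => f (vec Z w)).
Proof.
move=> cf fB.
have tY e : 0 < e -> exists K0, forall K, K0 <= K -> forall m i,
    Ex P1 (\1_(exceeds K ((fun _ : nat => Y) m i))) <= e.
  move=> e0; have /choice [KY HY] : forall i, exists K0, forall K, K0 <= K -> Ex P1 (\1_(exceeds K (Y i))) <= e.
    by move=> i; exact: single_tight.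
  exists (\sum_i `|KY i|) => K KK _ i; apply: HY; apply: le_trans KK.
  by apply: le_trans (ler_norm _) _; rewrite (bigD1 i) //= lerDl sumr_ge0.
have := @levy_continuity (fun=> Y) Z (fun=> mY) mZ tY.
move=> /(_ _ _ f B cf fB) H; apply: (seq_unique (u := fun=> Ex P1 (fun w => f (vec Y w)))).
  exact: cvg_cst.
apply: H => theta; have [E1 E2] := YZ theta; first by rewrite E1; exact: cvg_cst.
by rewrite E2; exact: cvg_cst.
Qed.

(** Continuous functions that converge to the indicator of the open orthant below [b]. *)
Let box_fun (b : 'I_n -> R) (m : nat) (x : 'rV[R]_n) : R :=
  \prod_i Num.min 1 (Num.max 0 (m%:R * (b i - x 0 i))).

Let factor01 (b y : R) (m : nat) : 0 <= Num.min 1 (Num.max 0 (m%:R * (b - y))) <= 1.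
Proof. by rewrite le_min ler01 le_max lexx ge_min lexx. Qed.

Let box_fun_continuous b m : continuous (box_fun b m).
Proof.
rewrite /box_fun; elim: (index_enum _) => [|i r IH].
  rewrite (_ : (fun x : 'rV[R]_n => \prod_(i <- [::]) _) = fun=> 1).
    exact: cst_continuous.
  by apply/funext => x; rewrite big_nil.
rewrite (_ : (fun x : 'rV[R]_n => \prod_(j <- i :: r) _) = fun x => Num.min 1 (Num.max 0 (m%:R * (b i - x 0 i))) *
   \prod_(j <- r) Num.min 1 (Num.max 0 (m%:R * (b j - x 0 j)))); last first.
  by apply/funext => x; rewrite big_cons.
move=> x; apply: (@continuousM _ _ (fun x : 'rV[R]_n => Num.min 1 (Num.max 0 (m%:R * (b i - x 0 i)))) _ x);
  last exact: IH.
have c0 : {for x, continuous (fun x : 'rV[R]_n => m%:R * (b i - x 0 i))}.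
  apply: (@continuousM _ _ (fun=> m%:R) (fun x : 'rV[R]_n => b i - x 0 i)); first exact: cst_continuous.
  apply: (@continuousB _ _ _ (fun=> b i) (fun x : 'rV[R]_n => x 0 i)); first exact: cst_continuous.
  exact: coord_continuous.
have cc (c : R) : {for x, continuous (fun=> c : R)} by exact: cst_continuous.
exact: (@continuous_min _ _ (fun=> 1) _ x (cc 1) (@continuous_max _ _ (fun=> 0) _ x (cc 0) c0)).
Qed.

Let box_fun_bound b m x : `|box_fun b m x| <= 1.
Proof.
rewrite normr_prod; apply: prodr_ile1 => i _; rewrite normr_ge0 /=.
by have /andP [h1 h2] := factor01 (b i) (x 0 i) m; rewrite ger0_norm.
Qed.

Let box_fun_cvg b x : box_fun b m x @[m --> \oo] --> (\prod_i ((x 0 i < b i)%R%:R : R) : R).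
Proof.
rewrite /box_fun; elim: (index_enum _) => [|i r IH].
  by rewrite big_nil; under eq_fun do rewrite big_nil; exact: cvg_cst.
rewrite big_cons; under eq_fun do rewrite big_cons; apply: seqM => //.
have [lt|ge] := ltP (x 0 i) (b i).
  apply/cvgrPdist_le => e e0; exists (Num.bound (b i - x 0 i)^-1) => // m /= bm.
  have q0 : 0 < b i - x 0 i by rewrite subr_gt0.
  have h : 1 <= m%:R * (b i - x 0 i).
    rewrite -ler_pdivrMr // mul1r; apply: ltW; apply: lt_le_trans (archi_boundP _) _.
      by rewrite invr_ge0 ltW.
    by rewrite ler_nat.
  rewrite (max_idPr _); last exact: le_trans h.
  by rewrite (min_idPl h) subrr normr0 ltW.
apply/cvgrPdist_le => e e0; exists 0%N => // m _.
rewrite (max_idPl _); last by rewrite mulr_ge0_le0 // subr_le0.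
by rewrite (min_idPr ler01) subrr normr0 ltW.
Qed.

Let box (b : 'I_n -> R) : set (n.-tuple R) := [set t | forall i, tnth t i < b i].

Definition tup {S} (Y : 'I_n -> S -> R) (w : S) : n.-tuple R := [tuple Y i w | i < n].

Lemma measurable_tup dS (S : measurableType dS) (Y' : 'I_n -> S -> R) :
  (forall i, measurable_fun [set: S] (Y' i)) -> measurable_fun [set: S] (tup Y').
Proof.
move=> mY'; apply/measurable_fun_tnthP => i; rewrite (_ : _ \o _ = Y' i) //.
by apply/funext => w; rewrite /= tnth_mktuple.
Qed.

Let measurable_box b : measurable (box b).
Proof.
have -> : box b = \bigcap_(i in [set: 'I_n]) ((fun t : n.-tuple R => tnth t i) @^-1` `]-oo, b i[%classic).
  apply/seteqP; split => t /= H; first by move=> i _ /=; rewrite in_itv /=; exact: H.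
  by move=> i; have := H i I; rewrite /= in_itv.
apply: fin_bigcap_measurable => // i _; rewrite -[X in measurable X]setTI.
by apply: (measurable_tnth i) => //; exact: measurable_itv.
Qed.

Let box_indic dS (S : measurableType dS) (Y' : 'I_n -> S -> R) b w :
  \1_(tup Y' @^-1` box b) w = \prod_i (vec Y' w 0 i < b i)%R%:R :> R.
Proof.
rewrite indicE; have [H|] := boolP (w \in _).
  rewrite big1 // => i _; have := set_mem H => /(_ i).
  by rewrite tnth_mktuple mxE => ->.
move=> /negP H; have [i Hi] : exists i, ~~ (vec Y' w 0 i < b i).
  apply: contrapT => /forallNP H'; apply: H; apply/mem_set => i.
  by rewrite tnth_mktuple; have := H' i => /negP; rewrite negbK mxE.
by rewrite (bigD1 i) //= (negbTE Hi) mul0r.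
Qed.

Let box_law b : P1 (tup Y @^-1` box b) = P2 (tup Z @^-1` box b).
Proof.
have key dS (S : measurableType dS) (P : probability S R) (Y' : 'I_n -> S -> R) :
    (forall i, measurable_fun [set: S] (Y' i)) ->
    Ex P (fun w => box_fun b m (vec Y' w)) @[m --> \oo] --> fine (P (tup Y' @^-1` box b)).
  move=> mY'; have mB : measurable (tup Y' @^-1` box b).
    by rewrite -[X in measurable X]setTI; apply: (measurable_tup mY').
  rewrite -Ex_indic //; apply: (Ex_bounded_cvg (M := 1)).
  - by move=> m; have [] := bm_continuous (@box_fun_continuous b m) (@box_fun_bound b m) mY'.
  - by move=> m w; exact: box_fun_bound.
  - by move=> w; rewrite box_indic; exact: box_fun_cvg.
have h1 := key _ _ P1 Y mY; have h2 := key _ _ P2 Z mZ.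
have E1 m : Ex P1 (fun w => box_fun b m (vec Y w)) = Ex P2 (fun w => box_fun b m (vec Z w)).
  exact: same_charfun_continuous (@box_fun_continuous b m) (@box_fun_bound b m).
rewrite (funext E1) in h1.
have E2 := seq_unique h1 h2.
have m1 : measurable (tup Y @^-1` box b).
  by rewrite -[X in measurable X]setTI; apply: (measurable_tup mY).
have m2 : measurable (tup Z @^-1` box b).
  by rewrite -[X in measurable X]setTI; apply: (measurable_tup mZ).
by rewrite -[LHS]fineK ?fin_num_measure // E2 fineK ?fin_num_measure.
Qed.

Let box_generates : (@measurable _ (n.-tuple R)) = <<s range box >>.
Proof.
apply/seteqP; split; last first.
  by apply: smallest_sub; [exact: sigma_algebra_measurable|move=> _ [b _ <-]; exact: measurable_box].
pose T' := g_sigma_algebraType (range box).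
have mc (i : 'I_n) : measurable_fun [set: T'] (fun t : T' => tnth (t : n.-tuple R) i).
  apply: (measurability _ (RGenInftyO.measurableE R)) => _ [_ [x ->] <-]; rewrite setTI.
  (* A half-space in one coordinate is the union over m of orthants whose other bounds are all m. *)
  have -> : (fun t : T' => tnth (t : n.-tuple R) i) @^-1` `]-oo, x[%classic
     = \bigcup_(m : nat) (box (fun j => if j == i then x else m%:R) : set T').
    apply/seteqP; split => [t /=|t [m _ H]] /=; last first.
      by have := H i; rewrite eqxx in_itv.
    rewrite in_itv /= => tx; exists (\sum_j Num.bound `|tnth t j|)%N => // j.
    case: eqVneq => [->//|_]; apply: le_lt_trans (ler_norm _) _.
    apply: lt_le_trans (archi_boundP (normr_ge0 _)) _; rewrite ler_nat.
    by rewrite (bigD1 j) //= leq_addr.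
  by apply: bigcup_measurable => m _; apply: sub_sigma_algebra; eexists.
apply: smallest_sub; first exact: (@sigma_algebra_measurable _ T').
rewrite /=; elim/big_ind: _ => // [A B hA hB C [/hA|/hB] //|i _ C [D mD <-]].
exact: (mc i measurableT D mD).
Qed.

(** Open orthants are stable under intersection and generate the product sigma-algebra, and their
    probabilities are limits of expectations of continuous functions. *)
Theorem tuple_law_unique B : measurable B -> P1 (tup Y @^-1` B) = P2 (tup Z @^-1` B).
Proof.
move=> mB.
pose Y' : {mfun S1 >-> n.-tuple R} := mfun_Sub (mem_set (measurable_tup mY)).
pose Z' : {mfun S2 >-> n.-tuple R} := mfun_Sub (mem_set (measurable_tup mZ)).
apply: (measure_unique (range box) (fun m => box (fun=> m%:R)) box_generates _ _ _
  (distribution P1 Y') (distribution P2 Z')) mB.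
- move=> _ _ [b _ <-] [b' _ <-]; exists (fun i => Num.min (b i) (b' i)) => //.
  apply/seteqP; split => t /=; first by move=> H; split => i; have := H i; rewrite lt_min => /andP [].
  by move=> [h1 h2] i; rewrite lt_min h1 h2.
- by move=> m; exists (fun=> m%:R).
- apply/seteqP; split => // t _; exists (\sum_j Num.bound `|tnth t j|)%N => // j.
  apply: le_lt_trans (ler_norm _) _.
  apply: lt_le_trans (archi_boundP (normr_ge0 _)) _; rewrite ler_nat.
  by rewrite (bigD1 j) //= leq_addr.
- by move=> _ [b _ <-]; exact: box_law.
- by move=> m; rewrite (le_lt_trans (probability_le1 (distribution P1 Y') _)) ?ltry.
Qed.

End levy.

(** * Gaussian variables *)

Section gaussian_integrals.
Context {R : realType}.
Notation mu := (@lebesgue_measure R).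
Implicit Types (t x : R).

Lemma cvg_integral_expanding (g : R -> R) : mu.-integrable [set: R] (EFin \o g) ->
  \int[mu]_(x in `[- n%:R, n%:R]) g x @[n --> \oo] --> \int[mu]_x g x.
Proof.
move=> ig; have mg : measurable_fun [set: R] g by apply/measurable_EFinP; exact: measurable_int ig.
pose gn (n : nat) x := g x * \1_(`[- n%:R, n%:R]%classic) x.
have mgn n : measurable_fun [set: R] (gn n).
  by apply: measurable_funM => //; apply: measurable_indic; exact: measurable_itv.
have [] := @dominated_convergence _ (measurableTypeR R) R mu setT measurableT (fun n x => (gn n x)%:E)
  (fun x => (g x)%:E) (fun x => `|g x|%:E).
- by move=> n; apply/measurable_EFinP; exact: mgn.
- exact/measurable_EFinP.
- apply: aeW => x _; apply/cvg_EFin; first exact: nearW.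
  apply/cvgrPdist_le => e e0; exists (Num.bound `|x|) => // m /= bm.
  rewrite /gn indicE mem_set ?mulr1 ?subrr ?normr0 ?ltW //= in_itv /= -ler_norml.
  by apply: ltW; apply: lt_le_trans (archi_boundP (normr_ge0 x)) _; rewrite ler_nat.
- have := integrable_abse ig; apply: eq_integrable => // x _; by rewrite /= abse_EFin.
- apply: aeW => x n _; rewrite lee_fin /gn normrM ler_piMr // indicE.
  by case: (_ \in _); rewrite ?normr1 ?normr0 ?ler01 ?lexx.
move=> _ _ H.
have E1 n : \int[mu]_(x in `[- n%:R, n%:R]) g x = fine (\int[mu]_x (gn n x)%:E)%E.
  rewrite Rintegral_mkcond /Rintegral; congr fine; apply: eq_integral => x _.
  rewrite /gn patchE indicE; case: ifPn => _; rewrite ?mulr1 ?mulr0 //.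
rewrite (funext E1); apply: fine_cvg.
have -> : (\int[mu]_x g x)%:E = (\int[mu]_x (g x)%:E)%E.
  by rewrite /Rintegral fineK //; exact: integrable_fin_num.
exact: H.
Qed.

Variables (K c phi : R).
Hypotheses (K0 : 0 < K) (c0 : 0 < c).

Definition gden x := K * expR (- (c * x ^+ 2)).

Hypothesis int_gden : forall c', 0 < c' ->
  mu.-integrable [set: R] (fun x => (expR (- (c' * x ^+ 2)))%:E).

Lemma gden_ge0 x : 0 <= gden x.
Proof. by rewrite mulr_ge0 ?expR_ge0 // ltW. Qed.

Lemma measurable_gden : measurable_fun [set: R] gden.
Proof.
apply: measurable_funM; first exact: measurable_cst.
apply: measurableT_comp => //; apply: measurable_funN.
by apply: measurable_funM; [exact: measurable_cst|exact: measurable_funX].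
Qed.

Lemma integrable_gden : mu.-integrable [set: R] (fun x => (gden x)%:E).
Proof. by under eq_fun do rewrite EFinM; apply: integrableZl => //; exact: int_gden. Qed.

Lemma integrable_bounded_gden (f : R -> R) (M : R) : measurable_fun [set: R] f ->
  (forall x, `|f x| <= M) -> mu.-integrable [set: R] (fun x => (f x * gden x)%:E).
Proof.
move=> mf fM; apply: (@le_integrable _ (measurableTypeR R) R mu setT measurableT _ (fun x => (M * gden x)%:E)).
- by apply/measurable_EFinP; apply: measurable_funM => //; exact: measurable_gden.
- move=> x _; rewrite lee_fin normrM (ger0_norm (gden_ge0 x)).
  apply: le_trans (ler_norm _); apply: ler_wpM2r => //; exact: gden_ge0.
- by under eq_fun do rewrite EFinM; apply: integrableZl => //; exact: integrable_gden.
Qed.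

(** Half of the exponent absorbs the factor |x|. This provides the integrable bound for
    differentiation under the integral. *)
Lemma norm_gden_le x : `|x| * gden x <= K * (1 + (2 * c)^-1) * expR (- (c / 2 * x ^+ 2)).
Proof.
rewrite /gden mulrCA -[leRHS]mulrA ler_pM2l //.
have -> : - (c * x ^+ 2) = - (c / 2 * x ^+ 2) + - (c / 2 * x ^+ 2) by field.
rewrite expRD mulrA ler_pM2r ?expR_gt0 // expRN ler_pdivrMr ?expR_gt0 //.
have e1 := expR_ge1Dx (c / 2 * x ^+ 2).
have A0 : 0 < (2 * c)^-1 by rewrite invr_gt0 mulr_gt0.
apply: (@le_trans _ _ ((1 + (2 * c)^-1) * (1 + c / 2 * x ^+ 2))); last first.
  by rewrite ler_pM2l // addr_gt0.
have -> : (1 + (2 * c)^-1) * (1 + c / 2 * x ^+ 2)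
   = 1 + c / 2 * x ^+ 2 + (2 * c)^-1 + x ^+ 2 / 4 by field; rewrite gt_eqF.
have x0 : 0 <= `|x| by exact: normr_ge0.
rewrite -[x ^+ 2]real_normK ?num_real //; have : 0 <= c / 2 * `|x| ^+ 2.
  by rewrite mulr_ge0 ?exprn_ge0 // divr_ge0 // ltW.
move: (`|x|) x0 => y y0 cy.
have : 0 <= (y / 2 - 1) ^+ 2 by exact: sqr_ge0.
have -> : (y / 2 - 1) ^+ 2 = y ^+ 2 / 4 - y + 1 by field.
by move: A0 cy; lra.
Qed.

Lemma integrable_norm_gden : mu.-integrable [set: R] (fun x => (`|x| * gden x)%:E).
Proof.
apply: (@le_integrable _ (measurableTypeR R) R mu setT measurableT _
  (fun x => (K * (1 + (2 * c)^-1) * expR (- (c / 2 * x ^+ 2)))%:E)).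
- have mn : measurable_fun [set: R] (fun x : R => `|x|).
    by apply: measurableT_comp => //; exact: measurable_id.
  by apply/measurable_EFinP; apply: measurable_funM mn measurable_gden.
- move=> x _; rewrite lee_fin ger0_norm; last by rewrite mulr_ge0 // gden_ge0.
  exact: le_trans (norm_gden_le x) (ler_norm _).
- under eq_fun do rewrite EFinM; apply: integrableZl => //; apply: int_gden; exact: divr_gt0.
Qed.

Lemma is_derive_gden x : is_derive x 1 gden (- (2 * c * x) * gden x).
Proof.
have -> : gden = K *: (expR \o (fun y : R => - (c * y ^+ 2))).
  by apply/funext => y.
have -> : - (2 * c * x) * gden x = K *: (- (2 * c * x) * expR (- (c * x ^+ 2))).
  by rewrite /gden /GRing.scale /=; ring.
apply: is_deriveZ.
have D : is_derive x 1 (fun y : R => - (c * y ^+ 2)) (- (2 * c * x)).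
  have -> : (fun y : R => - (c * y ^+ 2)) = (- c) *: (id ^+ 2).
    by apply/funext => y; exact: (esym (mulNr c (y ^+ 2))).
  by apply: is_derive_eq; rewrite /GRing.scale /= expr1; ring.
by rewrite mulrC; apply: is_derive1_comp.
Qed.

Lemma continuous_gden : continuous gden.
Proof.
move=> x; apply: differentiable_continuous; apply/derivable1_diffP.
by have [] := is_derive_gden x.
Qed.

Lemma gden_cvg0 : gden n%:R @[n --> \oo] --> (0 : R).
Proof.
apply/cvgrPdist_le => e e0; pose q := K / (c * e).
have q0 : 0 <= q by rewrite divr_ge0 ?ltW // mulr_gt0.
exists (Num.bound q).+1 => // m /= bm; rewrite sub0r normrN ger0_norm ?gden_ge0 //.
rewrite /gden expRN ler_pdivrMr ?expR_gt0 //.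
have m1 : 1 <= m%:R :> R by rewrite ler1n; apply: leq_trans bm.
have qm : q <= m%:R.
  by apply: ltW; apply: lt_le_trans (archi_boundP q0) _; rewrite ler_nat ltnW.
rewrite /q ler_pdivrMr ?mulr_gt0 // in qm.
apply: le_trans qm _; rewrite mulrCA mulrA [_ * e]mulrC ler_pM2l //.
apply: le_trans (expR_ge1Dx _); have : c * m%:R <= c * m%:R ^+ 2.
  by rewrite ler_pM2l // expr2 ler_peMl // (le_trans ler01).
by rewrite mulrC; lra.
Qed.

Let cosI t := \int[mu]_x (cos (t * x + phi) * gden x).
Let sinI t := \int[mu]_x (x * sin (t * x + phi) * gden x).

Let mscale t : measurable_fun [set: R] (fun x => t * x + phi).
Proof.
apply: measurable_funD; last exact: measurable_cst.
by apply: measurable_funM; [exact: measurable_cst|exact: measurable_id].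
Qed.

Let mcos t : measurable_fun [set: R] (fun x => cos (t * x + phi)).
Proof. by have [] := bm_comp (h := cos) (M := 1) (@continuous_cos R) (@cos_max R) (mscale t). Qed.

Let msin t : measurable_fun [set: R] (fun x => sin (t * x + phi)).
Proof. by have [] := bm_comp (h := sin) (M := 1) (@continuous_sin R) (@sin_max R) (mscale t). Qed.

Let int_xsin t : mu.-integrable [set: R] (fun x => (x * sin (t * x + phi) * gden x)%:E).
Proof.
apply: (@le_integrable _ (measurableTypeR R) R mu setT measurableT _ (fun x => (`|x| * gden x)%:E)).
- apply/measurable_EFinP; apply: measurable_funM; last exact: measurable_gden.
  by apply: measurable_funM; [exact: measurable_id|exact: msin].
- move=> x _; rewrite lee_fin !normrM normr_id; apply: ler_wpM2r => //.
  by rewrite ler_piMr // sin_max.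
- exact: integrable_norm_gden.
Qed.

Let int_cos t : mu.-integrable [set: R] (fun x => (cos (t * x + phi) * gden x)%:E).
Proof. by apply: (integrable_bounded_gden (M := 1)) => // x; exact: cos_max. Qed.

Let is_derive_lin t x : is_derive x 1 (fun y : R => t * y + phi) t.
Proof.
have -> : (fun y : R => t * y + phi) = (t *: id) \+ cst phi by apply/funext.
by apply: is_derive_eq; rewrite /GRing.scale /= mulr1 addr0.
Qed.

Let is_derive_sinI t x : is_derive x 1 (fun y => sin (t * y + phi) * gden y)
  (t * (cos (t * x + phi) * gden x) - 2 * c * (x * sin (t * x + phi) * gden x)).
Proof.
have D1 : is_derive x 1 (fun y => sin (t * y + phi)) (t * cos (t * x + phi)).
  have -> : (fun y => sin (t * y + phi)) = sin \o (fun y => t * y + phi) by [].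
  rewrite mulrC; apply: is_derive1_comp; exact: is_derive_lin.
have D2 := is_derive_gden x.
have D := is_deriveM D1 D2; rewrite (_ : t * _ - _ = sin (t * x + phi) *: (- (2 * c * x) * gden x)
  + gden x *: (t * cos (t * x + phi))); first exact: D.
by rewrite /GRing.scale /=; ring.
Qed.

(* Together with is_derive_cosI this is a linear differential equation for the
   characteristic function. *)
Lemma gaussian_by_parts t : t * cosI t = 2 * c * sinI t.
Proof.
pose H' x := t * (cos (t * x + phi) * gden x) - 2 * c * (x * sin (t * x + phi) * gden x).
have i1 : mu.-integrable [set: R] (fun x => (t * (cos (t * x + phi) * gden x))%:E).
  by under eq_fun do rewrite EFinM; apply: integrableZl => //; exact: int_cos.
have i2 : mu.-integrable [set: R] (fun x => (2 * c * (x * sin (t * x + phi) * gden x))%:E).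
  by under eq_fun do rewrite EFinM; apply: integrableZl => //; exact: int_xsin.
have iH : mu.-integrable [set: R] (EFin \o H').
  have := integrableB measurableT i1 i2; apply: eq_integrable => // x _.
have -> : sinI t = \int[mu]_x (x * sin (t * x + phi) * gden x) by [].
apply/eqP; rewrite -subr_eq0; apply/eqP.
have <- : \int[mu]_x H' x = t * cosI t - 2 * c * sinI t.
  rewrite /H' RintegralB // /cosI /sinI.
  by rewrite !RintegralZl //; [exact: int_xsin|exact: int_cos].
have cH : continuous H'.
  have cl : continuous (fun x : R => t * x + phi).
    move=> x; apply: differentiable_continuous; apply/derivable1_diffP.
    by have [] := is_derive_lin t x.
  have cc : continuous (fun x => cos (t * x + phi)).
    by move=> x; apply: continuous_comp; [exact: cl|exact: continuous_cos].
  have cs : continuous (fun x => sin (t * x + phi)).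
    by move=> x; apply: continuous_comp; [exact: cl|exact: continuous_sin].
  move=> x; apply: (@continuousB _ _ _ (fun x => t * (cos (t * x + phi) * gden x)) (fun x => 2 * c * (x * sin (t * x + phi) * gden x))).
    apply: (@continuousM _ _ (fun=> t) (fun x => cos (t * x + phi) * gden x)); first exact: cst_continuous.
    by apply: continuousM; [exact: cc|exact: continuous_gden].
  apply: (@continuousM _ _ (fun=> 2 * c) (fun x => x * sin (t * x + phi) * gden x)); first exact: cst_continuous.
  apply: (@continuousM _ _ (fun x => x * sin (t * x + phi)) gden); last exact: continuous_gden.
  by apply: (@continuousM _ _ id (fun x => sin (t * x + phi))); [by move=> ?|exact: cs].
pose H x := sin (t * x + phi) * gden x.
have FTC n : \int[mu]_(x in `[- n.+1%:R, n.+1%:R]) H' x = H n.+1%:R - H (- n.+1%:R).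
  rewrite /Rintegral (@continuous_FTC2 R H' H) //.
  - by rewrite gtrN // ltr0n.
  - exact: continuous_subspaceT.
  - have cont x : H x @[x --> x] --> H x.
      by apply: differentiable_continuous; apply/derivable1_diffP; have [] := is_derive_sinI t x.
    split => [x _| |].
    + by have [] := is_derive_sinI t x.
    + by apply: cvg_at_right_filter; exact: cont.
    + by apply: cvg_at_left_filter; exact: cont.
  - by move=> x _; rewrite derive1E; have [_ ->] := is_derive_sinI t x.
have l1 := cvg_integral_expanding iH.
have l2 : \int[mu]_(x in `[- n.+1%:R, n.+1%:R]) H' x @[n --> \oo] --> \int[mu]_x H' x.
  by have := l1; rewrite -cvg_shiftS.
apply: (seq_unique l2); rewrite (funext FTC).
have l3 : 2 * gden n.+1%:R @[n --> \oo] --> (0 : R).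
  have := gden_cvg0; rewrite -cvg_shiftS => l; have := seqZ (c := 2) l.
  by rewrite mulr0 => l'; apply: l'.
apply/cvgrPdist_le => e e0; have /cvgrPdist_le /(_ e e0) := l3.
apply: filterS => n; rewrite !sub0r !normrN => h; apply: le_trans h.
have g2 : 0 <= 2 * gden n.+1%:R by rewrite mulr_ge0 // gden_ge0.
rewrite (ger0_norm g2).
have Hb x : `|H x| <= gden x.
  by rewrite /H normrM (ger0_norm (gden_ge0 x)) ler_piMl ?gden_ge0 // sin_max.
have gN x : gden (- x) = gden x by rewrite /gden sqrrN.
apply: le_trans (ler_normB _ _) _; apply: le_trans (lerD (Hb _) (Hb _)) _.
by rewrite gN mulr_natl mulr2n.
Qed.

Lemma is_derive_cosI t : is_derive t 1 cosI (- sinI t).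
Proof.
pose f t x := cos (t * x + phi) * gden x.
have D1 t' x : is_derive t' 1 (f ^~ x) (- (x * sin (t' * x + phi) * gden x)).
  have D : is_derive t' 1 (fun s => cos (s * x + phi)) (- sin (t' * x + phi) * x).
    have -> : (fun s => cos (s * x + phi)) = cos \o (fun s => x * s + phi) by apply/funext => s /=; rewrite mulrC.
    rewrite [t' * x]mulrC; apply: is_derive1_comp; exact: is_derive_lin.
  have -> : (f ^~ x) = gden x *: (fun s => cos (s * x + phi)) by apply/funext => s; exact: mulrC.
  by apply: is_derive_eq; rewrite /GRing.scale /=; ring.
have h1 x' : `]t - 1, t + 1[%classic x' -> mu.-integrable [set: R] (EFin \o f x').
  by move=> _; exact: int_cos.
have It : `]t - 1, t + 1[%classic t by rewrite /= in_itv /=; apply/andP; split; lra.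
have h2 x' y : `]t - 1, t + 1[%classic x' -> [set: R] y -> derivable (f ^~ y) x' 1.
  by move=> _ _; have [] := D1 x' y.
have h3 x' y : `]t - 1, t + 1[%classic x' -> [set: R] y -> `|partial1of2 f x' y| <= `|y| * gden y.
  move=> _ _; rewrite partial1of2E; have [_ ->] := D1 x' y; rewrite normrN normrM [X in X * _]normrM.
  rewrite (ger0_norm (gden_ge0 y)); apply: ler_wpM2r; first exact: gden_ge0.
  by rewrite ler_piMr // sin_max.
have h0 y : 0 <= `|y| * gden y by rewrite mulr_ge0 // gden_ge0.
have der := derivable_under_integral measurableT It h1 h2 h0 integrable_norm_gden h3.
have val := differentiation_under_integral measurableT It h1 h2 h0 integrable_norm_gden h3.
apply: DeriveDef; first exact: der.
rewrite -derive1E val /sinI -mulN1r -RintegralZl //; last exact: int_xsin.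
by apply: eq_Rintegral => x _; rewrite partial1of2E; have [_ ->] := D1 t x; rewrite mulN1r.
Qed.

Hypothesis mass1 : \int[mu]_x gden x = 1.

Lemma gaussian_cos_integral t : \int[mu]_x (cos (t * x + phi) * gden x) = cos phi * expR (- (t ^+ 2 / (4 * c))).
Proof.
(* The integrating factor of the linear differential equation, so [g] is constant. *)
pose g (s : R) := cosI s * expR (s ^+ 2 / (4 * c)).
have Dg (s : R) : is_derive s 1 g 0.
  have De : is_derive s 1 (fun s => expR (s ^+ 2 / (4 * c))) (s / (2 * c) * expR (s ^+ 2 / (4 * c))).
    have D : is_derive s 1 (fun s : R => s ^+ 2 / (4 * c)) (s / (2 * c)).
      have -> : (fun s : R => s ^+ 2 / (4 * c)) = (4 * c)^-1 *: (id ^+ 2).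
        by apply/funext => y; exact: mulrC.
      by apply: is_derive_eq; rewrite /GRing.scale /= expr1; field; rewrite gt_eqF.
    have -> : (fun s => expR (s ^+ 2 / (4 * c))) = expR \o (fun s : R => s ^+ 2 / (4 * c)) by [].
    by rewrite [s / (2 * c) * _]mulrC; apply: is_derive1_comp.
  have Dc := is_derive_cosI s.
  have D := is_deriveM Dc De; rewrite (_ : 0 = cosI s *: (s / (2 * c) * expR (s ^+ 2 / (4 * c)))
    + expR (s ^+ 2 / (4 * c)) *: (- sinI s)); first exact: D.
  rewrite /GRing.scale /=.
  have S1 : sinI s = s * cosI s / (2 * c) by rewrite gaussian_by_parts; field; rewrite gt_eqF.
  by rewrite S1; field; rewrite gt_eqF.
have g0 : g 0 = cos phi.
  rewrite /g /cosI expr0n mul0r expR0 mulr1 -[RHS]mulr1 -mass1 -RintegralZl //; last exact: integrable_gden.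
  by apply: eq_Rintegral => x _; rewrite mul0r add0r.
have gt1 : g t = cos phi.
  rewrite -g0; have [t0|t0] := leP 0 t.
    have [d _] := MVT_everywhere Dg t0; rewrite mul0r => /eqP; rewrite subr_eq0 => /eqP //.
  have [d _] := MVT_everywhere Dg (ltW t0); rewrite mul0r => /eqP; rewrite subr_eq0 => /eqP //.
apply: (mulIf (x := expR (t ^+ 2 / (4 * c)))); first by rewrite gt_eqF ?expR_gt0.
by rewrite -/(cosI t) -/(g t) gt1 -mulrA -expRD addNr expR0 mulr1.
Qed.

End gaussian_integrals.

Section normal_law.
Context {R : realType}.
Notation mu := (@lebesgue_measure R).
Implicit Types (t x s : R).

Lemma normal_pdf_gden s x : 0 < s ->
  normal_pdf 0 s x = gden (normal_peak s) (s ^+ 2 *+ 2)^-1 x.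
Proof.
move=> s0; rewrite normal_pdfE ?gt_eqF // /gden /normal_fun subr0.
by congr (_ * expR _); rewrite mulNr mulrC.
Qed.

Lemma integrable_expN_sqr c : 0 < c ->
  mu.-integrable [set: R] (fun x => (expR (- (c * x ^+ 2)))%:E).
Proof.
move=> c0; pose s := Num.sqrt ((2 * c)^-1).
have q0 : 0 < (2 * c)^-1 by rewrite invr_gt0 mulr_gt0.
have s0 : 0 < s by rewrite sqrtr_gt0.
have sE : (s ^+ 2 *+ 2)^-1 = c.
  by rewrite sqr_sqrtr ?ltW // -mulr_natl; field; rewrite gt_eqF.
have p0 := normal_peak_gt0 (lt0r_neq0 s0).
have E1 x : (expR (- (c * x ^+ 2)))%:E = ((normal_peak s)^-1%:E * (normal_pdf 0 s x)%:E)%E.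
  by rewrite -EFinM normal_pdf_gden // /gden sE mulKf // gt_eqF.
by under eq_fun do rewrite E1; apply: integrableZl => //; exact: integrable_normal_pdf.
Qed.

Lemma integral_normal_prob s (f : R -> \bar R) :
  (normal_prob 0 s).-integrable setT f ->
  (\int[normal_prob 0 s]_x f x = \int[mu]_x (f x * (normal_pdf 0 s x)%:E))%E.
Proof.
move=> intf; have mf := measurable_int _ intf.
have dom := @normal_prob_dominates R 0 s.
rewrite -(Radon_Nikodym_change_of_variables dom) //.
apply: ae_eq_integral => //.
- exact: emeasurable_funM.
- by apply: emeasurable_funM => //; apply/measurable_EFinP; exact: measurable_normal_pdf.
apply: ae_eqe_mul2l => /=; rewrite Radon_NikodymE //=.
case: cid => /= g [g1 g2 g3]; apply: integral_ae_eq => //=.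
- by apply/measurable_EFinP; exact: measurable_normal_pdf.
- by move=> E _ mE; rewrite -g3.
Qed.

Lemma normal_charfun s t phi : 0 < s ->
  Ex (normal_prob 0 s) (fun x => cos (t * x + phi)) = cos phi * expR (- (t ^+ 2 * s ^+ 2 / 2)).
Proof.
move=> s0; have p0 := normal_peak_gt0 (lt0r_neq0 s0).
have c0 : 0 < (s ^+ 2 *+ 2)^-1 by rewrite invr_gt0 pmulrn_rgt0 // exprn_gt0.
have pE : normal_pdf 0 s = gden (normal_peak s) (s ^+ 2 *+ 2)^-1.
  by apply/funext => x; exact: normal_pdf_gden.
have mass1 : \int[mu]_x gden (normal_peak s) (s ^+ 2 *+ 2)^-1 x = 1.
  by rewrite -pE /Rintegral integral_normal_pdf.
have := gaussian_cos_integral phi p0 c0 integrable_expN_sqr mass1 t.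
have -> : t ^+ 2 / (4 * (s ^+ 2 *+ 2)^-1) = t ^+ 2 * s ^+ 2 / 2.
  by rewrite -mulr_natl; field; rewrite gt_eqF.
move=> <-; rewrite /Ex /Rintegral integral_normal_prob.
  by congr fine; apply: eq_integral => x _; rewrite -EFinM pE.
apply: bm_integrable; apply: (bm_comp (h := cos) (M := 1)); [exact: continuous_cos|exact: cos_max|].
apply: measurable_funD; last exact: measurable_cst.
by apply: measurable_funM; [exact: measurable_cst|exact: measurable_id].
Qed.

End normal_law.

(** * Fair coin tossing and its independent subsequences *)

Definition coin_cylinders : set (set (nat -> bool)) :=
  [set A | exists (k : nat) (b : bool), A = [set w | w k = b]].

Definition coins : Type := g_sigma_algebraType coin_cylinders.
HB.instance Definition _ := Measurable.on coins.

Section coin_space.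
Implicit Types (w b c : nat -> bool) (n m k : nat).

Definition coin_cyl n b : set coins := [set w | forall k, (k < n)%N -> w k = b k].

Lemma measurable_coin k (x : bool) : measurable [set w : coins | w k = x].
Proof. by apply: sub_sigma_algebra; exists k, x. Qed.

Lemma measurable_to_coins dS (S : measurableType dS) (f : S -> coins) :
  (forall k x, measurable [set s | f s k = x]) -> measurable_fun [set: S] f.
Proof.
move=> H; apply: (@measurability _ _ S coins setT f coin_cylinders) => //.
by move=> _ [_ [k [x ->]] <-]; rewrite setTI; exact: H.
Qed.

Definition set_bit b n (x : bool) : nat -> bool := fun k => if k == n then x else b k.

Lemma coin_cylS n b x : coin_cyl n.+1 (set_bit b n x) = coin_cyl n b `&` [set w | w n = x].
Proof.
apply/seteqP; split => [w H|w [H1 H2] k] /=.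
  split => [k kn|]; first by have := H k (ltnW kn); rewrite /set_bit; case: eqP kn => // ->; rewrite ltnn.
  by have := H n (ltnSn n); rewrite /set_bit eqxx.
rewrite ltnS leq_eqVlt /set_bit; case: eqP => [->|_] //=; exact: H1.
Qed.

Lemma coin_cyl_split n b :
  coin_cyl n b = coin_cyl n.+1 (set_bit b n true) `|` coin_cyl n.+1 (set_bit b n false).
Proof.
rewrite !coin_cylS -setIUr; apply/seteqP; split => w; last by case.
by move=> H; split => //=; case: (w n); [left|right].
Qed.

Lemma coin_cyl_disjoint n b :
  coin_cyl n.+1 (set_bit b n true) `&` coin_cyl n.+1 (set_bit b n false) = set0.
Proof.
rewrite !coin_cylS; apply/seteqP; split => // w [[_ /= h1] [_ /= h2]].
by move: h1; rewrite h2.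
Qed.

Lemma measurable_coin_cyl n b : measurable (coin_cyl n b).
Proof.
elim: n b => [|n IH] b.
  have -> : coin_cyl 0 b = setT by apply/seteqP; split.
  exact: measurableT.
have -> : coin_cyl n.+1 b = coin_cyl n b `&` [set w | w n = b n].
    rewrite -coin_cylS; congr (coin_cyl _ _); apply/funext => k.
  by rewrite /set_bit; case: eqP => [->|].
by apply: measurableI; [exact: IH|exact: measurable_coin].
Qed.

Definition coin_pi : set (set coins) := [set A | A = set0 \/ exists n b, A = coin_cyl n b].

Lemma coin_pi_closed : setI_closed coin_pi.
Proof.
have key n m b c : (n <= m)%N -> coin_pi (coin_cyl n b `&` coin_cyl m c).
  move=> nm; have [H|H] := pselect (forall k, (k < n)%N -> b k = c k).
    right; exists m, c; apply/seteqP; split => [w [] //|w Hw]; split => // k kn.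
    by rewrite H // Hw // (leq_trans kn).
  left; apply/seteqP; split => // w [h1 h2]; apply: H => k kn.
  by rewrite -h1 // h2 // (leq_trans kn).
move=> A B [->|[n [b ->]]]; first by left; rewrite set0I.
move=> [->|[m [c ->]]]; first by left; rewrite setI0.
by have [nm|/ltnW nm] := leqP n m; [exact: key|rewrite setIC; exact: key].
Qed.

Lemma coin_pi_generates : @measurable _ coins = <<s coin_pi >>.
Proof.
apply/seteqP; split; last first.
  apply: smallest_sub; first exact: sigma_algebra_measurable.
  by move=> _ [->|[n [b ->]]]; [exact: measurable0|exact: measurable_coin_cyl].
pose T' := g_sigma_algebraType coin_pi.
apply: smallest_sub; first exact: (@sigma_algebra_measurable _ T').
move=> _ [k [x ->]].
(* Descending on the length of the prescribed prefix, a condition on coin [k] becomes a finite union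
   of cylinders of length k + 1. *)
suff H j b : (j <= k)%N -> @measurable _ T' (coin_cyl (k - j) b `&` [set w | w k = x]).
  have := H k (fun=> true) (leqnn k); rewrite subnn.
  have -> : coin_cyl 0 (fun=> true) = setT by apply/seteqP; split.
  by rewrite setTI.
elim: j b => [|j IH] b jk.
  rewrite subn0 -coin_cylS; apply: sub_sigma_algebra; right; by eexists; eexists.
rewrite (coin_cyl_split (k - j.+1)) setIUl -subSn // subSS.
by apply: measurableU; apply: IH; exact: ltnW.
Qed.

Context {R : realType}.

Lemma coin_measure_unique (m1 m2 : {measure set coins -> \bar R}) :
  (m1 setT < +oo)%E -> (forall n b, m1 (coin_cyl n b) = m2 (coin_cyl n b)) ->
  forall A, measurable A -> m1 A = m2 A.
Proof.
move=> fin H A mA.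
have c0 : coin_cyl 0 (fun=> true) = setT by apply/seteqP; split.
apply: (measure_unique coin_pi (fun=> setT) coin_pi_generates coin_pi_closed) mA => //.
- by move=> _; right; exists 0%N, (fun=> true).
- by apply/seteqP; split => // w _; exists 0%N.
- by move=> _ [->|[n [b ->]]]; [rewrite !measure0|exact: H].
Qed.

(** Cuts one coin sequence into two independent ones; iterating on [odds] supplies infinitely
    many. *)
Definition evens (w : coins) : coins := fun k => w k.*2.
Definition odds (w : coins) : coins := fun k => w k.*2.+1.

Lemma measurable_evens : measurable_fun [set: coins] evens.
Proof. by apply: measurable_to_coins => k x; exact: measurable_coin. Qed.

Lemma measurable_odds : measurable_fun [set: coins] odds.
Proof. by apply: measurable_to_coins => k x; exact: measurable_coin. Qed.

Variable P : probability coins R.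
Hypothesis fairP : forall n b, P (coin_cyl n b) = (2^-1 ^+ n)%:E.

Let mpre (f : coins -> coins) A : measurable_fun [set: coins] f -> measurable A -> measurable (f @^-1` A).
Proof. by move=> mf mA; rewrite -[X in measurable X]setTI; exact: mf. Qed.

(** For equal lengths the event is a single cylinder on twice as many coins. Unequal lengths are
    reached from the larger one by summing over the last coin of either half. *)
Lemma fair_split n m b c :
  P (evens @^-1` coin_cyl n b `&` odds @^-1` coin_cyl m c) = (2^-1 ^+ n * 2^-1 ^+ m)%:E.
Proof.
pose p n m b c := P (evens @^-1` coin_cyl n b `&` odds @^-1` coin_cyl m c).
have mE n' b' : measurable (evens @^-1` coin_cyl n' b').
  by apply: mpre; [exact: measurable_evens|exact: measurable_coin_cyl].
have mO n' b' : measurable (odds @^-1` coin_cyl n' b').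
  by apply: mpre; [exact: measurable_odds|exact: measurable_coin_cyl].
have diag N b' c' : p N N b' c' = (2^-1 ^+ N * 2^-1 ^+ N)%:E.
  rewrite /p -exprD addnn -(fairP N.*2 (fun k => if odd k then c' k./2 else b' k./2)); congr (P _).
  apply/seteqP; split => [w [h1 h2] k kN|w H].
    have ke := odd_double_half k; case: ifP => ok; rewrite ok in ke.
      by rewrite -(h2 k./2) ?/odds; [congr (w _); rewrite -[LHS]ke|lia].
    by rewrite -(h1 k./2) ?/evens; [congr (w _); rewrite -[LHS]ke|lia].
  split => k kN.
    have := H k.*2; rewrite odd_double doubleK; apply; lia.
  have := H k.*2.+1; rewrite /= odd_double /= uphalf_double; apply; lia.
have addE n' m' b' c' : p n' m' b' c' = (p n'.+1 m' (set_bit b' n' true) c' + p n'.+1 m' (set_bit b' n' false) c')%E.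
  rewrite /p coin_cyl_split preimage_setU setIUl measureU //; try exact: measurableI.
  by rewrite setIACA -preimage_setI coin_cyl_disjoint preimage_set0 set0I.
have addO n' m' b' c' : p n' m' b' c' = (p n' m'.+1 b' (set_bit c' m' true) + p n' m'.+1 b' (set_bit c' m' false))%E.
  rewrite /p (coin_cyl_split m' c') preimage_setU setIUr measureU //; try exact: measurableI.
  by rewrite setIACA setIid -preimage_setI coin_cyl_disjoint preimage_set0 setI0.
have stepE j N b' c' : (j <= N)%N -> p (N - j)%N N b' c' = (2^-1 ^+ (N - j) * 2^-1 ^+ N)%:E.
  elim: j b' => [|j IH] b' jN; first by rewrite subn0 diag.
  rewrite addE -subSn // subSS !IH ?(ltnW jN) // -EFinD; congr (_%:E).
  have -> : (N - j = (N - j.+1).+1)%N by lia.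
  by rewrite exprS; field.
have stepO j i N b' c' : (j <= N)%N -> (i <= N)%N ->
    p (N - j)%N (N - i)%N b' c' = (2^-1 ^+ (N - j) * 2^-1 ^+ (N - i))%:E.
  move=> jN; elim: i c' => [|i IH] c' iN; first by rewrite subn0 stepE.
  rewrite addO -subSn // subSS !IH ?(ltnW iN) // -EFinD; congr (_%:E).
  have -> : (N - i = (N - i.+1).+1)%N by lia.
  by rewrite [2^-1 ^+ _.+1]exprS; field.
have := stepO (maxn n m - n)%N (maxn n m - m)%N (maxn n m) b c (leq_subr _ _) (leq_subr _ _).
by rewrite !subKn ?leq_maxl ?leq_maxr.
Qed.

Let evensM : {mfun coins >-> coins} := mfun_Sub (mem_set measurable_evens).
Let oddsM : {mfun coins >-> coins} := mfun_Sub (mem_set measurable_odds).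

Let fin_pr A : measurable A -> P A \is a fin_num.
Proof. exact: fin_num_measure. Qed.

(** Uniqueness of measures is used twice: in [A] with a cylinder for the odd coins, then in [B] with
    [A] fixed. *)
Lemma split_independent A B : measurable A -> measurable B ->
  P (evens @^-1` A `&` odds @^-1` B) = (P A * P B)%E.
Proof.
move=> mA mB.
have step1 m c A' : measurable A' ->
    P (evens @^-1` A' `&` odds @^-1` coin_cyl m c) = (P A' * (2^-1 ^+ m)%:E)%E.
  move=> mA'; have mO : measurable (odds @^-1` coin_cyl m c).
    by apply: mpre; [exact: measurable_odds|exact: measurable_coin_cyl].
  have q0 : 0 <= 2^-1 ^+ m :> R by rewrite exprn_ge0.
  have := @coin_measure_unique (pushforward (mrestr P mO) evensM) (mscale (NngNum q0) P) _ _ A' mA'.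
  rewrite /pushforward /mrestr /mscale /= muleC; apply; first exact: measurable_evens.
    by apply: le_lt_trans (probability_le1 P _) (ltry _); rewrite ?preimage_setT ?setTI.
  by move=> n b; rewrite /pushforward /mrestr /mscale /= fair_split fairP -EFinM mulrC.
have mE : measurable (evens @^-1` A) by apply: mpre => //; exact: measurable_evens.
have [q q0 PAE] : exists2 q : R, 0 <= q & P A = q%:E.
  by exists (fine (P A)); rewrite ?fine_ge0 // fineK // fin_pr.
have := @coin_measure_unique (pushforward (mrestr P mE) oddsM) (mscale (NngNum q0) P) _ _ B mB.
rewrite /pushforward /mrestr /mscale /= setIC PAE; apply; first exact: measurable_odds.
  by apply: le_lt_trans (probability_le1 P _) (ltry _); rewrite ?preimage_setT ?setTI.
by move=> n b; rewrite /pushforward /mrestr /mscale /= setIC step1 // PAE fairP.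
Qed.

Let pairM_measurable : measurable_fun [set: coins] (fun w => (evens w, odds w)).
Proof. by apply: measurable_fun_pair; [exact: measurable_evens|exact: measurable_odds]. Qed.

Let pairM : {mfun coins >-> (coins * coins)%type} := mfun_Sub (mem_set pairM_measurable).

Lemma Ex_split (f g : coins -> R) : bm f -> bm g ->
  Ex P (fun w => f (evens w) * g (odds w)) = Ex P f * Ex P g.
Proof.
move=> bf bg.
have bF : bm (fun z : coins * coins => f z.1 * g z.2).
  apply: bmM.
    by case: bf => mf [M fM]; split; [exact: measurableT_comp|exists M => z].
  by case: bg => mg [M gM]; split; [exact: measurableT_comp|exists M => z].
have prodE X : measurable X -> (P \x P)%E X = pushforward P pairM X.
  apply: product_measure_unique => A B mA mB; rewrite /pushforward /=.
  by rewrite -split_independent.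
have iF : (P \x P)%E.-integrable setT (fun z : coins * coins => (f z.1 * g z.2)%:E).
  exact: (bm_integrable (P \x P)%E bF).
have iG : P.-integrable setT (fun w => (g w)%:E) by exact: bm_integrable.
have iFe : P.-integrable setT (fun w => (f w)%:E) by exact: bm_integrable.
have E1 : (\int[P]_w (f (evens w) * g (odds w))%:E = \int[pushforward P pairM]_z (f z.1 * g z.2)%:E)%E.
  rewrite integral_pushforward //; first by apply/measurable_EFinP; exact: bF.1.
  by apply: (bm_integrable P); split;
    [apply: (measurableT_comp bF.1 pairM_measurable)|case: bF => _ [M HM]; exists M => w; exact: HM].
have E2 : (\int[pushforward P pairM]_z (f z.1 * g z.2)%:E = \int[(P \x P)%E]_z (f z.1 * g z.2)%:E)%E.
  by apply: eq_measure_integral => A mA _; exact/esym/prodE.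
rewrite /Ex /Rintegral E1 E2 -integral12_prod_meas1 //.
have E3 x : (\int[P]_y ((f x * g y)%:E) = (f x * Ex P g)%:E)%E.
  under eq_integral do rewrite EFinM.
  by rewrite integralZl // EFinM fineK //; exact: integrable_fin_num.
transitivity (fine (\int[P]_x ((f x)%:E * (Ex P g)%:E))%E).
  congr fine; apply: eq_integral => x _; rewrite -EFinM -E3; exact: eq_integral.
by rewrite integralZr // fineM //; exact: integrable_fin_num.
Qed.

End coin_space.

Section fair_coins.
Context {R : realType}.
Implicit Types (x t u : R) (b : nat -> bool) (n k : nat).

(* [bit x] is the binary expansion of x in [0, 1[, read off the doubling map. *)
Definition dbl x : R := 2 * x - ((2^-1 : R) <= x)%R%:R.
Definition bit x k : bool := (2^-1 : R) <= iter k dbl x.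
Definition dyad n b : R := \sum_(k < n) (b k)%:R * 2^-1 ^+ k.+1.

Lemma measurable_dbl : measurable_fun [set: R] dbl.
Proof.
have mge : measurable_fun [set: R] (fun x => (2^-1 : R) <= x)%R by exact: measurable_fun_ler.
rewrite /dbl; apply: measurable_funB; first exact: measurable_funM.
rewrite [X in measurable_fun _ X](_ : _ = (fun x => if ((2^-1 : R) <= x)%R then 1 else 0)).
  exact: measurable_fun_ifT.
by apply/funext => x; case: ifP.
Qed.

Lemma measurable_iter_dbl k : measurable_fun [set: R] (fun x => iter k dbl x).
Proof. elim: k => [|k IH] //=; exact: (measurableT_comp measurable_dbl IH). Qed.

Lemma measurable_bit : measurable_fun [set: R] (bit : R -> coins).
Proof.
apply: measurable_to_coins => k y.
have mb : measurable_fun [set: R] (fun x => (2^-1 : R) <= iter k dbl x)%R.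
  by apply: measurable_fun_ler => //; exact: measurable_iter_dbl.
by have := mb measurableT [set y] I; rewrite setTI.
Qed.

Lemma dyad0 b : dyad 0 b = 0.
Proof. by rewrite /dyad big_ord0. Qed.

Lemma dyadSr n b : dyad n.+1 b = dyad n b + (b n)%:R * 2^-1 ^+ n.+1.
Proof. by rewrite /dyad big_ord_recr. Qed.

Lemma dyadS n b : dyad n.+1 b = (b 0%N)%:R / 2 + dyad n (fun k => b k.+1) / 2.
Proof.
rewrite /dyad big_ord_recl /= expr1 mulr_suml; congr (_ + _); apply: eq_bigr => k _.
by rewrite /bump /= add1n [2^-1 ^+ k.+2]exprSr mulrA.
Qed.

Lemma dyad_ge0 n b : 0 <= dyad n b.
Proof. by apply: sumr_ge0 => k _; rewrite mulr_ge0 ?exprn_ge0 ?invr_ge0. Qed.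

Lemma dyad_le n b : dyad n b + 2^-1 ^+ n <= 1.
Proof.
elim: n b => [|n IH] b; first by rewrite dyad0 expr0 add0r.
rewrite dyadS exprS; have := IH (fun k => b k.+1).
by case: (b 0%N) => /=; lra.
Qed.

Lemma dyad_bit n x : x = dyad n (bit x) + 2^-1 ^+ n * iter n dbl x.
Proof.
elim: n => [|n IH]; first by rewrite dyad0 expr0 mul1r add0r.
rewrite {1}IH dyadSr iterS [in RHS]/dbl -/(bit x n) exprS; by field.
Qed.

Lemma dbl_itv x : 0 <= x < 1 -> 0 <= dbl x < 1.
Proof. by move=> /andP[x0 x1]; rewrite /dbl; case: (lerP 2^-1 x) => h /=; apply/andP; split; lra. Qed.

Lemma iter_dbl_itv n x : 0 <= x < 1 -> 0 <= iter n dbl x < 1.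
Proof. by move=> x01; elim: n => //= n IH; exact: dbl_itv. Qed.

Lemma bit_dyadic n b x : 0 <= x < 1 ->
  (forall k, (k < n)%N -> bit x k = b k) <-> dyad n b <= x < dyad n b + 2^-1 ^+ n.
Proof.
move=> x01; split => [H|].
  have <- : dyad n (bit x) = dyad n b by apply: eq_bigr => k _; rewrite H.
  have /andP[i0 i1] := iter_dbl_itv n x01; have p0 : 0 < 2^-1 ^+ n :> R by rewrite exprn_gt0.
  have xE := dyad_bit n x; apply/andP; split.
    by rewrite [leRHS]xE lerDl mulr_ge0 // ltW.
  by rewrite [ltLHS]xE ltrD2l gtr_pMr.
elim: n b x x01 => [|n IH] b x x01 //.
have /andP[x0 x1] := x01.
rewrite dyadS exprS => /andP[h1 h2].
have d0 := dyad_ge0 n (fun k => b k.+1); have d1 := dyad_le n (fun k => b k.+1).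
have b0 : bit x 0 = b 0%N.
  rewrite /bit /=; case: (b 0%N) h1 h2 => /= h1 h2; first by lra.
  by apply/negbTE; rewrite -ltNge; lra.
have I : dyad n (fun k => b k.+1) <= dbl x < dyad n (fun k => b k.+1) + 2^-1 ^+ n.
  rewrite /dbl -[((2^-1 : R) <= x)%R]/(bit x 0) b0.
  by case: (b 0%N) h1 h2 => /= h1 h2; apply/andP; split; lra.
move=> [|k] kn //; have := IH _ _ (dbl_itv x01) I k kn.
by rewrite /bit iterSr.
Qed.

Let m01 : measurable (`[0, 1[%classic : set R). Proof. exact: measurable_itv. Qed.

Definition unit_lebesgue : set R -> \bar R := mrestr (@lebesgue_measure R) m01.
HB.instance Definition _ := isMeasure.Build _ _ _ unit_lebesgue
  (measure0 (mrestr lebesgue_measure m01)) (measure_ge0 (mrestr lebesgue_measure m01))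
  (@measure_semi_sigma_additive _ _ _ (mrestr lebesgue_measure m01)).

Lemma unit_lebesgueT : unit_lebesgue setT = 1%E.
Proof. by rewrite /unit_lebesgue /mrestr setTI lebesgue_measure_itv /= lte_fin ltr01 oppr0 adde0. Qed.

HB.instance Definition _ := Measure_isProbability.Build _ _ R unit_lebesgue unit_lebesgueT.

Lemma unit_lebesgue_itv x y (b1 : bool) : 0 <= x -> x <= y -> y <= 1 ->
  unit_lebesgue ([set` Interval (BSide b1 x) (BSide true y)]) = (y - x)%:E.
Proof.
move=> x0 xy y1; rewrite /unit_lebesgue /mrestr setIidl.
  rewrite lebesgue_measure_itv /= lte_fin; case: ltP => // yx.
  by have -> : x = y; [apply/le_anti; rewrite xy|rewrite subrr].
  move=> z /=; rewrite !in_itv /= => /andP[h1 h2]; apply/andP; split.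
  by apply: le_trans x0 _; case: b1 h1 => //=; exact: ltW.
exact: lt_le_trans h2 y1.
Qed.

Lemma dyad_bit_cvg x : 0 <= x < 1 -> dyad n (bit x) @[n --> \oo] --> x.
Proof.
move=> x01; apply/cvgrPdist_le => e e0.
have /cvgrPdist_le/(_ e e0) : (fun n => 2^-1 ^+ n : R) @ \oo --> (0 : R).
  by apply: cvg_expr; rewrite ger0_norm ?invr_ge0 //; lra.
apply: filterS => n; rewrite sub0r normrN ger0_norm ?exprn_ge0 ?invr_ge0 // => ne.
rewrite {1}(dyad_bit n x) addrC addKr.
have /andP[i0 i1] := iter_dbl_itv n x01.
have p0 : 0 < 2^-1 ^+ n :> R by rewrite exprn_gt0.
rewrite ger0_norm; last by rewrite mulr_ge0 // ltW.
by apply: le_trans ne; rewrite ger_pMr // ltW.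
Qed.

Lemma fair_coins_exist : exists (P : probability coins R) (U : coins -> R),
  [/\ measurable_fun setT U,
      forall n b, P (coin_cyl n b) = (2^-1 ^+ n)%:E &
      forall A, measurable A -> P (U @^-1` A) = unit_lebesgue A].
Proof.
pose bitM : {mfun R >-> coins} := mfun_Sub (mem_set measurable_bit).
(* An upper limit of measurable functions is measurable outright; at the digits of a point of [0, 1[
   it returns the point, so [U] is uniform. *)
pose U (w : coins) : R := limn_sup (fun n => dyad n w).
have mU : measurable_fun setT U.
  apply: measurable_fun_limn_sup.
  - move=> w _; exists 1 => _ [n _ <-].
    by apply: le_trans (dyad_le n w); rewrite lerDl exprn_ge0 // invr_ge0.
  - by move=> w _; exists 0 => _ [n _ <-]; exact: dyad_ge0.
  move=> n; rewrite /dyad; apply: measurable_sum => k; apply: measurable_funM => //.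
  rewrite [X in measurable_fun _ X](_ : _ = (\1_[set w : coins | w k = true] : coins -> R)).
    by apply: measurable_indic; exact: measurable_coin.
  apply/funext => w; rewrite indicE; case: (boolP (w k)) => wk.
    by rewrite mem_set.
  by rewrite memNset //=; apply/negP.
exists (distribution (unit_lebesgue : probability _ _) bitM), U; split => // [n b|A mA].
  rewrite /distribution /pushforward /= /unit_lebesgue /mrestr.
  have -> : bit @^-1` coin_cyl n b `&` `[0, 1[ = `[dyad n b, dyad n b + 2^-1 ^+ n[%classic.
    apply/seteqP; split => x /=; rewrite !in_itv /=.
      by move=> [H x01]; apply/(bit_dyadic n b x01).
    move=> H; have x01 : 0 <= x < 1.
      have := dyad_ge0 n b; have := dyad_le n b; case/andP: H => h1 h2 h3 h4.
      by rewrite (le_trans h4 h1) (lt_le_trans h2 h3).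
    by split => //; apply/(bit_dyadic n b x01).
  rewrite lebesgue_measure_itv /= lte_fin ltrDl exprn_gt0 // -EFinD.
  by congr (_%:E); ring.
rewrite /distribution /pushforward /= /unit_lebesgue /mrestr; congr (lebesgue_measure _).
apply/seteqP; split => x /= [Ax x01]; split => //; move: Ax; rewrite /U.
  by have [_ ->] := cvg_limn_inf_sup (dyad_bit_cvg x01).
by have [_ ->] := cvg_limn_inf_sup (dyad_bit_cvg x01).
Qed.

End fair_coins.

(** * Quantile transform and independent standard normal variables *)

Section quantile.
Context {R : realType} (P : probability coins R) (U : coins -> R).
Hypothesis mU : measurable_fun setT U.
Hypothesis UP : forall A, measurable A -> P (U @^-1` A) = unit_lebesgue A.
Variable N : probability R R.

Let idM : {mfun R >-> R} := mfun_Sub (mem_set (@measurable_id _ _ setT)).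
Let F (t : R) : R := fine (N `]-oo, t]%classic).

Let FE t : (F t)%:E = cdf (idM : {RV N >-> R}) t.
Proof. by rewrite /F fineK ?fin_num_measure //; exact: measurable_itv. Qed.

Let F0 t : 0 <= F t. Proof. by rewrite /F fine_ge0. Qed.

Let F1 t : F t <= 1.
Proof. by rewrite -lee_fin FE; exact: cdf_le1. Qed.

Let F_mono t t' : t <= t' -> F t <= F t'.
Proof. by move=> tt; rewrite -lee_fin !FE; exact: cdf_nondecreasing. Qed.

Let Q (u : R) : R := inf [set x | u <= F x].

(** Right continuity of the distribution function makes this an exact equivalence of strict
    inequalities. *)
Let Q_gt u t : 0 < u < 1 -> (t < Q u) = (F t < u).
Proof.
move=> /andP[u0 u1].
have [y Fy] : exists y, u <= F y.
  have /fine_cvg /cvgrPdist_lt /(_ (1 - u)) := cvg_cdfy1 (idM : {RV N >-> R}).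
  rewrite subr_gt0 => /(_ u1) [M [_ HM]]; exists (M + 1).
  have := HM (M + 1); rewrite /= -FE /= ltrDl ltr01 => /(_ isT).
  by move=> /ltr_normlW; lra.
have [z Fz] : exists z, F z < u.
  have /fine_cvg /cvgrPdist_lt /(_ u u0) [M [_ HM]] := cvg_cdfNy0 (idM : {RV N >-> R}).
  exists (M - 1); have := HM (M - 1); rewrite /= -FE /= ltrBlDr ltrDl ltr01 => /(_ isT).
  by rewrite sub0r normrN => /ltr_normlW.
have lb : has_lbound [set x | u <= F x].
  exists z => x /= ux; rewrite leNgt; apply/negP => /ltW /F_mono; lra.
have nE : [set x | u <= F x] !=set0 by exists y.
apply/idP/idP => [tQ|Ftu].
  rewrite ltNge; apply/negP => uF; move: tQ; rewrite ltNge => /negP; apply.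
  by apply: ge_inf.
have [e e0 He] : exists2 e, 0 < e & F (t + e) < u.
  have := @cdf_right_continuous _ _ _ N idM t.
  rewrite -FE => /fine_cvg /cvgrPdist_lt /(_ (u - F t)); rewrite subr_gt0 => /(_ Ftu) [e /= e0 He].
  exists (e / 2); first by rewrite divr_gt0.
  have h1 : e / 2 < e by lra.
  have h2 : t < t + e / 2 by rewrite ltrDl divr_gt0.
  have := He (t + e / 2); rewrite /= -FE /= opprD addNKr normrN ger0_norm ?divr_ge0 ?(ltW e0) //.
  by move=> /(_ h1 h2); rewrite distrC => /ltr_normlW; lra.
apply: (@lt_le_trans _ _ (t + e)); first by rewrite ltrDl.
apply: lb_le_inf => // x /= ux; rewrite leNgt; apply/negP => /ltW /F_mono; lra.
Qed.

Lemma quantile_transform : exists2 G : coins -> R, measurable_fun setT G &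
  forall A : set R, measurable A -> P (G @^-1` A) = N A.
Proof.
pose G w := if 0 < U w < 1 then Q (U w) else 0.
have mI : measurable (`]0, 1[%classic : set R) by exact: measurable_itv.
have mUA (A : set R) : measurable A -> measurable (U @^-1` A).
  by move=> mA; rewrite -[X in measurable X]setTI; exact: mU.
(* The null set [Z] absorbs the event that [U] leaves ]0, 1[, where [G] has the default value 0. *)
have GE t : exists2 Z, measurable Z /\ P Z = 0%E &
    G @^-1` `]t, +oo[%classic = U @^-1` `]F t, 1[%classic `|` Z.
  exists (if t < 0 then U @^-1` (~` `]0, 1[%classic) else set0).
    case: ifP => _; last by rewrite measure0.
    split; first by apply: mUA; exact: measurableC.
    rewrite UP; last exact: measurableC.
    transitivity (1 - @unit_lebesgue R `]0%R, 1%R[%classic)%E; first exact: probability_setC.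
    by rewrite unit_lebesgue_itv // subr0 subee.
  apply/seteqP; split => w /=; rewrite /G !in_itv /= ?andbT.
    case: ifP => uw; first by rewrite Q_gt // => h; left; rewrite h; case/andP: uw.
    by move=> t0; right; rewrite t0 /= in_itv /= uw.
  case=> [/andP[h1 h2]|].
    have uw : 0 < U w < 1 by rewrite h2 (le_lt_trans (F0 t) h1).
    by rewrite uw Q_gt.
  by case: ifP => //= t0; rewrite in_itv /= => /negP /negbTE ->.
have mG : measurable_fun setT G.
  move=> mT; apply: (measurability _ (RGenOInfty.measurableE R)) => //.
  move=> _ [_ [x ->] <-]; rewrite setTI; have [Z [mZ _] ->] := GE x.
  by apply: measurableU => //; apply: mUA; exact: measurable_itv.
exists G => // A mA.
pose GM : {mfun coins >-> R} := mfun_Sub (mem_set mG).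
suff : distribution P GM A = N A by [].
have half t : distribution P GM `]t, +oo[%classic = N `]t, +oo[%classic.
  rewrite /distribution /pushforward /=; have [Z [mZ Z0] ->] := GE t.
  have mF : measurable (`]F t, 1[%classic : set R) by exact: measurable_itv.
  transitivity (P (U @^-1` `]F t, 1[%classic)); first by apply: measureU0 => //; exact: mUA.
  rewrite UP // unit_lebesgue_itv // EFinB FE.
  have -> : (`]t, +oo[%classic : set R) = ~` `]-oo, t]%classic by rewrite setCitvl.
  by apply/esym; apply: probability_setC; exact: measurable_itv.
apply: (measure_unique (@RGenOInfty.G R) (fun n => `]- n%:R, +oo[%classic) (RGenOInfty.measurableE R)) mA.
- move=> _ _ [x ->] [y ->]; exists (Num.max x y).
  by apply/seteqP; split => z /=; rewrite !in_itv /= !andbT gt_max => /andP.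
- by move=> n; exists (- n%:R).
- apply/seteqP; split => // x _; exists (Num.bound `|x|) => //=.
  by rewrite in_itv /= andbT ltrNl (le_lt_trans _ (archi_boundP (normr_ge0 x))) // -normrN ler_norm.
- by move=> _ [x ->]; exact: half.
- by move=> n; apply: le_lt_trans (probability_le1 _ _) (ltry _); exact: measurable_itv.
Qed.

End quantile.

Section gaussian_sequence.
Context {R : realType}.

Lemma Ex_law dT (T : measurableType dT) (P : probability T R) (N : probability R R)
    (G : T -> R) (f : R -> R) : measurable_fun setT G ->
  (forall A : set R, measurable A -> P (G @^-1` A) = N A) ->
  bm f -> Ex P (f \o G) = Ex N f.
Proof.
move=> mG GN bf; pose GM : {mfun T >-> R} := mfun_Sub (mem_set mG).
rewrite /Ex /Rintegral; congr fine.
transitivity (\int[pushforward P GM]_x (f x)%:E)%E; last first.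
  by apply: eq_measure_integral => A mA _; exact: GN.
rewrite integral_pushforward //; first by apply/measurable_EFinP; exact: bf.1.
apply: (bm_integrable P (f := f \o G)); split; first exact: (measurableT_comp bf.1 mG).
by case: bf => _ [M HM]; exists M => w; exact: HM.
Qed.

Lemma gaussian_sequence : exists (P : probability coins R) (xi : nat -> coins -> R),
  (forall k, measurable_fun setT (xi k)) /\
  forall n (c : nat -> R) (phi : R),
    Ex P (fun w => cos (\sum_(k < n) c k * xi k w + phi))
    = cos phi * expR (- ((\sum_(k < n) c k ^+ 2) / 2)).
Proof.
have [P [U [mU fairP UP]]] := @fair_coins_exist R.
have mid : @measurable_fun _ _ (measurableTypeR R) R setT idfun by move=> _ A mA; rewrite setTI.
pose idM : {mfun measurableTypeR R >-> R} := @mfun_Sub _ _ (measurableTypeR R) R idfun (mem_set mid).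
pose N : probability R R := distribution (normal_prob 0 1 : probability (measurableTypeR R) R) idM.
have [G mG GP] := quantile_transform mU UP N.
(* The variables read disjoint sets of coins. In the induction the even coins carry the first
   variable and the odd coins all others. *)
pose xi k w := G (evens (iter k odds w)).
have mxi k : measurable_fun setT (xi k).
  apply: (measurableT_comp mG); apply: (measurableT_comp measurable_evens).
  elim: k => [|k IH]; first exact: measurable_id.
  exact: (measurableT_comp measurable_odds IH).
exists P, xi; split => // n; elim: n => [|n IH] c phi.
  under [X in Ex P X]eq_fun do rewrite big_ord0 add0r.
  by rewrite Ex_cst big_ord0 mul0r oppr0 expR0 mulr1.
pose S c' w := \sum_(k < n) c' k * xi k w : R.
pose c1 k := c k.+1.
have mS c' : measurable_fun setT (S c').
  by apply: measurable_sum => k; exact: measurable_funM.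
have bc ph (Y : coins -> R) : measurable_fun setT Y -> bm (fun w => cos (Y w + ph)).
  move=> mY; apply: (bm_comp (h := cos) (M := 1)); [exact: continuous_cos|exact: cos_max|].
  exact: measurable_funD.
have bs ph (Y : coins -> R) : measurable_fun setT Y -> bm (fun w => sin (Y w + ph)).
  move=> mY; apply: (bm_comp (h := sin) (M := 1)); [exact: continuous_sin|exact: sin_max|].
  exact: measurable_funD.
have E1 w : cos (\sum_(k < n.+1) c k * xi k w + phi) =
    cos (c 0%N * G (evens w) + 0) * cos (S c1 (odds w) + phi)
    - sin (c 0%N * G (evens w) + 0) * sin (S c1 (odds w) + phi).
  rewrite addr0 -cosD big_ord_recl addrA; congr (cos (_ + _ + _)).
  by apply: eq_bigr => k _; rewrite /xi /= -iterSr.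
under [X in Ex P X]eq_fun do rewrite E1.
have mcG t : measurable_fun setT (fun w => t * G w) by exact: measurable_funM.
have bcG t ph : bm (fun x : R => cos (t * x + ph)).
  apply: (bm_comp (h := cos) (M := 1)); [exact: continuous_cos|exact: cos_max|].
  by apply: measurable_funD => //; exact: measurable_funM.
have EG t ph : Ex P (fun w => cos (t * G w + ph)) = cos ph * expR (- (t ^+ 2 / 2)).
  rewrite -[t ^+ 2]mulr1 -[X in t ^+ 2 * X](expr1n _ 2) -(normal_charfun _ _ ltr01).
  have -> : Ex (normal_prob 0 1) (fun x => cos (t * x + ph)) = Ex N (fun x => cos (t * x + ph)).
    exact: (Ex_law (P := (normal_prob 0 1 : probability (measurableTypeR R) R)) mid _ (bcG t ph)).
  exact: (Ex_law mG GP (bcG t ph)).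
have mce : measurable_fun setT (fun w => c 0%N * G (evens w)).
  exact: (measurableT_comp (mcG _) measurable_evens).
have mSo : measurable_fun setT (fun w => S c1 (odds w)).
  exact: (measurableT_comp (mS _) measurable_odds).
rewrite (ExB _ (bmM (bc 0 _ mce) (bc phi _ mSo)) (bmM (bs 0 _ mce) (bs phi _ mSo))).
rewrite (Ex_split fairP (f := fun w => cos (c 0%N * G w + 0)) (g := fun w => cos (S c1 w + phi))); [|exact: bc|exact: bc].
rewrite (Ex_split fairP (f := fun w => sin (c 0%N * G w + 0)) (g := fun w => sin (S c1 w + phi))); [|exact: bs|exact: bs].
rewrite EG cos0 mul1r IH.
have -> : Ex P (fun w => sin (c 0%N * G w + 0)) = 0.
  under [X in Ex P X]eq_fun do rewrite addr0 -cosBpihalf.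
  by rewrite EG cosN cos_pihalf mul0r.
rewrite mul0r subr0 mulrCA -expRD big_ord_recl /c1 /=; congr (_ * expR _).
by rewrite mulrDl opprD.
Qed.

End gaussian_sequence.

(** * Schur complements and Gaussian families with given covariance *)

Section cholesky.
Context {R : realType}.
Implicit Types (S G : nat -> nat -> R) (l : seq (R * nat)) (i j k : nat).

Definition qform S l : R := \sum_(p <- l) \sum_(q <- l) p.1 * q.1 * S p.2 q.2.
Definition psd S := (forall i j, S i j = S j i) /\ forall l, 0 <= qform S l.

(* When S k k = 0 the quotient is 0 in Rocq, which is harmless: row k then
   vanishes, by psd_zero_diag. *)
Definition schur S k i j : R := S i j - S i k * S j k / S k k.

Lemma qform_cons S l c k : (forall i j, S i j = S j i) ->
  qform S ((c, k) :: l) = c ^+ 2 * S k k + 2 * c * (\sum_(p <- l) p.1 * S p.2 k) + qform S l.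
Proof.
move=> sS; rewrite /qform big_cons big_cons /=.
under [X in _ + X]eq_bigr do rewrite big_cons /=.
rewrite big_split /= addrA; congr (_ + _); rewrite -expr2 -addrA; congr (_ + _).
rewrite !mulr_sumr -big_split; apply: eq_bigr => p _ /=.
by rewrite (sS k p.2); ring.
Qed.

Lemma psd_diag S k : psd S -> 0 <= S k k.
Proof.
move=> [sS /(_ [:: (1, k)])]; rewrite qform_cons // /qform !big_nil mulr0 !addr0.
by rewrite expr1n mul1r.
Qed.

Lemma psd_zero_diag S k i : psd S -> S k k = 0 -> S i k = 0.
Proof.
move=> pS k0; have [sS HS] := pS; apply/eqP/contraT => nz.
(* With a zero pivot the form is affine in the first coefficient; this choice gives it the value
   -1. *)
have := HS [:: (- (S i i + 1) / (2 * S i k), k); (1, i)].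
rewrite qform_cons // k0 qform_cons // /qform !big_cons !big_nil /= .
have -> : 2 * (- (S i i + 1) / (2 * S i k)) * (1 * S i k + 0) = - (S i i + 1) by field.
by lra.
Qed.

Lemma qform_schur S k l : (forall i j, S i j = S j i) ->
  qform (schur S k) l = qform S l - (\sum_(p <- l) p.1 * S p.2 k) ^+ 2 / S k k.
Proof.
move=> sS; rewrite /qform /schur expr2 mulr_suml mulr_suml -sumrB; apply: eq_bigr => p _.
rewrite mulr_sumr mulr_suml -sumrB; apply: eq_bigr => q _; ring.
Qed.

Lemma psd_schur S k : psd S -> psd (schur S k).
Proof.
move=> pS; have [sS HS] := pS; split=> [i j|l]; first by rewrite /schur sS; ring.
rewrite qform_schur //; set L := \sum_(p <- l) _.
have [k0|kn0] := eqVneq (S k k) 0; first by rewrite k0 invr0 mulr0 subr0.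
(* The coefficient that minimises the form over multiples of the k-th vector. *)
have := HS ((- L / S k k, k) :: l); rewrite qform_cons // -/L.
by have -> : (- L / S k k) ^+ 2 * S k k + 2 * (- L / S k k) * L + qform S l
  = qform S l - L ^+ 2 / S k k by field.
Qed.

Fixpoint schurs G k : nat -> nat -> R :=
  if k is k'.+1 then schur (schurs G k') k' else G.

Definition chol G i k : R := schurs G k i k / Num.sqrt (schurs G k k k).

Variable G : nat -> nat -> R.
Hypothesis pG : psd G.

Lemma psd_schurs k : psd (schurs G k).
Proof. by elim: k => //= k IH; exact: psd_schur. Qed.

(** Each elimination annihilates its own row and keeps the rows that already vanish; a zero pivot is
    covered by [psd_zero_diag]. *)
Lemma schurs_eq0 k i j : (i < k)%N -> schurs G k i j = 0.
Proof.
elim: k i j => // k IH i j; rewrite ltnS leq_eqVlt => /orP[/eqP ->|ik] /=; last first.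
  by rewrite /schur !(IH i) // !mul0r subr0.
have pS := psd_schurs k; have sS := pS.1; rewrite /schur (sS k j).
have [k0|kn0] := eqVneq (schurs G k k k) 0; last by field.
by rewrite (psd_zero_diag j pS k0) mulr0 mul0r subr0.
Qed.

Lemma chol_eq0 i k : (i < k)%N -> chol G i k = 0.
Proof. by move=> ik; rewrite /chol schurs_eq0 // mul0r. Qed.

Lemma schurs_sum n i j : G i j = schurs G n i j + \sum_(k < n) chol G i k * chol G j k.
Proof.
elim: n => [|n IH]; first by rewrite big_ord0 addr0.
rewrite {1}IH big_ord_recr /= addrA addrAC; congr (_ + _).
rewrite /schur /chol mulrACA -invfM -expr2 sqr_sqrtr ?subrK //.
exact/psd_diag/psd_schurs.
Qed.

Lemma chol_mul n i j : (i < n)%N -> \sum_(k < n) chol G i k * chol G j k = G i j.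
Proof. by move=> im; rewrite (schurs_sum n) schurs_eq0 // add0r. Qed.

Lemma gaussian_family : exists (P : probability coins R) (Y : nat -> coins -> R),
  (forall m, measurable_fun setT (Y m)) /\
  forall n (m : 'I_n -> nat) (c : 'I_n -> R) (phi : R),
    Ex P (fun w => cos (\sum_i c i * Y (m i) w + phi))
    = cos phi * expR (- ((\sum_i \sum_j c i * c j * G (m i) (m j)) / 2)).
Proof.
have [P [xi [mxi H]]] := @gaussian_sequence R.
exists P, (fun m w => \sum_(k < m.+1) chol G m k * xi k w); split => [m|n m c phi].
  by apply: measurable_sum => k; exact: measurable_funM.
(* The factor is triangular, so all the sums extend by zeros to this common range. *)
pose N := (\max_i m i).+1.
have mN (i : 'I_n) : (m i < N)%N by rewrite ltnS; exact: (leq_bigmax i).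
have YE (i : 'I_n) w : \sum_(k < (m i).+1) chol G (m i) k * xi k w = \sum_(k < N) chol G (m i) k * xi k w.
  rewrite (big_ord_widen N (fun k => chol G (m i) k * xi k w)) // big_mkcond /=.
  apply: eq_bigr => k _; case: ifP => // /negbT; rewrite -leqNgt => ik.
  by rewrite chol_eq0 ?mul0r.
have E1 w : \sum_i c i * (\sum_(k < (m i).+1) chol G (m i) k * xi k w)
    = \sum_(k < N) (\sum_i c i * chol G (m i) k) * xi k w.
  under eq_bigr do rewrite YE mulr_sumr.
  rewrite exchange_big /=; apply: eq_bigr => k _; rewrite mulr_suml.
  by apply: eq_bigr => i _; rewrite mulrA.
under [X in Ex P X]eq_fun do rewrite E1.
rewrite (H N (fun k => \sum_i c i * chol G (m i) k)); congr (_ * expR (- (_ / 2))).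
under eq_bigr do rewrite expr2 mulr_suml.
rewrite exchange_big /=; apply: eq_bigr => i _.
under eq_bigr do rewrite mulr_sumr.
rewrite exchange_big /=; apply: eq_bigr => j _.
rewrite -(chol_mul (n := N) _ (mN i)) mulr_sumr; apply: eq_bigr => k _; ring.
Qed.

End cholesky.

(** * The limit process *)

Section gaussian_variable.
Context {R : realType} dT {T : measurableType dT} (P : probability T R).

(** The phase captures cosine and sine transforms at once, and v = 0 covers the degenerate law. *)
Definition gaussian_charfun (Z : T -> R) (v : R) := measurable_fun setT Z /\
  forall t phi, Ex P (fun w => cos (t * Z w + phi)) = cos phi * expR (- (t ^+ 2 * v / 2)).

Variables (Z : T -> R) (v : R).
Hypothesis gZ : gaussian_charfun Z v.

Let mZ : measurable_fun setT Z. Proof. by case: gZ. Qed.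
Let HZ t phi : Ex P (fun w => cos (t * Z w + phi)) = cos phi * expR (- (t ^+ 2 * v / 2)).
Proof. by case: gZ. Qed.

Let mtZ t phi : measurable_fun setT (fun w => t * Z w + phi).
Proof. by apply: measurable_funD => //; exact: measurable_funM. Qed.

Let bcos t phi : bm (fun w => cos (t * Z w + phi)).
Proof. by apply: (bm_comp (h := cos) (M := 1)) (mtZ t phi); [exact: continuous_cos|exact: cos_max]. Qed.

Lemma gaussian_variance_ge0 : 0 <= v.
Proof.
have := Ex_norm_le P (bcos 1 0) (M := 1) (fun w => cos_max _).
rewrite HZ cos0 mul1r expr1n mul1r ger0_norm ?expR_ge0 // -[leRHS]expR0 ler_expR; lra.
Qed.

(* This truncation of x ^+ 2 tends to it as t tends to 0, and its expectation is
   given by the characteristic function. *)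
Let phi_ t (x : R) : R := 2 / t ^+ 2 * (1 - cos (t * x + 0)).

Let bphi t : bm (fun w => phi_ t (Z w)).
Proof. by apply: bmZ; apply: bmB; [exact: bm_cst|exact: bcos]. Qed.

Let Ex_phi t : Ex P (fun w => phi_ t (Z w)) = 2 / t ^+ 2 * (1 - expR (- (t ^+ 2 * v / 2))).
Proof.
rewrite /phi_ ExZ; last by apply: bmB; [exact: bm_cst|exact: bcos].
by rewrite ExB ?Ex_cst ?HZ ?cos0 ?mul1r //; exact: bm_cst.
Qed.

Let t_ n : R := n.+1%:R^-1.
Let t0 n : 0 < t_ n. Proof. by rewrite invr_gt0. Qed.

Let quad_cvg (c l : R) (u : nat -> R) : (forall n, `|u n - l| <= c * t_ n ^+ 2) -> u @ \oo --> l.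
Proof.
move=> H; apply/cvgrPdist_le => e e0.
have h0 : (fun n => c * t_ n ^+ 2) @ \oo --> (0 : R).
  have -> : 0 = c * 0 ^+ 2 :> R by rewrite expr0n mulr0.
  apply: cvgMr; apply: (cvg_comp t_ (fun x => x ^+ 2)); first exact: cvg_harmonic.
  exact: exprn_continuous.
have /cvgrPdist_le/(_ e e0) := h0; apply: filterS => n.
rewrite sub0r normrN distrC => hn; apply: le_trans (H n) (le_trans _ hn); exact: ler_norm.
Qed.

Let Ex_phi_cvg : (fun n => Ex P (fun w => phi_ (t_ n) (Z w))) @ \oo --> v.
Proof.
apply: (@quad_cvg (v ^+ 2 / 2)) => n; rewrite Ex_phi.
have tn := t0 n; have v0 := gaussian_variance_ge0; set t := t_ n in tn *.
have u0 : 0 <= t ^+ 2 * v / 2 by rewrite divr_ge0 // mulr_ge0 // sqr_ge0.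
have := expRN_taylor u0; set e := expR _ => H.
have -> : 2 / t ^+ 2 * (1 - e) - v = - (2 / t ^+ 2 * (e - (1 - t ^+ 2 * v / 2))) by field; rewrite gt_eqF.
have p0 : 0 <= 2 / t ^+ 2 by rewrite divr_ge0 // sqr_ge0.
rewrite normrN normrM (ger0_norm p0); apply: le_trans (ler_wpM2l p0 H) _.
rewrite le_eqVlt; apply/orP; left; apply/eqP; field; by rewrite gt_eqF.
Qed.

Let phi_cvg x : (fun n => phi_ (t_ n) x) @ \oo --> x ^+ 2.
Proof.
apply: (@quad_cvg (2 * `|x| ^+ 4)) => n; rewrite /phi_ addr0.
have tn := t0 n; set t := t_ n in tn *.
have := cos_taylor (t * x); set c := cos _ => H.
have -> : 2 / t ^+ 2 * (1 - c) - x ^+ 2 = - (2 / t ^+ 2 * (c - 1 + (t * x) ^+ 2 / 2)) by field; rewrite gt_eqF.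
have p0 : 0 <= 2 / t ^+ 2 by rewrite divr_ge0 // sqr_ge0.
rewrite normrN normrM (ger0_norm p0); apply: le_trans (ler_wpM2l p0 H) _.
rewrite normrM (gtr0_norm tn) exprMn.
rewrite le_eqVlt; apply/orP; left; apply/eqP; field; by rewrite gt_eqF.
Qed.

Let phi_ge0 t x : 0 <= phi_ t x.
Proof. by rewrite mulr_ge0 ?divr_ge0 ?sqr_ge0 // subr_ge0 cos_le1. Qed.

Let phi_le t x : 0 < t -> phi_ t x <= x ^+ 2.
Proof.
move=> tp; rewrite /phi_ addr0.
have E : 1 - cos (t * x) = 2 * sin (t * x / 2) ^+ 2.
  have {1}-> : t * x = t * x / 2 + t * x / 2 by field.
  by rewrite cosD -!expr2; have := cos2Dsin2 (t * x / 2); lra.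
have H : sin (t * x / 2) ^+ 2 <= (t * x / 2) ^+ 2.
  have h : `|sin (t * x / 2)| <= `|t * x / 2|.
    by have := sin_lipschitz (t * x / 2) 0; rewrite sin0 !subr0.
  rewrite -(real_normK (num_real (sin _))) -(real_normK (num_real (t * x / 2))).
  by rewrite lerXn2r ?nnegrE.
rewrite E; have p0 : 0 <= 2 / t ^+ 2 by rewrite divr_ge0 // sqr_ge0.
apply: le_trans (ler_wpM2l p0 (ler_wpM2l (ler0n _ 2) H)) _.
rewrite le_eqVlt; apply/orP; left; apply/eqP; field; by rewrite gt_eqF.
Qed.

Let EFin_phi t : (\int[P]_w (phi_ t (Z w))%:E = (Ex P (fun w => phi_ t (Z w)))%:E)%E.
Proof. by rewrite /Ex /Rintegral fineK //; apply: integrable_fin_num => //; exact: (bm_integrable P (bphi t)). Qed.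

Let EFin_lim (u : nat -> R) l : u @ \oo --> l -> limn_einf (fun n => (u n)%:E) = l%:E.
Proof.
move=> ul; have H : (fun n => (u n)%:E) @ \oo --> l%:E by apply: cvg_EFin => //; exact: nearW.
by have [-> _] := cvg_limn_einf_sup H.
Qed.

(** Fatou's lemma along the truncations gives one inequality; the other holds because each
    truncation is below the square. *)
Lemma gaussian_second_moment : (\int[P]_w (Z w ^+ 2)%:E = v%:E)%E.
Proof.
have mphi n : measurable_fun setT (fun w => (phi_ (t_ n) (Z w))%:E).
  by apply/measurable_EFinP; exact: (bphi _).1.
have mZ2 : measurable_fun setT (fun w => (Z w ^+ 2)%:E).
  by apply/measurable_EFinP; exact: measurable_funX.
apply/le_anti/andP; split.
  have p0 n w : [set: T] w -> (0 <= (phi_ (t_ n) (Z w))%:E)%E by rewrite lee_fin.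
  have := fatou P measurableT mphi p0.
  under eq_integral => w _ do rewrite (EFin_lim (@phi_cvg (Z w))).
  by under [X in (_ <= limn_einf X)%E]eq_fun do rewrite EFin_phi; rewrite (EFin_lim Ex_phi_cvg).
have H : (fun n => (Ex P (fun w => phi_ (t_ n) (Z w)))%:E) @ \oo --> v%:E.
  by apply: cvg_EFin; [exact: nearW|exact: Ex_phi_cvg].
apply: (cvge_le _ H); apply: nearW => n; rewrite -EFin_phi; apply: ge0_le_integral => //.
- by move=> w _; rewrite lee_fin.
- by move=> w _; rewrite lee_fin phi_le.
Qed.

Lemma gaussian_sqr_integrable : P.-integrable setT (fun w => (Z w ^+ 2)%:E).
Proof.
apply/integrableP; split; first by apply/measurable_EFinP; exact: measurable_funX.
under eq_integral do rewrite gee0_abs ?lee_fin ?sqr_ge0 //.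
by rewrite gaussian_second_moment ltry.
Qed.

Lemma gaussian_integrable : P.-integrable setT (fun w => (Z w)%:E).
Proof.
have i1 : P.-integrable setT (fun w => (1 + Z w ^+ 2)%:E).
  under eq_fun do rewrite EFinD; apply: integrableD => //; last exact: gaussian_sqr_integrable.
  exact: (bm_integrable P (bm_cst 1)).
apply: (le_integrable _ _ _ i1) => //; first exact/measurable_EFinP.
move=> w _ /=; rewrite lee_fin [leRHS]ger0_norm ?addr_ge0 ?sqr_ge0 //.
rewrite ler_norml; apply/andP; split.
  by have := sqr_ge0 (Z w + 1); rewrite sqrrD; have := sqr_ge0 (Z w); lra.
by have := sqr_ge0 (Z w - 1); rewrite sqrrB; have := sqr_ge0 (Z w); lra.
Qed.

(** Since sin(t Z) has mean zero, t E Z is the mean of t Z - sin(t Z), which is of order t^2 by the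
    second moment. *)
Lemma gaussian_mean : (\int[P]_w (Z w)%:E = 0)%E.
Proof.
have fm : (\int[P]_w (Z w)%:E)%E \is a fin_num by apply: integrable_fin_num => //; exact: gaussian_integrable.
rewrite -(fineK fm); congr (_%:E); rewrite -[fine _]/(Ex P Z).
have bsin t : bm (fun w => sin (t * Z w)).
  by under eq_fun do rewrite -cosBpihalf; exact: bcos.
have Es t : Ex P (fun w => sin (t * Z w)) = 0.
  under [X in Ex P X]eq_fun do rewrite -cosBpihalf.
  by rewrite HZ cosN cos_pihalf mul0r.
have sinE (x : R) : `|x - sin x| <= 2 * x ^+ 2.
  rewrite -(real_normK (num_real x)); have [x1|/ltW x1] := leP `|x| 1.
    rewrite distrC; apply: le_trans (sin_taylor x) _.
    rewrite exprSr; apply: (@le_trans _ _ (`|x| ^+ 2 * 1)); first by rewrite ler_wpM2l ?sqr_ge0.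
    by have := sqr_ge0 `|x|; lra.
  apply: le_trans (ler_normB _ _) _.
  have := sin_lipschitz x 0; rewrite sin0 !subr0 => h.
  have : `|x| * 1 <= `|x| * `|x| by rewrite ler_wpM2l.
  by rewrite expr2; lra.
have mg t : measurable_fun setT (fun w => t * Z w - sin (t * Z w)).
  by apply: measurable_funB; [exact: measurable_funM|exact: (bsin t).1].
have ig t : P.-integrable setT (fun w => (t * Z w)%:E).
  by under eq_fun do rewrite EFinM; apply: integrableZl => //; exact: gaussian_integrable.
have bd t : `|t * Ex P Z| <= 2 * t ^+ 2 * v.
  have -> : t * Ex P Z = Ex P (fun w => t * Z w - sin (t * Z w)).
    rewrite /Ex RintegralB //; [|exact: ig|exact: (bm_integrable P (bsin t))].
    by rewrite -/(Ex P (fun w => sin (t * Z w))) Es subr0 RintegralZl //; exact: gaussian_integrable.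
  rewrite -lee_fin -abse_EFin /Ex /Rintegral fineK; last first.
    apply: integrable_fin_num => //; under eq_fun do rewrite EFinB.
    by apply: integrableB => //; exact: (bm_integrable P (bsin t)).
  apply: le_trans (le_abse_integral _ _ _) _ => //; first exact/measurable_EFinP.
  rewrite [leRHS]EFinM -gaussian_second_moment -ge0_integralZl //; last 3 first.
  - by apply/measurable_EFinP; exact: measurable_funX.
  - by move=> w _; rewrite lee_fin sqr_ge0.
  - by rewrite lee_fin mulr_ge0 // sqr_ge0.
  apply: ge0_le_integral => //.
  - by apply: measurableT_comp => //; exact/measurable_EFinP.
  - by under eq_fun do rewrite -EFinM; apply/measurable_EFinP; apply: measurable_funM => //; exact: measurable_funX.
  by move=> w _; rewrite -EFinM abse_EFin lee_fin; have := sinE (t * Z w); rewrite exprMn mulrA.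
apply: (seq_unique (u := fun=> Ex P Z)); first exact: cvg_cst.
(* [bd] is applied at the square of [t_ n], to match the quadratic rate. *)
apply: (@quad_cvg (2 * v)) => n; rewrite subr0.
have tp : 0 < t_ n ^+ 2 by rewrite exprn_gt0.
rewrite -(ler_pM2l tp) -{1}(gtr0_norm tp) -normrM; apply: le_trans (bd _) _.
by rewrite le_eqVlt; apply/orP; left; apply/eqP; ring.
Qed.

End gaussian_variable.

Section gaussian_laws.
Context {R : realType}.

Lemma gaussian_charfun_sin dT (T : measurableType dT) (P : probability T R) Z v t :
  gaussian_charfun P Z v -> Ex P (fun w => sin (t * Z w)) = 0.
Proof.
move=> [_ HZ]; under [X in Ex P X]eq_fun do rewrite -cosBpihalf.
by rewrite HZ cosN cos_pihalf mul0r.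
Qed.

Lemma gaussian_charfun_cos dT (T : measurableType dT) (P : probability T R) Z v t :
  gaussian_charfun P Z v -> Ex P (fun w => cos (t * Z w)) = expR (- (t ^+ 2 * v / 2)).
Proof.
move=> [_ HZ]; have := HZ t 0; rewrite cos0 mul1r => <-; congr Ex.
by apply/funext => w; rewrite addr0.
Qed.

Lemma gaussian_charfun_law d1 (T1 : measurableType d1) (P1 : probability T1 R)
    d2 (T2 : measurableType d2) (P2 : probability T2 R) Z1 Z2 v :
  gaussian_charfun P1 Z1 v -> gaussian_charfun P2 Z2 v ->
  forall A : set R, measurable A -> P1 (Z1 @^-1` A) = P2 (Z2 @^-1` A).
Proof.
move=> g1 g2 A mA.
have dot1 dS (S : measurableType dS) (Z : S -> R) theta w :
    dot theta (vec (fun _ : 'I_1 => Z) w) = theta 0 0 * Z w.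
  by rewrite /dot big_ord1 mxE.
have sc : same_charfun P1 P2 (fun _ : 'I_1 => Z1) (fun _ : 'I_1 => Z2).
  move=> theta; split.
    under [X in Ex P1 X]eq_fun do rewrite dot1; under [X in Ex P2 X]eq_fun do rewrite dot1.
    by rewrite (gaussian_charfun_cos _ g1) (gaussian_charfun_cos _ g2).
  under [X in Ex P1 X]eq_fun do rewrite dot1; under [X in Ex P2 X]eq_fun do rewrite dot1.
  by rewrite (gaussian_charfun_sin _ g1) (gaussian_charfun_sin _ g2).
have mB : measurable [set t : 1.-tuple R | A (tnth t ord0)].
  by have := measurable_tnth (ord0 : 'I_1) measurableT mA; rewrite setTI.
have := tuple_law_unique (fun=> g1.1) (fun=> g2.1) sc mB.
rewrite /preimage /tup /=.
under [X in P1 X = _]eq_set do rewrite tnth_mktuple.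
by under [X in _ = P2 X]eq_set do rewrite tnth_mktuple.
Qed.

Lemma gaussian_charfun_gaussian dT (T : measurableType dT) (P : probability T R) Z v :
  gaussian_charfun P Z v -> gaussian_law (pushforward P Z).
Proof.
move=> gZ; have v0 := gaussian_variance_ge0 gZ.
exists 0, (Num.sqrt v); split => [|A mA]; first exact: sqrtr_ge0.
(* For v = 0 the comparison is with the constant 0, whose law is the Dirac mass. *)
rewrite /pushforward sqrtr_eq0; case: ifP => [v1|/negbT]; last rewrite -ltNge => v1.
  have ve : v = 0 by apply/le_anti; rewrite v1.
  have g0 : gaussian_charfun P (fun=> 0) v.
    split; first exact: measurable_cst.
    move=> t phi; under [X in Ex P X]eq_fun do rewrite mulr0 add0r.
    by rewrite Ex_cst ve mulr0 mul0r oppr0 expR0 mulr1.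
  rewrite (gaussian_charfun_law gZ g0 mA) diracE.
  case: (boolP (0 \in A)) => [|/negP] h.
    rewrite (_ : _ @^-1` A = setT) ?probability_setT //; apply/seteqP; split => // w _.
    by rewrite inE in h.
  by rewrite (_ : _ @^-1` A = set0) ?measure0 //; apply/seteqP; split => // w /= Aw; apply: h; rewrite inE.
pose N : probability (measurableTypeR R) R := normal_prob 0 (Num.sqrt v).
have gN : gaussian_charfun N idfun v.
  split; first by move=> _ B mB; rewrite setTI.
  move=> t phi; rewrite -[in RHS](sqr_sqrtr v0) -normal_charfun ?sqrtr_gt0 //.
exact: (gaussian_charfun_law gZ gN mA).
Qed.

End gaussian_laws.

(** * From characteristic functions to a stationary Gaussian process *)

Section gaussian_process.
Context {R : realType} dT {T : measurableType dT} (P : probability T R).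
Variables (Y : int -> T -> R) (kappa : int -> R).
Hypothesis mY : forall m, measurable_fun setT (Y m).
Hypothesis kappaN : forall m, kappa (- m) = kappa m.
Hypothesis HY : forall n (m : 'I_n -> int) (c : 'I_n -> R) (phi : R),
  Ex P (fun w => cos (\sum_i c i * Y (m i) w + phi))
  = cos phi * expR (- ((\sum_i \sum_j c i * c j * kappa (m j - m i)) / 2)).

Lemma linear_combination_charfun n (m : 'I_n -> int) (c : 'I_n -> R) :
  gaussian_charfun P (fun w => \sum_i c i * Y (m i) w)
    (\sum_i \sum_j c i * c j * kappa (m j - m i)).
Proof.
split; first by apply: measurable_sum => i; exact: measurable_funM.
move=> t phi; under [X in Ex P X]eq_fun do rewrite mulr_sumr.
under [X in Ex P X]eq_fun do under eq_bigr do rewrite mulrA.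
rewrite HY; congr (_ * expR (- (_ / 2))); rewrite mulr_sumr; apply: eq_bigr => i _.
by rewrite mulr_sumr; apply: eq_bigr => j _; ring.
Qed.

Lemma pair_charfun m m' (e : R) :
  gaussian_charfun P (fun w => Y m w + e * Y m' w) (kappa 0 + 2 * e * kappa (m' - m) + e ^+ 2 * kappa 0).
Proof.
have := @linear_combination_charfun 2 (fun i => if i == ord0 then m else m') (fun i => if i == ord0 then 1 else e).
under [X in gaussian_charfun P X]eq_fun do rewrite big_ord_recl big_ord1 /= mul1r.
rewrite !big_ord_recl !big_ord0 /= !addr0 !mul1r !subrr !mulr1 -(kappaN (m - m')) opprB.
by congr (gaussian_charfun P _ _); ring.
Qed.

Lemma single_charfun m : gaussian_charfun P (Y m) (kappa 0).
Proof.
have := pair_charfun m m 0; rewrite mulr0 mul0r expr0n mul0r !addr0.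
by under [X in gaussian_charfun P X]eq_fun do rewrite mul0r addr0.
Qed.

(** Polarisation: the product is a quarter of the difference of the squares of the sum and the
    difference, both Gaussian. *)
Lemma process_cross_moment m m' : P.-integrable setT (fun w => (Y m w * Y m' w)%:E) /\
  (\int[P]_w (Y m w * Y m' w)%:E = (kappa (m' - m))%:E)%E.
Proof.
have gp := pair_charfun m m' 1; have gm := pair_charfun m m' (-1).
have ip := gaussian_sqr_integrable gp; have im := gaussian_sqr_integrable gm.
have E w : ((Y m w * Y m' w)%:E = 4^-1%:E * (((Y m w + 1 * Y m' w) ^+ 2)%:E - ((Y m w + -1 * Y m' w) ^+ 2)%:E))%E.
  by rewrite -EFinB -EFinM; congr (_%:E); field.
split; first by under eq_fun do rewrite E; apply: integrableZl => //; exact: integrableB.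
under eq_integral do rewrite E.
rewrite integralZl //; last exact: integrableB.
rewrite integralB // (gaussian_second_moment gp) (gaussian_second_moment gm) -EFinB -EFinM.
by congr (_%:E); field.
Qed.

Variable u : R -> int.

Definition process (s : R) : {RV P >-> R} := mfun_Sub (mem_set (mY (u s))).

Lemma process_gaussian D : gaussian_process D process.
Proof.
move=> n s c _; exact: (gaussian_charfun_gaussian (linear_combination_charfun (fun i => u (s i)) c)).
Qed.

Lemma process_mean D : mean_zero D process.
Proof. by move=> s _; rewrite unlock; exact: (gaussian_mean (single_charfun (u s))). Qed.

Lemma process_covariance D : has_covariance D process (fun s t => kappa (u t - u s)).
Proof.
move=> s t Ds Dt; have [i1 E1] := process_cross_moment (u s) (u t).
rewrite covarianceE; [|exact/Lfun1_integrable/(gaussian_integrable (single_charfun _))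
  |exact/Lfun1_integrable/(gaussian_integrable (single_charfun _))|exact/Lfun1_integrable].
rewrite (process_mean Ds) mul0e sube0 unlock; exact: E1.
Qed.

(** Increments of [u] have to be translation invariant only along [D], because rounding to the
    lattice is not additive off it. *)
Lemma process_stationary D :
  (forall s t v, D s -> D t -> D (s + v) -> D (t + v) -> u (t + v) - u (s + v) = u t - u s) ->
  stationary_process D process.
Proof.
move=> Du n s v Ds Dsv B mB.
have dotE (r : 'I_n -> R) theta w :
    dot (theta : 'rV[R]_n) (vec (fun i => Y (u (r i))) w) = \sum_i theta 0 i * Y (u (r i)) w.
  by apply: eq_bigr => i _; rewrite mxE.
have sc : same_charfun P P (fun i => Y (u (s i + v))) (fun i => Y (u (s i))).
  have vE (theta : 'rV[R]_n) : \sum_i \sum_j theta 0 i * theta 0 j * kappa (u (s j + v) - u (s i + v))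
      = \sum_i \sum_j theta 0 i * theta 0 j * kappa (u (s j) - u (s i)) :> R.
    by apply: eq_bigr => i _; apply: eq_bigr => j _; rewrite Du.
  have g1 (theta : 'rV[R]_n) := linear_combination_charfun (fun i => u (s i + v)) (fun i => theta 0 i).
  have g2 (theta : 'rV[R]_n) := linear_combination_charfun (fun i => u (s i)) (fun i => theta 0 i).
  move=> theta; split.
    under [X in Ex P X = _]eq_fun do rewrite dotE -[\sum_i _]mul1r.
    under [X in _ = Ex P X]eq_fun do rewrite dotE -[\sum_i _]mul1r.
    by rewrite (gaussian_charfun_cos _ (g1 theta)) (gaussian_charfun_cos _ (g2 theta)) vE.
  under [X in Ex P X = _]eq_fun do rewrite dotE -[\sum_i _]mul1r.
  under [X in _ = Ex P X]eq_fun do rewrite dotE -[\sum_i _]mul1r.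
  by rewrite (gaussian_charfun_sin _ (g1 theta)) (gaussian_charfun_sin _ (g2 theta)).
exact: (tuple_law_unique (fun i => mY _) (fun i => mY _) sc mB).
Qed.

End gaussian_process.

(** * The limiting kernel and the normalised slices *)

Section limit_process.
Context {R : realType} {d : nat} (beta h : R) (mu : probability (config d) R).
Hypotheses (b0 : 0 <= beta) (h0 : 0 < h) (hmu : ising_measure beta h mu).
Local Notation E := (Ex mu).
Local Notation cubeM := (cube d.-1).
Implicit Types (M : nat) (t : int).

Definition spin_sum M t (z : config d) : R := \sum_(y <- cubeM M) sgx (pt t y) z.

Lemma local_spin_sum M t : local (spin_sum M t).
Proof. by apply: local_sum => y; exact: local_sg. Qed.

Let bm_spin_sum M t : bm (spin_sum M t).
Proof. exact/local_bm/local_spin_sum. Qed.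

Lemma Cov_spin_sum M t t' : Cov mu (spin_sum M t) (spin_sum M t') = slice_cov mu M (t' - t).
Proof.
have E1 s : spin_sum M s = (fun z => \sum_(y <- cubeM M) 1 * sgx (pt s y) z).
  by apply/funext => z; apply: eq_bigr => y _; rewrite mul1r.
rewrite {1}E1 Cov_suml; [|by move=> y; exact: local_sg|exact: local_spin_sum].
apply: eq_bigr => y _; rewrite mul1r CovC E1 Cov_suml; [|by move=> y'; exact: local_sg|exact: local_sg].
by apply: eq_bigr => y' _; rewrite mul1r CovC (Cov_sgx b0 h0 hmu).
Qed.

Lemma Cov_centred f : bm f -> Cov mu f f = E (fun z => (f z - E f) ^+ 2).
Proof.
move=> bf.
have -> : (fun z => (f z - E f) ^+ 2) = (fun z => (f z * f z - (2 * E f) * f z) + E f * E f).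
  by apply/funext => z; ring.
rewrite ExD; [|by apply: bmB; [exact: bmM|exact: bmZ]|exact: bm_cst].
by rewrite ExB; [|exact: bmM|exact: bmZ]; rewrite ExZ // Ex_cst /Cov; ring.
Qed.

Lemma bm_centred_sqr f : bm f -> bm (fun z => (f z - E f) ^+ 2).
Proof.
move=> bf; have bfc : bm (fun z => f z - E f) by apply: bmB => //; exact: bm_cst.
exact: (bmM bfc bfc).
Qed.

Lemma Cov_ge0 f : bm f -> 0 <= Cov mu f f.
Proof.
move=> bf; rewrite Cov_centred // -[X in X <= _](Ex_cst mu 0).
by apply: le_Ex => [||z]; [exact: bm_cst|exact: bm_centred_sqr|rewrite sqr_ge0].
Qed.

Definition kernel t : R := kap mu t / kap mu 0.

(** Inherited from the symmetry of the covariance of two slice sums, before the limit. *)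
Lemma kernelN t : kernel (- t) = kernel t.
Proof.
have E1 M : slice_cov mu M (- t) = slice_cov mu M t.
  by rewrite -[t in RHS]subr0 -Cov_spin_sum CovC Cov_spin_sum sub0r.
have H1 := @slice_cov_ratio_cvg _ _ _ _ _ b0 h0 hmu (- t).
have H2 := @slice_cov_ratio_cvg _ _ _ _ _ b0 h0 hmu t.
apply: seq_unique H2; move: H1.
by under eq_fun do rewrite E1.
Qed.

(** The quadratic form is a limit of normalised variances of linear combinations of slice sums. *)
Lemma kernel_psd (u : nat -> int) : psd (fun i j => kernel (u j - u i)).
Proof.
split=> [i j|l]; first by rewrite -kernelN opprB.
pose q M := \sum_(p <- l) \sum_(p' <- l) p.1 * p'.1 * (slice_cov mu M (u p'.2 - u p.2) / slice_cov mu M 0).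
have q0 M : 0 <= q M.
  pose f z := \sum_(p <- l) p.1 * spin_sum M (u p.2) z.
  have lf : local f by apply: local_sum => p; apply: localM; [exact: local_cst|exact: local_spin_sum].
  have -> : q M = Cov mu f f / slice_cov mu M 0.
    rewrite /f Cov_suml; [|by move=> p; exact: local_spin_sum|exact: lf].
    rewrite /q mulr_suml; apply: eq_bigr => p _.
    rewrite CovC Cov_suml; [|by move=> p'; exact: local_spin_sum|exact: local_spin_sum].
    rewrite mulr_sumr mulr_suml; apply: eq_bigr => p' _.
    by rewrite CovC Cov_spin_sum; ring.
  by rewrite divr_ge0 ?Cov_ge0 ?(ltW (slice_cov0_gt0 b0 h0 hmu M)) //; exact: local_bm.
apply: (seq_le (u := fun=> 0) (v := q)); [exact: seq_cst| |exact: nearW].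
by apply: seq_sum => p; apply: seq_sum => p'; apply: seqZ; exact: (slice_cov_ratio_cvg b0 h0 hmu).
Qed.

Lemma limit_variables : exists (P : probability coins R) (Y : int -> coins -> R),
  (forall t, measurable_fun setT (Y t)) /\
  forall n (k : 'I_n -> int) (c : 'I_n -> R) (phi : R),
    Ex P (fun w => cos (\sum_i c i * Y (k i) w + phi))
    = cos phi * expR (- ((\sum_i \sum_j c i * c j * kernel (k j - k i)) / 2)).
Proof.
(* Numbering the integers turns the process into a sequence; the default 0 fills the codes of no
   integer. *)
pose u (m : nat) : int := odflt 0 (choice.unpickle m).
have [P [Y [mY HY]]] := gaussian_family (kernel_psd u).
exists P, (fun t => Y (choice.pickle t)); split=> [t|n k c phi]; first exact: mY.
rewrite (HY n (fun i => choice.pickle (k i))); congr (_ * expR (- (_ / 2))).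
by apply: eq_bigr => i _; apply: eq_bigr => j _; rewrite /u !choice.pickleK.
Qed.

Definition normalised M t (z : config d) : R :=
  scale mu M * \sum_(y <- cubeM M) (sgx (pt t y) z - E (sgx (pt t y))).

Lemma local_normalised M t : local (normalised M t).
Proof.
apply: localM; first exact: local_cst.
by apply: local_sum => y; apply: localB; [exact: local_sg|exact: local_cst].
Qed.

Lemma normalisedE M t z : normalised M t z = scale mu M * (spin_sum M t z - E (spin_sum M t)).
Proof.
rewrite /normalised sumrB Ex_sum // => y; exact/local_bm/local_sg.
Qed.

Lemma Ex_normalised_sqr M t : E (fun z => normalised M t z ^+ 2) = 1.
Proof.
have s0 := slice_cov0_gt0 b0 h0 hmu M.
under [X in E X]eq_fun do rewrite normalisedE exprMn (scale_sqr b0 h0 hmu).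
rewrite ExZ; last exact: bm_centred_sqr.
by rewrite -Cov_centred // Cov_spin_sum subrr mulVf ?gt_eqF.
Qed.

Lemma normalised_tight e : 0 < e -> exists K0 : R, forall K, K0 <= K -> forall M t,
  E (\1_(exceeds K (normalised M t))) <= e.
Proof.
(* Chebyshev with unit variance gives 1 / K^2, and K >= 1 + 1 / e gives K^2 >= K >= 1 / e. *)
move=> e0; exists (1 + e^-1) => K HK M t.
have ei : 0 < e^-1 by rewrite invr_gt0.
have K1 : 1 <= K by move: HK ei; lra.
have K0 : 0 < K by move: K1; lra.
have bn : bm (normalised M t) by exact/local_bm/local_normalised.
have bn2 : bm (fun z => normalised M t z ^+ 2) by exact: (bmM bn bn).
have K2 : 0 < K ^+ 2 by rewrite exprn_gt0.
have H : E (\1_(exceeds K (normalised M t))) <= E (fun z => (K ^+ 2)^-1 * normalised M t z ^+ 2).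
  apply: le_Ex => [||z]; [by apply/bm_indic/measurable_exceeds; case: bn|exact: bmZ|].
  rewrite indicE; case: (boolP (z \in _)) => [|_] /=; last by rewrite mulr_ge0 ?sqr_ge0 // invr_ge0 sqr_ge0.
  rewrite inE /exceeds /= => Kz; rewrite mulrC ler_pdivlMr // mul1r -(real_normK (num_real (normalised _ _ _))).
  by rewrite lerXn2r ?nnegrE ?(ltW K0) // ltW.
apply: le_trans H _; rewrite ExZ // Ex_normalised_sqr mulr1 -[leRHS]invrK.
rewrite lef_pV2 ?posrE //; apply: (@le_trans _ _ K); first by move: HK; lra.
by rewrite expr2 ler_peMr // ltW.
Qed.

Lemma slice_field_normalised n (k : 'I_n -> int) theta M z :
  slice_field mu k theta M z = \sum_i theta i * normalised M (k i) z.
Proof. by rewrite /slice_field mulr_sumr; apply: eq_bigr => i _; rewrite mulrCA. Qed.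

Hypothesis d2 : (2 <= d)%N.

Lemma normalised_cvg (P : probability coins R) (Y : int -> coins -> R) n (k : 'I_n -> int)
    (f : 'rV[R]_n -> R) (B : R) :
  (forall t, measurable_fun setT (Y t)) ->
  (forall (c : 'I_n -> R) (phi : R),
    Ex P (fun w => cos (\sum_i c i * Y (k i) w + phi))
    = cos phi * expR (- ((\sum_i \sum_j c i * c j * kernel (k j - k i)) / 2))) ->
  injective k -> continuous f -> (forall x, `|f x| <= B) ->
  E (fun z => f (\row_i normalised M (k i) z)) @[M --> \oo] --> Ex P (fun w => f (\row_i Y (k i) w)).
Proof.
move=> mY HY injk cf fB.
have dotE dS (S : measurableType dS) (Z : 'I_n -> S -> R) (theta : 'rV[R]_n) w : dot theta (vec Z w) = \sum_i theta 0 i * Z i w.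
  by apply: eq_bigr => i _; rewrite mxE.
apply: (levy_continuity (Y := fun M i => normalised M (k i)) (Z := fun i => Y (k i))) cf fB => //.
- by move=> M i; exact: (local_bm (local_normalised M (k i))).1.
- by move=> e /normalised_tight [K0 H]; exists K0 => K KK m i; exact: H.
- move=> theta.
  have -> : Ex P (fun w => cos (dot theta (vec (fun i => Y (k i)) w)))
      = expR (- (limit_var mu k (fun i => theta 0 i) / 2)).
    transitivity (Ex P (fun w => cos (\sum_i theta 0 i * Y (k i) w + 0))).
      by congr Ex; apply/funext => w; rewrite dotE addr0.
    by rewrite (HY (fun i => theta 0 i) 0) cos0 mul1r.
  under eq_fun do under [X in E X]eq_fun do rewrite dotE -slice_field_normalised.
  exact: (slice_field_cos_cvg b0 h0 hmu injk d2).
- move=> theta.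
  have -> : Ex P (fun w => sin (dot theta (vec (fun i => Y (k i)) w))) = 0.
    transitivity (Ex P (fun w => cos (\sum_i theta 0 i * Y (k i) w + - (pi / 2)))).
      by congr Ex; apply/funext => w; rewrite dotE cosBpihalf.
    by rewrite (HY (fun i => theta 0 i)) cosN cos_pihalf mul0r.
  under eq_fun do under [X in E X]eq_fun do rewrite dotE -slice_field_normalised.
  exact: (slice_field_sin_cvg b0 h0 hmu _ injk d2).
Qed.

End limit_process.

(** * Lattice indices and the real parameter L *)

Section translation.
Context {R : realType} {d : nat} (a beta h : R) (mu : probability (config d) R).
Hypotheses (a0 : 0 < a) (b0 : 0 <= beta) (h0 : 0 < h) (hmu : ising_measure beta h mu).
Implicit Types (L s u : R).

Lemma beta_c_ge0 : 0 <= beta_c d :> R.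
Proof.
rewrite /beta_c; set A := [set _ | _]; have [A0|/set0P/negP/negPn/eqP ->] := pselect (A !=set0).
  by apply: lb_le_inf => // x [].
(* The infimum of the empty set is 0 by convention. *)
by rewrite inf0.
Qed.

Lemma avgE f : bm f -> avg mu f = Ex mu f.
Proof. by move=> bf; rewrite /avg (expectationE mu bf). Qed.

Lemma slice_truncatedE u : slice_truncated mu a u = slice_corr mu (nearest a u).
Proof.
apply/funext => y; have bs x : bm (sgx x : config d -> R) by exact/local_bm/local_sg.
by rewrite /slice_truncated /truncated !avgE //; exact: bmM.
Qed.

Lemma nearest_lattice (k : int) : nearest a (a * k%:~R) = k.
Proof.
rewrite /nearest mulrAC mulfV ?gt_eqF // mul1r; apply/floor_def.
by apply/andP; split; rewrite ?rmorphD /=; lra.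
Qed.

Lemma KhatE s t : lattice a s -> lattice a t -> Khat mu a (t - s) = kernel mu (nearest a t - nearest a s).
Proof.
move=> [k ->] [l ->]; rewrite /Khat !slice_truncatedE -mulrBr -rmorphB /= !nearest_lattice.
by have := nearest_lattice 0; rewrite mulr0 => ->.
Qed.

(** For L >= 0 the slice depends on L only through this integer, so limits along cubes give limits
    in real L. *)
Definition radius L : nat := `|Num.floor (L / a)|%N.

Lemma sliceE L : 0 <= L -> @slice R d a L = [set` cube d.-1 (radius L)].
Proof.
move=> L0; have f0 : 0 <= Num.floor (L / a) by rewrite floor_ge0 divr_ge0 // ltW.
apply/seteqP; split => y; rewrite /slice /= mem_cube => H; [apply/forallP => i|move=> i].
  rewrite /radius gez0_abs // floor_ge_int intr_norm ler_pdivlMr // mulrC.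
  by rewrite -[X in X * _](gtr0_norm a0) -normrM; exact: H.
move/forallP: H => /(_ i); rewrite /radius gez0_abs // floor_ge_int intr_norm.
by rewrite ler_pdivlMr // mulrC normrM (gtr0_norm a0).
Qed.

Lemma slice_fsum L (F : 'rV[int]_d.-1 -> R) : 0 <= L ->
  \sum_(y \in @slice R d a L) F y = \sum_(y <- cube d.-1 (radius L)) F y.
Proof. by move=> L0; rewrite sliceE // -fsbig_seq. Qed.

Lemma variance_Cov f : bm f -> fine ('V_mu[f])%E = Cov mu f f.
Proof.
move=> bf; rewrite Cov_centred // /variance unlock (expectationE mu bf) /=.
have bc : bm (fun z => (f z - Ex mu f) * (f z - Ex mu f)).
  by apply: bmM; apply: bmB => //; exact: bm_cst.
by rewrite (expectationE mu bc).
Qed.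

Lemma XhatE L s z : 0 <= L -> Xhat mu a L s z = normalised mu (radius L) (nearest a s) z.
Proof.
move=> L0; have sE : slice_sum a L s = spin_sum (radius L) (nearest a s) :> (config d -> R).
  by apply/funext => w; rewrite /slice_sum slice_fsum.
rewrite /Xhat sE variance_Cov; last exact/local_bm/local_spin_sum.
rewrite (Cov_spin_sum b0 h0 hmu) subrr /centred_slice_sum slice_fsum // /normalised mulrC.
congr (_ * _); apply: eq_bigr => y _; rewrite avgE //; exact/local_bm/local_sg.
Qed.

Lemma radius_cvg N : exists L0, forall L, L0 < L -> 0 <= L /\ (N <= radius L)%N.
Proof.
exists (a * N%:R) => L HL; have L0 : 0 <= L by apply: le_trans (ltW HL); rewrite mulr_ge0 // ltW.
split => //; rewrite -lez_nat /radius gez0_abs ?floor_ge0 ?divr_ge0 ?(ltW a0) //.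
by rewrite floor_ge_int ler_pdivlMr // mulrC ltW.
Qed.

End translation.

(** The summability clause certifies that the values of [family_sum] in [Khat] are sums of
    absolutely summable families. *)
Theorem theorem4 (R : realType) (d : nat) (a h : R)
    (mu : probability (config d) R)
    (hd : (2 <= d)%N) (ha : 0 < a) (hh : 0 < h)
    (hmu : ising_measure (beta_c d) h mu) :
  (forall u, lattice a u ->
     summable [set: 'rV[int]_d.-1] (fun y => (slice_truncated mu a u y)%:E)) /\
  exists (dO : measure_display) (Omega : measurableType dO)
         (P : probability Omega R) (X : R -> {RV P >-> R}),
    [/\ gaussian_process (lattice a) X,
        mean_zero (lattice a) X,
        stationary_process (lattice a) X,
        has_covariance (lattice a) X (fun s t => Khat mu a (t - s)) &
        forall (n : nat) (s : 'I_n -> R),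
          (forall i, lattice a (s i)) -> injective s ->
          cvg_in_distribution mu P
            (fun L eta => \row_(i < n) Xhat mu a L (s i) eta)
            (fun w => \row_(i < n) X (s i) w)].
Proof.
have b0 : 0 <= beta_c d :> R := beta_c_ge0.
split=> [u _|]; first by rewrite slice_truncatedE; have [] := slice_corr_family b0 hh hmu (nearest a u).
have [P [Y [mY HY]]] := limit_variables b0 hh hmu.
have kN := kernelN b0 hh hmu.
exists _, coins, P, (process P mY (nearest a)); split.
- exact: (process_gaussian mY HY).
- exact: (process_mean mY kN HY).
- apply: (process_stationary mY HY) => s t v [k ->] [l ->] [k' Ek] [l' El].
  rewrite Ek El !(nearest_lattice ha); apply/eqP; rewrite -(eqr_int R) !rmorphB /=.
  rewrite -(inj_eq (mulfI (lt0r_neq0 ha))) !mulrBr -Ek -El; apply/eqP; ring.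
- by move=> s t Ds Dt; rewrite (process_covariance mY kN HY (nearest a) Ds Dt) KhatE.
move=> n s Ls injs f cf [B fB].
have injk : injective (fun i => nearest a (s i)).
  move=> i j; have [k Ei] := Ls i; have [l Ej] := Ls j; rewrite Ei Ej !(nearest_lattice ha) => kl.
  by apply: injs; rewrite Ei Ej kl.
have -> : ('E_P[f \o (fun w => \row_(i < n) process P mY (nearest a) (s i) w)]
    = (Ex P (fun w => f (\row_i Y (nearest a (s i)) w)))%:E)%E.
  exact: (expectationE P (bm_continuous cf fB (fun i => mY (nearest a (s i))))).
have H : (Ex mu (fun z => f (\row_i normalised mu M (nearest a (s i)) z)))%:E @[M --> \oo]
    --> (Ex P (fun w => f (\row_i Y (nearest a (s i)) w)))%:E.
  apply: cvg_EFin; first exact: nearW.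
  exact: (normalised_cvg b0 hh hmu hd mY (HY n (fun i => nearest a (s i))) injk cf fB).
(* Transfers the limit along the integers M to real L: once L is large, [radius a L] is at least
   [N]. *)
move=> A /H [N _ HN]; have [L0 HL] := radius_cvg ha N.
exists L0; split; first exact: num_real.
move=> L /HL [L0' NL]; have := HN _ NL; rewrite /=.
have bn : bm (fun z => f (\row_i normalised mu (radius a L) (nearest a (s i)) z)).
  exact: (bm_continuous cf fB (fun i => (local_bm (local_normalised mu (radius a L) (nearest a (s i)))).1)).
rewrite -(expectationE mu bn); congr A; congr expectation; apply/funext => z /=; congr f.
by apply/rowP => i; rewrite !mxE (XhatE ha b0 hh hmu).
Qed.
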